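(* Let $r\ge 1$, let $(A;M_1,\dots,M_r)$ be an admissible system (as defined in the context) and let $(D,\delta)$ be a decoration of $A$. Then the associated $C^*$-algebra $\mathcal{A}=\mathcal{A}_D$ is simple.
   Context: Notation. $\mathbb{Z}_+$ is the set of nonnegative integers, $e_1,\dots,e_r$ is the standard basis of $\mathbb{Z}^r$; for $m,n\in\mathbb{Z}^r$, $m\le n$ is meant coordinatewise and $[m,n]=\{k\in\mathbb{Z}^r: m\le k\le n\}$. Words. Let $A$ be a finite nonempty set (the alphabet) and $M_1,\dots,M_r$ matrices with entries $M_j(b,a)$, $a,b\in A$. For $m\in\mathbb{Z}_+^r$ let $W_m$ be the set of maps $w:[0,m]\to A$ with $M_j(w(l+e_j),w(l))=1$ whenever $l,l+e_j\in[0,m]$ (words of shape $m$). For $w\in W_m$ put $\sigma(w)=m$, $o(w)=w(0)$, $t(w)=w(m)$. Let $W=\bigcup_m W_m$ and identify $A$ with $W_0$. For $0\le k\le l\le m$ and $w\in W_m$, $w|_{[k,l]}\in W_{l-k}$ is $i\mapsto w(i+k)$. For $0\ne p\in\mathbb{Z}^r$, a word $w\in W_l$ is $p$-periodic if $w(j)=w(j-p)$ for all $j\in[0,l]\cap[p,p+l]$. Admissible system. $(A;M_1,\dots,M_r)$ is called admissible if: (H0) each $M_i$ is a nonzero $\{0,1\}$-matrix; (H1) whenever $u\in W_m$, $v\in W_n$ and $t(u)=o(v)$ there is a unique $w\in W_{m+n}$ with $w|_{[0,m]}=u$ and $w|_{[m,m+n]}=v$ (this $w$ is written $uv$); (H2)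 the directed graph with vertex set $A$ and a directed edge from $a$ to $b$ for each $i$ with $M_i(b,a)=1$ is irreducible (there is a directed path from any vertex to any vertex); (H3) for each $p\in\mathbb{Z}^r$, $p\ne0$, there is some $w\in W$ which is not $p$-periodic. Decorations. A decoration is a nonempty finite or countable set $D$ with a map $\delta:D\to A$. Put $\overline W_m=\{(d,w)\in D\times W_m: o(w)=\delta(d)\}$, $\overline W=\bigcup_m\overline W_m$, with $o(d,w)=d$, $t(d,w)=t(w)$, $\sigma(d,w)=\sigma(w)$; identify $D$ with $\overline W_0$. For $\overline u=(d,u)\in\overline W$ and $v\in W$ with $t(u)=o(v)$ put $\overline u v=(d,uv)$. The algebra. $\mathcal{A}=\mathcal{A}_D$ is the universal $C^*$-algebra generated by partial isometries $s_{u,v}$, for $u,v\in\overline W$ with $t(u)=t(v)$, subject to the relations $s_{u,v}^*=s_{v,u}$; $s_{u,v}s_{v,w}=s_{u,w}$; $s_{u,v}=\sum s_{uw,vw}$ for each $1\le j\le r$, the sum being over all $w\in W$ with $\sigma(w)=e_j$ and $o(w)=t(u)=t(v)$; $s_{u,u}s_{v,v}=0$ for $u,v\in\overline W_0$, $u\ne v$. *)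

(* Defs.v *)
From HB Require Import structures.
From mathcomp Require Import all_boot all_order all_algebra.
From mathcomp Require Import complex.
From mathcomp Require Import all_classical all_reals all_analysis.

Set Implicit Arguments.
Unset Strict Implicit.
Unset Printing Implicit Defensive.

Import Order.TTheory GRing.Theory Num.Theory.

Local Open Scope classical_set_scope.
Local Open Scope ring_scope.
Local Open Scope complex_scope.

(** * C*-algebras *)

(* Not necessarily unital, and possibly zero, so the multiplication cannot come
   from the unital ring hierarchy. *)
HB.mixin Record CompleteNormedModule_isCStarAlgebra (R : realType) B
    of CompleteNormedModule R[i] B := {
  cmul : B -> B -> B ;
  cstar : B -> B ;
  cmulA : forall x y z, cmul x (cmul y z) = cmul (cmul x y) z ;
  cmulDl : forall x y z, cmul (x + y) z = cmul x z + cmul y z ;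
  cmulDr : forall x y z, cmul x (y + z) = cmul x y + cmul x z ;
  cmulZl : forall (c : R[i]) x y, cmul (c *: x) y = c *: cmul x y ;
  cmulZr : forall (c : R[i]) x y, cmul x (c *: y) = c *: cmul x y ;
  cstarK : forall x, cstar (cstar x) = x ;
  cstarD : forall x y, cstar (x + y) = cstar x + cstar y ;
  cstarZ : forall (c : R[i]) x, cstar (c *: x) = c^* *: cstar x ;
  cstarM : forall x y, cstar (cmul x y) = cmul (cstar y) (cstar x) ;
  cnormM : forall x y, `|cmul x y| <= `|x| * `|y| ;
  cnorm_cstar : forall x, `|cmul (cstar x) x| = `|x| ^+ 2
}.

#[short(type="cstarAlgType")]
HB.structure Definition CStarAlgebra (R : realType) :=
  {B of CompleteNormedModule R[i] B & CompleteNormedModule_isCStarAlgebra R B}.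

Definition star_hom (R : realType) (B C : cstarAlgType R) (phi : B -> C) : Prop :=
  [/\ linear phi,
      forall x y, phi (cmul x y) = cmul (phi x) (phi y)
    & forall x, phi (cstar x) = cstar (phi x)].

Definition cstar_subalgebra (R : realType) (B : cstarAlgType R) (S : set B) :
    Prop :=
  [/\ S 0,
      forall (c : R[i]) x y, S x -> S y -> S (c *: x + y),
      forall x y, S x -> S y -> S (cmul x y),
      forall x, S x -> S (cstar x)
    & closed S].

Definition closed_ideal (R : realType) (B : cstarAlgType R) (I : set B) : Prop :=
  [/\ I 0,
      forall (c : R[i]) x y, I x -> I y -> I (c *: x + y),
      forall x y, I y -> I (cmul x y),
      forall x y, I x -> I (cmul x y)
    & closed I].

Definition cstar_simple (R : realType) (B : cstarAlgType R) : Prop :=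
  (exists x : B, x != 0) /\
  (forall I : set B, closed_ideal I -> I = [set 0] \/ I = [set: B]).

(** * Words *)

(* Z_+^r and Z^r, with their pointwise structures. *)
Notation natvec r := {ffun 'I_r -> nat}.
Notation intvec r := {ffun 'I_r -> int}.

Definition unit_vec (r : nat) (j : 'I_r) : natvec r :=
  [ffun i => nat_of_bool (i == j)].

(* The integer box [0, m]. *)
Notation box r m := {dffun forall i : 'I_r, 'I_((m : natvec r) i).+1}.

Definition coords (r : nat) (m : natvec r) (l : box r m) : natvec r :=
  [ffun i => nat_of_ord (l i)].

(* The point x seen in [0, m]; meaningful only when x <= m (coordinates that are
   out of range are sent to 0). *)
Definition in_box (r : nat) (m x : natvec r) : box r m :=
  finfun (fun i : 'I_r => inord (x i) : 'I_(m i).+1).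

(* The entries are arbitrary integers: that they lie in {0,1} is part of (H0).
   The guard l j < m j says that l + e_j is in [0, m]. *)
Definition is_word (r : nat) (A : finType) (M : 'I_r -> A -> A -> int)
    (m : natvec r) (w : {ffun box r m -> A}) : bool :=
  [forall l : box r m, forall j : 'I_r,
    (l j < m j)%N ==> (M j (w (in_box m (coords l + unit_vec j))) (w l) == 1)].

Record word (r : nat) (A : finType) (M : 'I_r -> A -> A -> int) (m : natvec r) :=
  Word { letters :> {ffun box r m -> A} ; _ : is_word M letters }.

HB.instance Definition _ r A M m := [isSub for @letters r A M m].
HB.instance Definition _ r A M m := [Finite of @word r A M m by <:].

(* The map i |-> w(i + k) on [0, n], that is w|_[k,k+n]; meaningful only when
   k + n <= m. *)
Definition subword (r : nat) (A : finType) (m : natvec r)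
    (w : {ffun box r m -> A}) (k n : natvec r) : {ffun box r n -> A} :=
  [ffun i => w (in_box m (coords i + k))].

Definition worigin (r : nat) (A : finType) (M : 'I_r -> A -> A -> int)
    (m : natvec r) (w : word M m) : A := w (in_box m 0).

Definition wterminus (r : nat) (A : finType) (M : 'I_r -> A -> A -> int)
    (m : natvec r) (w : word M m) : A := w (in_box m m).

(* w|_[0,m] = u and w|_[m,m+n] = v *)
Definition is_concat (r : nat) (A : finType) (M : 'I_r -> A -> A -> int)
    (m n : natvec r) (u : word M m) (v : word M n) (w : word M (m + n)) : bool :=
  (subword w 0 m == letters u) && (subword w m n == letters v).

Definition periodic (r : nat) (A : finType) (M : 'I_r -> A -> A -> int)
    (p : intvec r) (l : natvec r) (w : word M l) : Prop :=
  forall j k : box r l, (forall i, (k i)%:Z = (j i)%:Z - p i) -> w j = w k.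

Record admissible (r : nat) (A : finType) (M : 'I_r -> A -> A -> int) : Prop :=
  Admissible {
    adm_H0 : forall i, (forall b a, M i b a = 0 \/ M i b a = 1) /\
                       (exists b a, M i b a <> 0) ;
    adm_H1 : forall (m n : natvec r) (u : word M m) (v : word M n),
      wterminus u = worigin v -> exists! w : word M (m + n), is_concat u v w ;
    adm_H2 : forall a b : A,
      connect (fun x y => [exists i, M i y x == 1]) a b ;
    adm_H3 : forall p : intvec r, p != 0 ->
      exists (l : natvec r) (w : word M l), ~ periodic p w
  }.

(* The set W of words of all shapes. *)
Definition words (r : nat) (A : finType) (M : 'I_r -> A -> A -> int) : Type :=
  {m : natvec r & word M m}.

Definition mkwords (r : nat) (A : finType) (M : 'I_r -> A -> A -> int)
    (m : natvec r) (w : word M m) : words M := Tagged (word M) w.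

Definition org (r : nat) (A : finType) (M : 'I_r -> A -> A -> int)
    (u : words M) : A := worigin (tagged u).

Definition trm (r : nat) (A : finType) (M : 'I_r -> A -> A -> int)
    (u : words M) : A := wterminus (tagged u).

(* The product uv. Under (H1), if t(u) = o(v) there is exactly one candidate;
   if there is none (which then forces t(u) <> o(v)) the value is u. *)
Definition concat (r : nat) (A : finType) (M : 'I_r -> A -> A -> int)
    (u v : words M) : words M :=
  if [pick w | is_concat (tagged u) (tagged v) w] is Some w
  then mkwords w else u.

Lemma org_concat (r : nat) (A : finType) (M : 'I_r -> A -> A -> int)
  (u v : words M) : org (concat u v) = org u.
Proof.
rewrite /concat; case: pickP => [w /andP[/eqP uw _]|//].
rewrite /org /worigin -uw ffunE addr0 /=; congr (letters w (in_box _ _)).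
by apply/ffunP => i; rewrite !ffunE inordK.
Qed.

(** * Decorated words *)

Record dword (r : nat) (A : finType) (M : 'I_r -> A -> A -> int)
    (D : countType) (delta : D -> A) := DWord {
  deco : D ;
  dunder : words M ;
  _ : org dunder == delta deco
}.

Definition dshape (r : nat) (A : finType) (M : 'I_r -> A -> A -> int)
    (D : countType) (delta : D -> A) (u : dword M delta) : natvec r :=
  tag (dunder u).

Definition dtrm (r : nat) (A : finType) (M : 'I_r -> A -> A -> int)
    (D : countType) (delta : D -> A) (u : dword M delta) : A :=
  trm (dunder u).

Lemma dconcat_subproof (r : nat) (A : finType) (M : 'I_r -> A -> A -> int)
  (D : countType) (delta : D -> A) (u : dword M delta) (v : words M) :
  org (concat (dunder u) v) == delta (deco u).
Proof. by rewrite org_concat; case: u. Qed.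

Definition dconcat (r : nat) (A : finType) (M : 'I_r -> A -> A -> int)
    (D : countType) (delta : D -> A) (u : dword M delta) (v : words M) :
    dword M delta := DWord (dconcat_subproof u v).

(** * The algebra A_D *)

(* A family s_{u,v} indexed by pairs with t(u) = t(v) is given as a total
   function of (u, v); its values at the other pairs are never used. *)
Record AD_relations (R : realType) (r : nat) (A : finType)
    (M : 'I_r -> A -> A -> int) (D : countType) (delta : D -> A)
    (B : cstarAlgType R) (s : dword M delta -> dword M delta -> B) : Prop :=
  ADRelations {
    AD_pisom : forall u v, dtrm u = dtrm v ->
      cmul (cmul (s u v) (cstar (s u v))) (s u v) = s u v ;
    AD_star : forall u v, dtrm u = dtrm v -> cstar (s u v) = s v u ;
    AD_mul : forall u v w, dtrm u = dtrm v -> dtrm v = dtrm w ->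
      cmul (s u v) (s v w) = s u w ;
    AD_sum : forall u v, dtrm u = dtrm v -> forall j : 'I_r,
      s u v = \sum_(w : word M (unit_vec j) | worigin w == dtrm u)
                s (dconcat u (mkwords w)) (dconcat v (mkwords w)) ;
    AD_orth : forall u v, dshape u = 0 -> dshape v = 0 -> u <> v ->
      cmul (s u u) (s v v) = 0
  }.

(* B is, via s, the universal C*-algebra generated by partial isometries
   s_{u,v} subject to the relations (that the morphism phi is unique follows
   from generation). *)
Record is_AD (R : realType) (r : nat) (A : finType)
    (M : 'I_r -> A -> A -> int) (D : countType) (delta : D -> A)
    (B : cstarAlgType R) (s : dword M delta -> dword M delta -> B) : Prop :=
  IsAD {
    AD_rel : AD_relations s ;
    AD_gen : forall S : set B, cstar_subalgebra S ->
      (forall u v, dtrm u = dtrm v -> S (s u v)) -> S = [set: B] ;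
    AD_univ : forall (C : cstarAlgType R)
        (t : dword M delta -> dword M delta -> C), AD_relations t ->
      exists2 phi : B -> C, star_hom phi &
        forall u v, dtrm u = dtrm v -> phi (s u v) = t u v
  }.

(* Main.v *)
Require Import Defs.
From HB Require Import structures.
From mathcomp Require Import all_boot all_order all_algebra.
From mathcomp Require Import separable cyclotomic cyclic.
From mathcomp Require Import complex.
From mathcomp Require Import all_classical all_reals all_analysis.
From mathcomp Require Import ring lra zify.

(** Write P_u = s_{u,u}.  The proof has two independent halves.

    A closed ideal I that contains some y <> 0 is everything.  Expand a finite
    combination of generators close to y in homogeneous components, the degree
    of s_{u,v} being shape(u) - shape(v).  Averaging the gauge automorphisms
    over roots of unity gives Fejer means that are contractive and converge on
    combinations of generators; hence some component T of the approximation is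
    large, with a lower bound that depends on y only [large_component].  After
    all first indices are brought to a common shape, star(T) T lies in a finite
    dimensional *-algebra spanned by matrix units s_{v,v'}, and star(T) times
    the other components only involves s_{v,v2} with v and v2 of different
    shapes.  A power iteration [growing_power_vec] finds a vector on which
    star(T) T is almost as large as its norm, which compresses the first part
    to a large multiple of some P_v.  By (H3) there is a word w that has none of
    the finitely many periods shape(v2) - shape(v); compressing by P_{vw} then
    kills everything else [aperiodic_compression].  So P_{vw} is at distance
    less than 1 from I, which forces it into I, and irreducibility (H2) spreads
    this to all generators.  Taking the component before compressing avoids the
    faithfulness of the conditional expectation, hence any spectral theory.

    Two facts about C*-algebras are needed and proved from the axioms: a
    star-homomorphism is contractive [star_hom_contractive], and projections
    that sum to a projection are orthogonal [projections_orthogonal], which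
    makes the s_{u,v} of a given shape matrix units.  Both rest on one
    construction, the square root of e - h for h small in a corner e B e, found
    as a fixed point; it exhibits a self-adjoint contraction as the real part
    of a unitary.

    The algebra is not zero.  By universality one nonzero family satisfying the
    relations suffices.  Infinite decorated words carry the partial bijections
    u x -> v x, and these act on functions on the set of infinite words.  The
    operators live on the finitely supported functions, a pre-Hilbert space;
    the C*-algebra is the completion of its bounded adjointable operators,
    realised inside the bounded sesquilinear forms. *)

Set Implicit Arguments.
Unset Strict Implicit.
Unset Printing Implicit Defensive.

Import Order.TTheory GRing.Theory Num.Theory.
Import numFieldNormedType.Exports.

Local Open Scope classical_set_scope.
Local Open Scope complex_scope.
Local Open Scope ring_scope.

(** * Linear combinations *)

(** A reflexive decision procedure for equalities of linear combinations:
    products in a possibly non-unital algebra are not ring expressions, so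
    after expansion they are treated as atoms of a left module. *)
Inductive lexp (K : Type) : Type :=
| LAtom of nat | LZero | LAdd of lexp K & lexp K | LOpp of lexp K
| LScale of K & lexp K.
Arguments LZero {K}.
Arguments LAtom {K}.

Fixpoint leval (K : pzRingType) (V : lmodType K) (env : seq V) (a : lexp K) : V :=
  match a with
  | LAtom n => nth 0 env n
  | LZero => 0
  | LAdd a b => leval env a + leval env b
  | LOpp a => - leval env a
  | LScale c a => c *: leval env a
  end.

Fixpoint lcoef (K : pzRingType) (a : lexp K) (n : nat) : K :=
  match a with
  | LAtom m => if eqn m n then 1 else 0
  | LZero => 0
  | LAdd a b => lcoef a n + lcoef b n
  | LOpp a => - lcoef a n
  | LScale c a => c * lcoef a n
  end.

Fixpoint lall (K : pzRingType) (a b : lexp K) (n : nat) : Prop :=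
  if n is n'.+1 then lall a b n' /\ lcoef a n' = lcoef b n' else True.

Lemma leval_coef (K : pzRingType) (V : lmodType K) (env : seq V) (a : lexp K) :
  leval env a = \sum_(n < size env) lcoef a n *: nth 0 env n.
Proof.
elim: a => [m||a IHa b IHb|a IHa|c a IHa] /=.
- have [mn|nm] := ltnP m (size env); last first.
    rewrite nth_default // big1 // => i _.
    have -> : eqn m i = false.
      apply/eqnP => mi; move: (ltn_ord i); rewrite -mi ltnNge nm //.
    by rewrite scale0r.
  have E a b : eqn a b = (a == b) by [].
  rewrite (bigD1 (Ordinal mn)) // E eqxx scale1r big1 => [|i]; first exact/esym/addr0.
  by rewrite -val_eqE E eq_sym => /negPf ->; rewrite scale0r.
- by rewrite big1 // => i _; rewrite scale0r.
- by rewrite IHa IHb -big_split; apply: eq_bigr => i _; rewrite scalerDl.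
- by rewrite IHa -sumrN; apply: eq_bigr => i _; rewrite scaleNr.
- by rewrite IHa scaler_sumr; apply: eq_bigr => i _; rewrite scalerA.
Qed.

(** Equality is checked coefficient by coefficient; the scalars may
    be open terms, so this premise is left to [ring] and not computed. *)
Lemma leval_eq (K : pzRingType) (V : lmodType K) (env : seq V) (a b : lexp K) :
  lall a b (size env) -> leval env a = leval env b.
Proof.
move=> h; rewrite !leval_coef; apply: eq_bigr => -[n nm] _ /=; congr (_ *: _).
move: nm h; elim: (size env) => // m IH.
by rewrite ltnS leq_eqVlt => /orP[/eqP -> [] //|/IH nm [/nm]].
Qed.

Ltac lfind x env :=
  match env with
  | cons x _ => constr:(O)
  | cons _ ?env' =>
    let n := lfind x env' in
    lazymatch n with None => constr:(@None nat) | _ => constr:(S n) end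
  | _ => constr:(@None nat)
  end.

Ltac ladd x env :=
  let n := lfind x env in
  lazymatch n with None => constr:(cons x env) | _ => env end.

Ltac latoms t env :=
  lazymatch t with
  | GRing.add ?a ?b => let env := latoms a env in latoms b env
  | GRing.opp ?a => latoms a env
  | GRing.scale _ ?a => latoms a env
  | GRing.zero => env
  | _ => ladd t env
  end.

Ltac lquote K t env :=
  lazymatch t with
  | GRing.add ?a ?b =>
    let a := lquote K a env in let b := lquote K b env in constr:(@LAdd K a b)
  | GRing.opp ?a => let a := lquote K a env in constr:(@LOpp K a)
  | GRing.scale ?c ?a => let a := lquote K a env in constr:(@LScale K c a)
  | GRing.zero => constr:(@LZero K)
  | _ => let n := lfind t env in constr:(@LAtom K n)
  end.

Ltac lmod_reify K :=
  lazymatch goal with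
  | |- @eq ?T ?l ?r =>
    let env := latoms l (@nil T) in
    let env := latoms r env in
    let a := lquote K l env in
    let b := lquote K r env in
    refine (@leval_eq _ _ env a b _)
  end.

Tactic Notation "lmod" constr(K) :=
  lmod_reify K; rewrite /=; repeat split; ring.

(** * Real-valued norms and limits *)

Definition nrm (R : realType) (V : normedModType R[i]) (x : V) : R :=
  complex.Re `|x|.

(** Norms on a space over R[i] take values in R[i], where the order is
    partial.  Estimates are carried out on their real parts. *)
Definition cabs (R : realType) (c : R[i]) : R := complex.Re `|c|.

Section norm.
Variables (R : realType) (V : normedModType R[i]).
Implicit Types x y z : V.

Lemma ge0_complexE (c : R[i]) : 0 <= c -> c = (complex.Re c)%:C.
Proof. by case: c => a b; rewrite lecE /= => /andP[/eqP -> _]. Qed.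

Lemma normE x : `|x| = (nrm x)%:C.
Proof. exact/ge0_complexE/normr_ge0. Qed.

Lemma cabsE (c : R[i]) : `|c| = (cabs c)%:C.
Proof. exact/ge0_complexE/normr_ge0. Qed.

Lemma cabs_ge0 (c : R[i]) : 0 <= cabs c.
Proof. by rewrite -lecR -cabsE normr_ge0. Qed.

Lemma nrm_ge0 x : 0 <= nrm x.
Proof. by rewrite -lecR -normE normr_ge0. Qed.

Lemma nrm0 : nrm (0 : V) = 0. Proof. by rewrite /nrm normr0. Qed.

Lemma nrm_eq0 x : nrm x = 0 -> x = 0.
Proof. by move=> h; apply/normr0_eq0; rewrite normE h. Qed.

Lemma nrm_gt0 x : (0 < nrm x) = (x != 0).
Proof. by rewrite -ltcR -normE normr_gt0. Qed.

Lemma nrmN x : nrm (- x) = nrm x. Proof. by rewrite /nrm normrN. Qed.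

Lemma nrmD x y : nrm (x + y) <= nrm x + nrm y.
Proof. by rewrite -lecR raddfD /= -!normE ler_normD. Qed.

Lemma nrmB x y : nrm (x - y) <= nrm x + nrm y.
Proof. by rewrite -(nrmN y); exact: nrmD. Qed.

Lemma nrm_distC x y : nrm (x - y) = nrm (y - x).
Proof. by rewrite -nrmN opprB. Qed.

Lemma nrm_dist_tri z x y : nrm (x - y) <= nrm (x - z) + nrm (z - y).
Proof. by apply: le_trans (nrmD _ _); rewrite addrA subrK. Qed.

Lemma nrmZ (c : R[i]) x : nrm (c *: x) = cabs c * nrm x.
Proof.
by apply: (@complexI R); rewrite rmorphM /= -cabsE -!normE normrZ.
Qed.

Lemma nrm_sum (I : Type) (s : seq I) (P : pred I) (F : I -> V) :
  nrm (\sum_(i <- s | P i) F i) <= \sum_(i <- s | P i) nrm (F i).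
Proof.
elim/big_ind2: _ => [|a b x y h1 h2|i _]; [by rewrite nrm0| |by []].
exact: le_trans (nrmD _ _) (lerD h1 h2).
Qed.

Lemma cabsR (t : R) : cabs t%:C = `|t|.
Proof. by rewrite /cabs normc_def /= expr0n addr0 sqrtr_sqr. Qed.

Lemma cabsM (a b : R[i]) : cabs (a * b) = cabs a * cabs b.
Proof. by apply: (@complexI R); rewrite rmorphM /= -!cabsE normrM. Qed.

Lemma cabs_conj (a : R[i]) : cabs a^* = cabs a.
Proof. by case: a => a b; rewrite /cabs !normc_def /= sqrrN. Qed.

End norm.

Definition nlim (R : realType) (V : normedModType R[i]) (u : nat -> V) (l : V) :=
  forall e : R, 0 < e -> exists N, forall n, (N <= n)%N -> nrm (u n - l) < e.

Definition approx (R : realType) (V : normedModType R[i]) (S : set V) : set V :=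
  [set x | forall e : R, 0 < e -> exists2 y, S y & nrm (x - y) < e].

Section limits.
Variables (R : realType) (V : normedModType R[i]).
Implicit Types (x y : V) (u v : nat -> V) (S : set V).

Lemma gt0_complexE (c : R[i]) : 0 < c -> exists2 e : R, 0 < e & c = e%:C.
Proof.
move=> c0; exists (complex.Re c); last exact/ge0_complexE/ltW.
by rewrite -ltcR -ge0_complexE // ltW.
Qed.

Lemma approx_sub S x : S x -> approx S x.
Proof. by move=> Sx e e0; exists x => //; rewrite subrr nrm0. Qed.

Lemma closed_approx S : closed (approx S).
Proof.
move=> x; rewrite /closure /= => h e e0.
have e2 : 0 < e / 2 by rewrite divr_gt0.
have /h[y [hy /=]] : nbhs x (ball x (e / 2)%:C).
  by apply: nbhsx_ballx; rewrite ltcR.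
rewrite -ball_normE /= normE ltcR => xy.
have [z Sz yz] := hy _ e2; exists z => //.
apply: le_lt_trans (nrm_dist_tri y _ _) _; lra.
Qed.

Lemma closed_approxE S x : closed S -> approx S x -> S x.
Proof.
move=> cS h; apply: cS => B /nbhs_ballP[c /= c0 cB].
have [e e0 ce] := gt0_complexE c0.
have [y Sy xy] := h _ e0; exists y; split=> //; apply: cB.
by rewrite -ball_normE /= normE ce ltcR.
Qed.

Lemma nlim_approx S u x : (forall n, S (u n)) -> nlim u x -> approx S x.
Proof.
move=> Su ux e /ux[N hN]; exists (u N) => //.
by rewrite nrm_distC; exact: hN.
Qed.

Lemma small_inv (e : R) : 0 < e -> exists N, forall n, (N <= n)%N ->
  n.+1%:R^-1 < e.
Proof.
move=> e0; exists (Num.truncn e^-1) => n hn.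
rewrite invf_plt ?posrE //; apply: lt_le_trans (truncnS_gt _) _.
by rewrite ler_nat.
Qed.

(** Closures are handled by approximation up to e, and algebraic
    operations by sequences; this is the passage from one to the other. *)
Lemma approx_nlim S x : approx S x -> exists2 u, forall n, S (u n) & nlim u x.
Proof.
move=> h; have /choice[u hu] : forall n : nat, exists y, S y /\ nrm (x - y) < n.+1%:R^-1.
  by move=> n; have [|y Sy xy] := h n.+1%:R^-1; [rewrite invr_gt0|exists y].
exists u => [n|e e0]; first by case: (hu n).
have [N hN] := small_inv e0.
by exists N => n /hN; apply: le_lt_trans; rewrite nrm_distC; apply/ltW; case: (hu n).
Qed.

Lemma nlim_cst x : nlim (fun=> x) x.
Proof. by move=> e e0; exists 0%N => n _; rewrite subrr nrm0. Qed.

Lemma nlim_unique u x y : nlim u x -> nlim u y -> x = y.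
Proof.
move=> ux uy; apply/eqP; rewrite -subr_eq0; apply/negPn/negP.
rewrite -nrm_gt0 => d0; have d2 : 0 < nrm (x - y) / 2 by rewrite divr_gt0.
have [N hN] := ux _ d2; have [N' hN'] := uy _ d2.
have := nrm_dist_tri (u (maxn N N')) x y.
have := hN _ (leq_maxl N N'); have := hN' _ (leq_maxr N N').
rewrite (nrm_distC _ x); lra.
Qed.

Lemma nlimD u v x y : nlim u x -> nlim v y -> nlim (fun n => u n + v n) (x + y).
Proof.
move=> ux vy e e0; have d2 : 0 < e / 2 by rewrite divr_gt0.
have [N hN] := ux _ d2; have [N' hN'] := vy _ d2.
exists (maxn N N') => n; rewrite geq_max => /andP[/hN h1 /hN' h2].
rewrite opprD addrACA; apply: le_lt_trans (nrmD _ _) _; lra.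
Qed.

Lemma nlimZ (c : R[i]) u x : nlim u x -> nlim (fun n => c *: u n) (c *: x).
Proof.
move=> ux e e0; have c0 := cabs_ge0 c.
have [|N hN] := ux (e / (cabs c + 1)); first by rewrite divr_gt0 // ltr_wpDl.
exists N => n /hN h; rewrite -scalerBr nrmZ.
rewrite ltr_pdivlMr ?ltr_wpDl // in h; apply: le_lt_trans h.
by rewrite mulrC ler_wpM2l ?nrm_ge0 // lerDl.
Qed.

Lemma nlim_bounded u x : nlim u x -> exists2 K, 0 < K & forall n, nrm (u n) <= K.
Proof.
move=> /(_ 1 ltr01)[N hN].
(* the terms before N are bounded by their sum, the others by nrm x + 1 *)
pose K := nrm x + 1 + \sum_(i < N) nrm (u i).
have s0 : 0 <= \sum_(i < N) nrm (u i) by apply: sumr_ge0 => i _; exact: nrm_ge0.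
have x0 := nrm_ge0 x.
exists K => [|n]; first by rewrite /K; lra.
have [nN|/hN h] := ltnP n N; last first.
  have := nrm_dist_tri x (u n) 0; rewrite !subr0 /K; lra.
rewrite /K (bigD1 (Ordinal nN)) //=.
have : 0 <= \sum_(i < N | i != Ordinal nN) nrm (u i).
  by apply: sumr_ge0 => i _; exact: nrm_ge0.
lra.
Qed.

End limits.

Lemma nlim_cauchy (R : realType) (V : completeNormedModType R[i]) (u : nat -> V) :
  (forall e : R, 0 < e -> exists N, forall n, (N <= n)%N -> nrm (u n - u N) < e) ->
  exists l, nlim u l.
Proof.
move=> hu; have : cauchy (u @ \oo).
  apply/cauchyP => c c0; have [e e0 ->] := gt0_complexE c0.
  have [N hN] := hu _ e0; exists (u N); exists N => // n /= /hN.
  by rewrite -ball_normE /= normE ltcR nrm_distC.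
move=> /cauchy_cvg /cvg_ex[l /cvgrPdist_lt ul]; exists l => e e0.
have /ul[N _ hN] : 0 < e%:C by rewrite ltcR.
by exists N => n /hN; rewrite normE ltcR nrm_distC.
Qed.

(** * C*-algebra calculus *)

Local Notation "x ** y" := (cmul x y) (at level 40, left associativity).

Lemma expr_small (R : realType) (q e : R) : 0 <= q -> q < 1 -> 0 < e ->
  exists N, forall n, (N <= n)%N -> q ^+ n < e.
Proof.
move=> q0 q1 e0.
have /cvg_expr /cvgrPdist_lt /(_ e e0)[N _ hN] : `|q| < 1 by rewrite ger0_norm.
by exists N => n /hN; rewrite sub0r normrN ger0_norm // exprn_ge0.
Qed.

Lemma nlim_geometric (R : realType) (V : completeNormedModType R[i])
    (u : nat -> V) (C q : R) : 0 <= q -> q < 1 ->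
  (forall n, nrm (u n.+1 - u n) <= C * q ^+ n) -> exists l, nlim u l.
Proof.
move=> q0 q1 hu.
have C0 : 0 <= C by have := hu 0%N; rewrite expr0 mulr1; apply: le_trans; exact: nrm_ge0.
have p0 : 0 < 1 - q by rewrite subr_gt0.
have hs N k : (1 - q) * nrm (u (N + k)%N - u N) <= C * q ^+ N * (1 - q ^+ k).
  elim: k => [|k IH]; first by rewrite addn0 subrr nrm0 expr0 subrr !mulr0.
  have h : nrm (u (N + k.+1)%N - u N) <= C * q ^+ N * q ^+ k + nrm (u (N + k)%N - u N).
    apply: le_trans (nrm_dist_tri (u (N + k)%N) _ _) _.
    by rewrite lerD2r -mulrA -exprD addnS; exact: hu.
  apply: le_trans (ler_wpM2l (ltW p0) h) _; rewrite mulrDr exprS.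
  move: IH; set a := C * q ^+ N; set b := q ^+ k; set c := (1 - q) * _ => IH.
  suff -> : a * (1 - q * b) = (1 - q) * (a * b) + a * (1 - b) by rewrite lerD2l.
  ring.
apply: nlim_cauchy => e e0.
have [|N hN] := @expr_small R q ((1 - q) * e / (C + 1)) q0 q1.
  by rewrite divr_gt0 ?mulr_gt0 // ltr_wpDl.
exists N => n Nn; rewrite -(subnKC Nn).
rewrite -(ltr_pM2l p0); apply: le_lt_trans (hs _ _) _.
have qk : 0 <= q ^+ (n - N) by exact: exprn_ge0.
have qN : 0 <= q ^+ N by exact: exprn_ge0.
have := hN _ (leqnn N); rewrite ltr_pdivlMr ?ltr_wpDl // => h.
apply: le_lt_trans h.
have h2 : 0 <= C * q ^+ N by exact: mulr_ge0.
have := mulr_ge0 h2 qk; lra.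
Qed.

Section cstar.
Variables (R : realType) (B : cstarAlgType R).
Implicit Types (x y z e h p : B) (c : R[i]) (t : R).

Lemma cmul0l x : 0 ** x = 0.
Proof. by rewrite -(scale0r (0 : B)) cmulZl !scale0r. Qed.
Lemma cmul0r x : x ** 0 = 0.
Proof. by rewrite -(scale0r (0 : B)) cmulZr !scale0r. Qed.
Lemma cmulNl x y : (- x) ** y = - (x ** y).
Proof. by rewrite -scaleN1r cmulZl scaleN1r. Qed.
Lemma cmulNr x y : x ** (- y) = - (x ** y).
Proof. by rewrite -scaleN1r cmulZr scaleN1r. Qed.
Lemma cmulBl x y z : (x - y) ** z = x ** z - y ** z.
Proof. by rewrite cmulDl cmulNl. Qed.
Lemma cmulBr x y z : x ** (y - z) = x ** y - x ** z.
Proof. by rewrite cmulDr cmulNr. Qed.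
Lemma cmul_suml (I : Type) (s : seq I) (P : pred I) (F : I -> B) z :
  (\sum_(i <- s | P i) F i) ** z = \sum_(i <- s | P i) F i ** z.
Proof. by apply: (big_morph (fun x => x ** z) _ (cmul0l z)) => x y; exact: cmulDl. Qed.
Lemma cmul_sumr (I : Type) (s : seq I) (P : pred I) (F : I -> B) z :
  z ** (\sum_(i <- s | P i) F i) = \sum_(i <- s | P i) z ** F i.
Proof. by apply: (big_morph (fun x => z ** x) _ (cmul0r z)) => x y; exact: cmulDr. Qed.

Lemma cstar0 : cstar (0 : B) = 0.
Proof. by rewrite -(scale0r (0 : B)) cstarZ rmorph0 !scale0r. Qed.
Lemma cstarN x : cstar (- x) = - cstar x.
Proof. by rewrite -scaleN1r cstarZ rmorphN rmorph1 scaleN1r. Qed.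
Lemma cstarB x y : cstar (x - y) = cstar x - cstar y.
Proof. by rewrite cstarD cstarN. Qed.
Lemma cstar_sum (I : Type) (s : seq I) (P : pred I) (F : I -> B) :
  cstar (\sum_(i <- s | P i) F i) = \sum_(i <- s | P i) cstar (F i).
Proof. by apply: (big_morph _ _ cstar0) => x y; exact: cstarD. Qed.
Lemma cstarZR t x : cstar (t%:C *: x) = t%:C *: cstar x.
Proof. by rewrite cstarZ; congr (_ *: _); exact: conjc_real. Qed.

Lemma nrmM x y : nrm (x ** y) <= nrm x * nrm y.
Proof. by rewrite -lecR rmorphM /= -!normE cnormM. Qed.

Lemma nrm_starM x : nrm (cstar x ** x) = nrm x ^+ 2.
Proof. by apply: (@complexI R); rewrite rmorphXn /= -!normE cnorm_cstar. Qed.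

Lemma nrm_star_le x : nrm x <= nrm (cstar x).
Proof.
have [->|x0] := eqVneq x 0; first by rewrite nrm0 nrm_ge0.
rewrite -nrm_gt0 in x0; rewrite -(ler_pM2r x0) -expr2 -nrm_starM; exact: nrmM.
Qed.

Lemma nrm_star x : nrm (cstar x) = nrm x.
Proof.
by apply/le_anti; rewrite nrm_star_le -{2}(cstarK x) nrm_star_le.
Qed.

Lemma nrm_Mstar x : nrm (x ** cstar x) = nrm x ^+ 2.
Proof. by rewrite -[in RHS]nrm_star -nrm_starM cstarK. Qed.

Lemma nrm_sq x : cstar x = x -> nrm (x ** x) = nrm x ^+ 2.
Proof. by move=> h; rewrite -nrm_starM h. Qed.

(** The C*-identity is used in this form: a bound on star(x) x is
    a bound on x. *)
Lemma nrm_star_le1 x k : 0 <= k -> nrm (cstar x ** x) <= k ^+ 2 -> nrm x <= k.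
Proof.
by move=> k0; rewrite nrm_starM; move/(ler_wsqrtr); rewrite !sqrtr_sqr !ger0_norm ?nrm_ge0.
Qed.

Lemma nlimM (u v : nat -> B) x y : nlim u x -> nlim v y ->
  nlim (fun n => u n ** v n) (x ** y).
Proof.
move=> ux vy; have [K K0 hK] := nlim_bounded ux.
move=> e e0; pose y1 := nrm y + 1.
have y0 : 0 < y1 by rewrite ltr_wpDl // nrm_ge0.
have [|N hN] := ux (e / 2 / y1); first by rewrite !divr_gt0.
have [|N' hN'] := vy (e / 2 / K); first by rewrite !divr_gt0.
exists (maxn N N') => n; rewrite geq_max => /andP[/hN h1 /hN' h2].
have -> : u n ** v n - x ** y = u n ** (v n - y) + (u n - x) ** y.
  by rewrite cmulBr cmulBl addrA subrK.
rewrite ltr_pdivlMr // in h1; rewrite ltr_pdivlMr // in h2.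
apply: le_lt_trans (nrmD _ _) _.
have a1 := nrmM (u n) (v n - y); have a2 := nrmM (u n - x) y.
have b1 : nrm (u n) * nrm (v n - y) <= nrm (v n - y) * K.
  by rewrite mulrC ler_wpM2l ?nrm_ge0.
have b2 : nrm (u n - x) * nrm y <= nrm (u n - x) * y1.
  by rewrite ler_wpM2l ?nrm_ge0 // lerDl.
lra.
Qed.

Lemma nlim_star (u : nat -> B) x : nlim u x -> nlim (fun n => cstar (u n)) (cstar x).
Proof. by move=> ux e /ux[N hN]; exists N => n /hN; rewrite -cstarB nrm_star. Qed.

Definition projection e := e ** e = e /\ cstar e = e.
(** The algebra need not have a unit.  A projection e serves as the
    unit of e B e, which replaces the unitization throughout. *)
Definition corner e x := e ** x = x /\ x ** e = x.

Lemma nrm_projection e : projection e -> nrm e <= 1.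
Proof.
move=> [ee es]; have := nrm_starM e; rewrite es ee => h.
have [->|e0] := eqVneq e 0; first by rewrite nrm0.
rewrite -nrm_gt0 in e0.
by move: h; rewrite expr2 -{1}(mulr1 (nrm e)) => /(mulfI (lt0r_neq0 e0)) <-.
Qed.

Lemma corner_unit e : projection e -> corner e e.
Proof. by case. Qed.
Lemma cornerD e x y : corner e x -> corner e y -> corner e (x + y).
Proof. by move=> [a b] [c d]; split; rewrite ?cmulDl ?cmulDr ?a ?b ?c ?d. Qed.
Lemma cornerZ e c x : corner e x -> corner e (c *: x).
Proof. by move=> [a b]; split; rewrite ?cmulZl ?cmulZr ?a ?b. Qed.
Lemma cornerN e x : corner e x -> corner e (- x).
Proof. by rewrite -scaleN1r; exact: cornerZ. Qed.
Lemma cornerB e x y : corner e x -> corner e y -> corner e (x - y).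
Proof. by move=> ? ?; apply: cornerD => //; exact: cornerN. Qed.
Lemma cornerM e x y : corner e x -> corner e y -> corner e (x ** y).
Proof. by move=> [a b] [c d]; split; [rewrite cmulA a|rewrite -cmulA d]. Qed.

Lemma corner_lim e (u : nat -> B) x : (forall n, corner e (u n)) -> nlim u x ->
  corner e x.
Proof.
move=> hu ux; have ce := @nlim_cst R B e.
split; [apply: nlim_unique (nlimM ce ux) _|apply: nlim_unique (nlimM ux ce) _].
  by under eq_fun do rewrite (hu _).1.
by under eq_fun do rewrite (hu _).2.
Qed.

End cstar.

Section corner_calculus.
Variables (R : realType) (B : cstarAlgType R) (e : B) (eP : projection e).
Implicit Types (x y z h g w : B).

Let half : R := 2^-1.

Lemma halfD (V : lmodType R[i]) (x : V) : half%:C *: (x + x) = x.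
Proof.
rewrite -mulr2n -scaler_nat scalerA -[X in _ *: X = _]scale1r -[RHS]scale1r.
rewrite scalerA mulr1; congr (_ *: _).
by rewrite -(rmorph_nat (real_complex R)) -rmorphM /= mulVf ?pnatr_eq0.
Qed.

Lemma nrm_half (V : normedModType R[i]) (x : V) : nrm (half%:C *: x) = half * nrm x.
Proof. by rewrite nrmZ cabsR ger0_norm // invr_ge0. Qed.

(** The root is e - w where w solves 2 w = h + w^2.  The map
    w -> (h + w^2) / 2 preserves the ball of radius |h| and has Lipschitz
    constant |h| < 1 there; self-adjointness and commutation relations hold
    along the iteration, hence at its limit. *)
Lemma corner_sqrt h : corner e h -> cstar h = h -> nrm h < 1 ->
  exists y, [/\ corner e y, cstar y = y, y ** y = e - h &
    forall z, corner e z -> z ** h = h ** z -> z ** y = y ** z].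
Proof.
move=> hc hs h1; have h0 := nrm_ge0 h.
pose f w := half%:C *: (h + w ** w).
pose P w := [/\ corner e w, cstar w = w, nrm w <= nrm h &
  forall z, z ** h = h ** z -> z ** w = w ** z].
have Pf w : P w -> P (f w).
  move=> [wc ws wn wz]; split.
  - by apply: cornerZ; apply: cornerD => //; exact: cornerM.
  - by rewrite cstarZR cstarD cstarM hs ws.
  - rewrite nrm_half.
    have := nrmD h (w ** w); have := nrmM w w.
    have : nrm w * nrm w <= nrm h * 1.
      by apply: ler_pM; rewrite ?nrm_ge0 // (le_trans wn) // ltW.
    rewrite /half; lra.
  - by move=> z zh; rewrite cmulZl cmulZr cmulDl cmulDr zh cmulA (wz z) // -!cmulA (wz z).
have P0 : P 0.
  split; [by split; rewrite ?cmul0l ?cmul0r|exact: cstar0|by rewrite nrm0|].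
  by move=> z _; rewrite cmul0l cmul0r.
pose u n := iter n f 0.
have Pu n : P (u n) by elim: n => [|n IH] //; exact: Pf.
have fd w w' : P w -> P w' -> nrm (f w - f w') <= nrm h * nrm (w - w').
  move=> [_ _ wn _] [_ _ wn' _].
  rewrite /f -scalerBr nrm_half opprD addrACA subrr add0r.
  have -> : w ** w - w' ** w' = w ** (w - w') + (w - w') ** w'.
    by rewrite cmulBr cmulBl addrA subrK.
  have := nrmD (w ** (w - w')) ((w - w') ** w').
  have a1 := nrmM w (w - w'); have a2 := nrmM (w - w') w'.
  have d0 := nrm_ge0 (w - w').
  have := ler_wpM2r d0 wn; have := ler_wpM2l d0 wn'.
  rewrite /half; lra.
have [l ul] : exists l, nlim u l.
  apply: (@nlim_geometric _ _ _ (nrm (u 1%N - u 0%N)) _ h0 h1) => n.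
  elim: n => [|n IH]; first by rewrite expr0 mulr1.
  apply: le_trans (fd _ _ (Pu n.+1) (Pu n)) _.
  by rewrite exprS mulrCA ler_wpM2l.
have lc : corner e l by apply: corner_lim ul => n; case: (Pu n).
have ls : cstar l = l.
  apply: (nlim_unique (nlim_star ul)).
  by have -> : (fun n => cstar (u n)) = u by apply/funext => n; have [_ -> _ _] := Pu n.
have lf : l + l = h + l ** l.
  have : l = f l.
    refine (nlim_unique ul _) => d d0; have := nlimZ half%:C (nlimD (nlim_cst h) (nlimM ul ul)).
    move=> /(_ _ d0)[N hN].
    have [N' hN'] : exists N, forall n, (N <= n)%N -> nrm (u n.+1 - f l) < d by exists N.
    by exists N'.+1 => -[//|n]; rewrite ltnS => /hN'.
  by move=> {1 2}->; rewrite /f -scalerDr halfD.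
exists (e - l); split.
- by apply: cornerB => //; exact: corner_unit.
- by rewrite cstarB ls eP.2.
- rewrite cmulBl !cmulBr eP.1 lc.1 lc.2.
  have -> : h = l + l - l ** l by rewrite lf addrK.
  by rewrite !opprB -addrA; congr (_ + _); rewrite addrCA -opprD.
- move=> z zc zh; rewrite cmulBl cmulBr zc.1 zc.2; congr (_ - _).
  apply: (nlim_unique (nlimM (nlim_cst z) ul)).
  have -> : (fun n => z ** u n) = (fun n => u n ** z).
    by apply/funext => n; have [_ _ _ ->] := Pu n.
  exact: nlimM ul (nlim_cst z).
Qed.

Lemma nrm_corner_contraction x : corner e x -> nrm (e - x) <= 1 -> forall t : R,
  0 <= t <= 1 -> nrm (e - t%:C *: x) <= 1.
Proof.
move=> xc x1 t /andP[t0 t1].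
have -> : e - t%:C *: x = (1 - t)%:C *: e + t%:C *: (e - x).
  by rewrite rmorphB rmorph1 scalerBl scale1r scalerBr addrA subrK.
apply: le_trans (nrmD _ _) _; rewrite !nrmZ !cabsR !ger0_norm ?subr_ge0 //.
have := ler_wpM2l t0 x1; have := nrm_projection eP.
have t2 : 0 <= 1 - t by rewrite subr_ge0.
move/(ler_wpM2l t2); lra.
Qed.

Lemma corner_unitary x : corner e x -> cstar x = x -> nrm x < 1 ->
  exists y, [/\ corner e y, cstar y = y, y ** y = e - x ** x & x ** y = y ** x].
Proof.
move=> xc xs x1.
have [||y [yc ys yy yz]] := @corner_sqrt (x ** x) (cornerM xc xc).
- by rewrite cstarM xs.
- rewrite nrm_sq // expr_lt1 ?nrm_ge0 //.
- by exists y; split=> //; apply: yz => //; rewrite cmulA.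
Qed.

Lemma unitary_ident (C : cstarAlgType R) (x y : C) : cstar x = x -> cstar y = y -> x ** y = y ** x ->
  cstar (x + 'i *: y) ** (x + 'i *: y) = x ** x + y ** y.
Proof.
move=> xs ys xy; rewrite cstarD cstarZ xs ys cmulDl !cmulDr !cmulZl !cmulZr.
rewrite scalerA xy conjCi mulNr -expr2 sqrCi opprK scale1r scaleNr.
by rewrite -addrA; congr (_ + _); rewrite addrA addrN add0r.
Qed.

(** With u = x + i y, star(u) u = x^2 + y^2, so u and star(u) are
    contractions; x and y are their real and imaginary parts. *)
Lemma nrm_parts (C : cstarAlgType R) (x y : C) : cstar x = x -> cstar y = y -> x ** y = y ** x ->
  nrm (x ** x + y ** y) <= 1 -> nrm x <= 1 /\ nrm y <= 1.
Proof.
move=> xs ys xy h; set u := x + 'i *: y.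
have u1 : nrm u <= 1 by apply: nrm_star_le1 => //; rewrite unitary_ident // expr1n.
have us : cstar u = x - 'i *: y by rewrite /u cstarD cstarZ xs ys conjCi scaleNr.
have u1' : nrm (cstar u) <= 1 by rewrite nrm_star.
have hx : x = half%:C *: (u + cstar u) by rewrite us /u addrACA addrN addr0 halfD.
have hy : 'i *: y = half%:C *: (u - cstar u).
  by rewrite us /u -[LHS]halfD; congr (_ *: _); lmod R[i].
split.
  rewrite hx nrm_half; have := nrmD u (cstar u); rewrite /half; lra.
have -> : nrm y = nrm ('i *: y).
  by rewrite nrmZ /cabs normCi mul1r.
rewrite hy nrm_half; have := nrmB u (cstar u); rewrite /half; lra.
Qed.

(** A square is positive: t^2 e - x^2 is the square of y, where
    x + i y is t times a unitary. *)
Lemma nrm_corner_sq x t : corner e x -> cstar x = x -> nrm x < t ->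
  nrm ((t ^+ 2)%:C *: e - x ** x) <= t ^+ 2.
Proof.
move=> xc xs xt; have t0 : 0 < t by apply: le_lt_trans xt; exact: nrm_ge0.
(* normalise so that x' is the real part of a unitary *)
pose x' := (t^-1)%:C *: x.
have x'c : corner e x' by exact: cornerZ.
have x's : cstar x' = x' by rewrite cstarZR xs.
have xE : x = t%:C *: x' by rewrite scalerA -rmorphM /= divff ?gt_eqF // scale1r.
have [|y [yc ys yy xy]] := corner_unitary x'c x's.
  rewrite nrmZ cabsR ger0_norm ?invr_ge0 ?ltW // mulrC ltr_pdivrMr ?mul1r //.
have [|_ y1] := nrm_parts x's ys xy.
  by rewrite yy addrC subrK; exact: nrm_projection.
rewrite xE cmulZl cmulZr scalerA -rmorphM -expr2 -scalerBr -yy nrmZ cabsR.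
rewrite ger0_norm ?sqr_ge0 // nrm_sq //.
by rewrite -[leRHS]mulr1 ler_wpM2l ?sqr_ge0 // expr_le1 ?nrm_ge0.
Qed.

(** For self-adjoint g, the bound |e - g| <= 1 expresses
    that g is positive.  Then g + c e is a square k^2 for every small c > 0, and
    for squares the bound |t e - k^2| <= t holds at every scale t > |k|^2. *)
Lemma nrm_corner_rescale g t : corner e g -> cstar g = g -> nrm (e - g) <= 1 ->
  nrm g < t -> nrm (t%:C *: e - g) <= t.
Proof.
move=> gc gs g1 gt; have t0 : 0 < t by apply: le_lt_trans gt; exact: nrm_ge0.
(* c is small enough for g + c e to have norm below t and for the error 2 c to be at most d *)
apply/ler_addgt0Pr => d d0; pose c := Num.min d (t - nrm g) / 2.
have c0 : 0 < c by rewrite divr_gt0 // lt_min d0 subr_gt0.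
have cd : c <= d / 2 by rewrite ler_pM2r // ge_min lexx.
have ct : c <= (t - nrm g) / 2 by rewrite ler_pM2r // ge_min lexx orbT.
have c1 : 0 < 1 + c by rewrite addr_gt0.
pose h := ((1 + c)^-1)%:C *: (e - g).
have hE : (1 + c)%:C *: (e - h) = g + c%:C *: e.
  rewrite scalerBr scalerA -rmorphM /= divff ?gt_eqF // scale1r rmorphD rmorph1.
  by rewrite scalerDl scale1r opprB addrC addrA subrK.
have ec := corner_unit eP.
have [|||k [kc ks kk _]] := @corner_sqrt h.
- by apply: cornerZ; exact: cornerB.
- by rewrite cstarZR cstarB eP.2 gs.
- rewrite nrmZ cabsR ger0_norm ?invr_ge0 ?ltW // mulrC ltr_pdivrMr ?mul1r //.
  by apply: le_lt_trans g1 _; rewrite ltrDl.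
pose l := (Num.sqrt (1 + c))%:C *: k.
have ll : l ** l = g + c%:C *: e.
  by rewrite cmulZl cmulZr scalerA -rmorphM -expr2 sqr_sqrtr ?ltW //= kk hE.
have ls : cstar l = l by rewrite cstarZR ks.
have lc : corner e l by exact: cornerZ.
have ln : nrm l < Num.sqrt t.
  have : nrm l ^+ 2 < t.
    rewrite -nrm_sq // ll; apply: le_lt_trans (nrmD _ _) _.
    rewrite nrmZ cabsR gtr0_norm //.
    have := ler_wpM2l (ltW c0) (nrm_projection eP); lra.
  rewrite -ltr_sqrt // sqrtr_sqr ger0_norm ?nrm_ge0 //.
have := nrm_corner_sq lc ls ln; rewrite sqr_sqrtr ?(ltW t0) // ll => hh.
have -> : t%:C *: e - g = (t%:C *: e - (g + c%:C *: e)) + c%:C *: e.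
  by rewrite opprD addrA subrK.
apply: le_trans (nrmD _ _) _; rewrite nrmZ cabsR gtr0_norm //.
have := ler_wpM2l (ltW c0) (nrm_projection eP); lra.
Qed.

(** If g and -g are both positive then, at the scale t just
    above |g|, both t e + g and t e - g have norm at most t; the difference of
    their squares is 4 t g, whence |g| <= t / 2. *)
Lemma corner_vertex g : corner e g -> cstar g = g -> nrm (e - g) <= 1 ->
  nrm (e + g) <= 1 -> g = 0.
Proof.
move=> gc gs g1 g2; apply: nrm_eq0; apply/le_anti; rewrite nrm_ge0 andbT.
suff hb : forall t, nrm g < t -> nrm g <= t / 2.
  have g0 := nrm_ge0 g; rewrite leNgt; apply/negP => g3.
  by have := hb (nrm g * (3 / 2)) ltac:(lra); lra.
move=> t gt; have t0 : 0 < t by apply: le_lt_trans gt; exact: nrm_ge0.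
have a1 := nrm_corner_rescale gc gs g1 gt.
have a2 : nrm (t%:C *: e + g) <= t.
  rewrite -[g]opprK; apply: nrm_corner_rescale; rewrite ?nrmN ?opprK //.
    exact: cornerN.
  by rewrite cstarN gs.
have id4 : (4 * t)%:C *: g = (t%:C *: e + g) ** (t%:C *: e + g)
     - (t%:C *: e - g) ** (t%:C *: e - g).
  rewrite !cmulDl !cmulDr !cmulNl !cmulNr !cmulZl !cmulZr gc.1 gc.2 eP.1.
  lmod R[i].
have := nrmB ((t%:C *: e + g) ** (t%:C *: e + g)) ((t%:C *: e - g) ** (t%:C *: e - g)).
have b0 := nrm_ge0 (t%:C *: e + g); have b1 := nrm_ge0 (t%:C *: e - g).
have := nrmM (t%:C *: e + g) (t%:C *: e + g); have := nrmM (t%:C *: e - g) (t%:C *: e - g).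
have := ler_pM b0 b0 a2 a2; have := ler_pM b1 b1 a1 a1.
rewrite -id4 nrmZ cabsR ger0_norm ?mulr_ge0 ?(ltW t0) // => h1 h2 h3 h4 h5.
have : t * (4 * nrm g) <= t * (2 * t) by lra.
rewrite ler_pM2l //; lra.
Qed.

End corner_calculus.

Section consequences.
Variables (R : realType) (B : cstarAlgType R).
Implicit Types (x y z e g p : B).

(** 1 - p is a projection, hence a contraction. *)
Lemma nrm_projection_compl p z : projection p -> nrm (z - p ** z) <= nrm z.
Proof.
move=> [pp ps]; set y := z - p ** z.
have h : nrm y ^+ 2 <= nrm z * nrm y.
  rewrite -nrm_starM; suff -> : cstar y ** y = cstar z ** y by rewrite -(nrm_star z) nrmM.
  have py : p ** y = 0 by rewrite /y cmulBr cmulA pp subrr.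
  by rewrite {1}/y cstarB cstarM ps cmulBl -cmulA py cmul0r subr0.
have [y0|/eqP y0] := eqVneq (nrm y) 0; first by rewrite y0 nrm_ge0.
by move: h; rewrite expr2 ler_pM2r // lt_neqAle nrm_ge0 andbT eq_sym; apply/eqP.
Qed.

Lemma nrm_compression_compl e p : projection e -> projection p ->
  nrm (e - e ** p ** e) <= 1.
Proof.
move=> eP pP; have e1 := nrm_projection eP; have [ee es] := eP.
have -> : e - e ** p ** e = e ** (e - p ** e) by rewrite cmulBr ee cmulA.
apply: le_trans (nrmM _ _) _.
by apply: mulr_ile1; rewrite ?nrm_ge0 // (le_trans (nrm_projection_compl _ pP)).
Qed.

(** Each c_i is positive.  If they sum to zero, -c_i is the sum
    of the others, hence positive as well, and c_i = 0. *)
Lemma zero_sum_corner (I : finType) (c : I -> B) e : projection e ->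
  (forall i, corner e (c i)) -> (forall i, cstar (c i) = c i) ->
  (forall i, nrm (e - c i) <= 1) -> \sum_i c i = 0 -> forall i, c i = 0.
Proof.
move=> eP cc cs c1 c0 i0; pose n : R := #|I|%:R.
have n1 : 1 <= n by rewrite ler1n; apply/card_gt0P; exists i0.
have n0 : 0 < n by apply: lt_le_trans n1.
have ni : 0 <= n^-1 by rewrite invr_ge0 ltW.
have nn : n^-1 * n = 1 by rewrite mulVf // gt_eqF.
suff : (n^-1)%:C *: c i0 = 0.
  move=> h; rewrite -[c i0]scale1r -(rmorph1 (real_complex R)) -nn mulrC.
  by rewrite rmorphM -scalerA [_ *: c i0]h scaler0.
apply: (corner_vertex eP); first exact: cornerZ.
- by rewrite cstarZR cs.
- by apply: nrm_corner_contraction => //; rewrite ni invf_le1.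
have -> : e + (n^-1)%:C *: c i0 =
    (n^-1)%:C *: (e + \sum_(i | i != i0) (e - c i)).
  rewrite sumrB sumr_const (cardC1 i0).
  move: c0; rewrite (bigD1 i0) //= => /eqP; rewrite addr_eq0 => /eqP ->.
  set S := \sum_(i | _) _; rewrite scalerDr scalerBr addrA scalerN; congr (_ - _).
  rewrite -scalerDr -mulrS prednK; last by apply/card_gt0P; exists i0.
  by rewrite -scaler_nat scalerA -(rmorph_nat (real_complex R)) -rmorphM nn rmorph1 scale1r.
rewrite nrmZ cabsR ger0_norm //.
suff h : nrm (e + \sum_(i | i != i0) (e - c i)) <= n.
  by apply: le_trans (ler_wpM2l ni h) _; rewrite nn.
apply: le_trans (nrmD _ _) _.
have -> : n = 1 + \sum_(i | i != i0) 1.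
  by rewrite sumr_const (cardC1 i0) -mulrS prednK //; apply/card_gt0P; exists i0.
apply: lerD; first exact: nrm_projection.
by apply: le_trans (nrm_sum _ _ _) _; apply: ler_sum.
Qed.

(** Compress the equation (1 - p) + sum_j p_j = 1 by
    e = p_i: the compressions of 1 - p and of the p_j, j <> i, are positive and
    sum to zero.  So e p_j e = 0, which is star(p_j e) (p_j e) = 0. *)
Lemma projections_orthogonal (I : finType) (P : pred I) (p : I -> B) :
  (forall i, P i -> projection (p i)) -> projection (\sum_(i | P i) p i) ->
  forall i j, P i -> P j -> i != j -> p i ** p j = 0.
Proof.
move=> pP qP i j Pi Pj ij; set e := p i; set q := \sum_(i | P i) p i in qP.
have eP : projection e by exact: pP.
have [ee es] := eP; have [qq qs] := qP.
have ec x : cstar x = x -> corner e (e ** x ** e) /\ cstar (e ** x ** e) = e ** x ** e.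
  move=> xs; split; last by rewrite !cstarM es xs cmulA.
  by split; [rewrite !cmulA ee|rewrite -cmulA ee].
(* the index i itself carries the compression of 1 - sum_j p_j *)
pose c k := if P k then if k == i then e - e ** q ** e else e ** p k ** e else 0.
have ck k : corner e (c k) /\ cstar (c k) = c k.
  rewrite /c; case: ifP => [Pk|_]; last first.
    by split; [split; rewrite ?cmul0l ?cmul0r|rewrite cstar0].
  case: ifP => _; last by apply: ec; case: (pP _ Pk).
  have [h1 h2] := ec _ qs; split; last by rewrite cstarB h2 es.
  by apply: cornerB => //; exact: corner_unit.
have /(_ j) : forall k, c k = 0.
  apply: (zero_sum_corner eP) => [k|k|k|].
  - by case: (ck k).
  - by case: (ck k).
  - rewrite /c; case: ifP => [Pk|_]; last by rewrite subr0 nrm_projection.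
    case: ifP => _; last by apply: nrm_compression_compl => //; exact: pP.
    rewrite opprB addrCA subrr addr0.
    have e1 := nrm_projection eP; have q1 := nrm_projection qP.
    apply: le_trans (nrmM _ _) _; apply: mulr_ile1; rewrite ?nrm_ge0 //.
    by apply: le_trans (nrmM _ _) _; apply: mulr_ile1; rewrite ?nrm_ge0.
  - rewrite (bigD1 i) //= {1}/c Pi eqxx.
    have -> : \sum_(k | k != i) c k = e ** (q - e) ** e.
      have -> : q = e + \sum_(k | P k && (k != i)) p k by rewrite /q (bigD1 i).
      rewrite [_ + _ - _]addrAC subrr add0r cmul_sumr cmul_suml.
      rewrite big_mkcond [RHS]big_mkcond; apply: eq_bigr => k _.
      by rewrite /c; case: (k == i); case: (P k).
    by rewrite cmulBr cmulBl ee ee addrA subrK subrr.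
rewrite /c Pj eq_sym (negPf ij) => h.
have : nrm (p j ** e) ^+ 2 = 0.
  have [jj js] := pP _ Pj.
  by rewrite -nrm_starM cstarM js es -cmulA [p j ** _]cmulA jj cmulA h nrm0.
move=> /eqP; rewrite expf_eq0 /= => /eqP /nrm_eq0 h2.
by rewrite -[e]es -[p j](pP _ Pj).2 -cstarM h2 cstar0.
Qed.

End consequences.

Section star_hom.
Variables (R : realType) (B C : cstarAlgType R) (phi : B -> C) (phiP : star_hom phi).

Lemma star_homZ c x : phi (c *: x) = c *: phi x.
Proof.
have [h _ _] := phiP.
have h0 : phi 0 = 0 by have := h (-1) 0 0; rewrite scaler0 add0r scaleN1r addNr.
by have := h c x 0; rewrite !addr0 h0 addr0.
Qed.

Lemma star_homD x y : phi (x + y) = phi x + phi y.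
Proof. by have [h _ _] := phiP; have := h 1 x y; rewrite !scale1r. Qed.

Lemma star_hom_sum (I : Type) (s : seq I) (P : pred I) (F : I -> B) :
  phi (\sum_(i <- s | P i) F i) = \sum_(i <- s | P i) phi (F i).
Proof.
apply: (big_morph _ star_homD).
by rewrite -(scale0r (0 : B)) star_homZ scale0r.
Qed.

(** A self-adjoint contraction is the real part of a
    unitary, and this algebraic relation is preserved by homomorphisms. *)
Lemma star_hom_contractive_sa e x : projection e -> corner e x -> cstar x = x ->
  nrm x < 1 -> nrm (phi x) <= 1.
Proof.
have [_ phM phS] := phiP; move=> eP xc xs x1.
have [y [yc ys yy xy]] := corner_unitary eP xc xs x1.
have [||||//] := @nrm_parts _ C (phi x) (phi y).
- by rewrite -phS xs.
- by rewrite -phS ys.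
- by rewrite -!phM xy.
- rewrite -!phM -star_homD yy addrC subrK; apply: nrm_projection.
  by split; rewrite -?phM -?phS ?eP.1 ?eP.2.
Qed.

(** By the C*-identity it suffices to treat x star(x),
    which is self-adjoint and lies in the corner of e; rescale it below norm 1. *)
Lemma star_hom_contractive e x : projection e -> e ** x = x ->
  nrm (phi x) <= nrm x.
Proof.
have [_ phM phS] := phiP; move=> eP ex; set g := x ** cstar x.
have gs : cstar g = g by rewrite cstarM cstarK.
have gc : corner e g.
  by split; [rewrite /g cmulA ex|rewrite /g -cmulA -{1}eP.2 -cstarM ex].
have hg : nrm (phi g) <= nrm g.
  apply/ler_addgt0Pr => d d0; have t0 : 0 < nrm g + d by rewrite ltr_wpDl ?nrm_ge0.
  have : nrm (phi ((nrm g + d)^-1%:C *: g)) <= 1.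
    apply: (star_hom_contractive_sa eP).
    - exact: cornerZ.
    - by rewrite cstarZR gs.
    - rewrite nrmZ cabsR gtr0_norm ?invr_gt0 // mulrC ltr_pdivrMr // mul1r.
      by rewrite ltrDl.
  rewrite star_homZ nrmZ cabsR gtr0_norm ?invr_gt0 //.
  by rewrite mulrC ler_pdivrMr // mul1r.
have : nrm (phi x) ^+ 2 <= nrm x ^+ 2 by rewrite -!nrm_Mstar -phS -phM.
by rewrite ler_sqr ?nnegrE ?nrm_ge0.
Qed.

End star_hom.

(** * Words *)

Definition lev (r : nat) (x m : natvec r) : Prop := forall i, (x i <= m i)%N.

Lemma addvE (r : nat) (x y : natvec r) i : (x + y) i = (x i + y i)%N.
Proof. by rewrite ffunE. Qed.

Lemma zerovE (r : nat) i : (0 : natvec r) i = 0%N.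
Proof. by rewrite ffunE. Qed.

Definition subv (r : nat) (x y : natvec r) : natvec r := [ffun i => x i - y i]%N.
Definition maxv (r : nat) (x y : natvec r) : natvec r := [ffun i => maxn (x i) (y i)].

Lemma subvE (r : nat) (x y : natvec r) i : subv x y i = (x i - y i)%N.
Proof. by rewrite ffunE. Qed.

Lemma subvK (r : nat) (x y : natvec r) : lev y x -> subv x y + y = x.
Proof. by move=> h; apply/ffunP => i; rewrite addvE subvE subnK. Qed.

Lemma addvI (r : nat) (a x y : natvec r) : a + x = a + y -> x = y.
Proof. by move=> /ffunP h; apply/ffunP => i; have := h i; rewrite !addvE => /addnI. Qed.

Lemma addvsubv (r : nat) (x y : natvec r) : x + subv y x = maxv x y.
Proof. by apply/ffunP => i; rewrite addvE subvE ffunE maxnE. Qed.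

Lemma maxvC (r : nat) (x y : natvec r) : maxv x y = maxv y x.
Proof. by apply/ffunP => i; rewrite !ffunE maxnC. Qed.

Lemma lev_refl (r : nat) (x : natvec r) : lev x x.
Proof. by move=> i. Qed.
Lemma lev0 (r : nat) (x : natvec r) : lev 0 x.
Proof. by move=> i; rewrite zerovE. Qed.
Lemma lev_trans (r : nat) (y x z : natvec r) : lev x y -> lev y z -> lev x z.
Proof. by move=> h k i; exact: leq_trans (h i) (k i). Qed.
Lemma lev_addr (r : nat) (x y : natvec r) : lev x (x + y).
Proof. by move=> i; rewrite addvE leq_addr. Qed.
Lemma lev_addl (r : nat) (x y : natvec r) : lev x (y + x).
Proof. by move=> i; rewrite addvE leq_addl. Qed.
Lemma lev_add (r : nat) (x y x' y' : natvec r) : lev x x' -> lev y y' -> lev (x + y) (x' + y').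
Proof. by move=> h k i; rewrite !addvE leq_add. Qed.
Lemma lev_maxl (r : nat) (x y : natvec r) : lev x (maxv x y).
Proof. by move=> i; rewrite ffunE leq_maxl. Qed.
Lemma lev_maxr (r : nat) (x y : natvec r) : lev y (maxv x y).
Proof. by move=> i; rewrite ffunE leq_maxr. Qed.
#[local] Hint Resolve lev_refl lev0 lev_addr lev_addl lev_maxl lev_maxr : core.

Lemma natvec_ind (r : nat) (P : natvec r -> Prop) : P 0 ->
  (forall m j, P m -> P (m + unit_vec j)) -> forall m, P m.
Proof.
move=> P0 PS m; have [n] := ubnP (\sum_i m i); elim: n m => // n IH m hn.
have [/forallP m0|] := boolP [forall i, m i == 0%N].
  suff -> : m = 0 by []; apply/ffunP => i; rewrite zerovE; exact/eqP.
rewrite negb_forall => /existsP[j mj].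
have hj : lev (unit_vec j) m.
  by move=> i; rewrite ffunE; case: eqP => // ->; rewrite lt0n.
rewrite -(subvK hj); apply/PS/IH.
rewrite ltnS in hn; apply: leq_trans hn.
rewrite (bigD1 j) //= [ltnRHS](bigD1 j) //= -addSn leq_add //.
  by rewrite subvE ffunE eqxx subn1 prednK // lt0n.
by apply: leq_sum => i _; rewrite subvE leq_subr.
Qed.

Section words.
Variables (r : nat) (A : finType) (M : 'I_r -> A -> A -> int).
Implicit Types (m n x y : natvec r) (u v w : words M).

Lemma coordsK m (l : box r m) : in_box m (coords l) = l.
Proof. by apply/ffunP => i; rewrite !ffunE inord_val. Qed.

Lemma coords_lev m (l : box r m) : lev (coords l) m.
Proof. by move=> i; rewrite ffunE -ltnS. Qed.

Lemma in_boxK m x : lev x m -> coords (in_box m x) = x.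
Proof. by move=> h; apply/ffunP => i; rewrite !ffunE inordK // ltnS. Qed.

(** Words have a shape-dependent type.  Read as functions on all of Z_+^r,
    with values that are meaningful on the box of the shape only, words of
    different shapes can be compared without transport. *)
Definition wval u x : A := tagged u (in_box (tag u) x).

Lemma orgE u : org u = wval u 0. Proof. by []. Qed.
Lemma trmE u : trm u = wval u (tag u). Proof. by []. Qed.

Definition word_on m (f : natvec r -> A) : Prop :=
  forall x j, lev (x + unit_vec j) m -> M j (f (x + unit_vec j)) (f x) = 1.

Lemma word_on_wval u : word_on (tag u) (wval u).
Proof.
move=> x j h; rewrite /wval; case: u h => m [w] /=; rewrite /tagged /= => ww h.
have /forallP/(_ (in_box m x)) /forallP/(_ j) := ww.
have hx : lev x m by apply: lev_trans h.
rewrite in_boxK // => /implyP hh; apply/eqP/hh.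
have := h j; rewrite addvE !ffunE eqxx addn1 => xj.
by rewrite inordK // ltnS ltnW.
Qed.

Lemma word_of m f : word_on m f -> exists u, tag u = m /\ forall x, lev x m -> wval u x = f x.
Proof.
move=> h; pose g : {ffun box r m -> A} := [ffun l => f (coords l)].
have gw : is_word M g.
  apply/forallP => l; apply/forallP => j; apply/implyP => lj.
  have hl : lev (coords l + unit_vec j) m.
    move=> i; rewrite addvE !ffunE; case: eqP => [->|_]; rewrite ?addn1 ?addn0 //.
    by rewrite -ltnS.
  by rewrite !ffunE in_boxK //; apply/eqP/h.
exists (mkwords (Word gw)); split=> // x hx.
by rewrite /wval /tagged /= ffunE in_boxK.
Qed.

Lemma word_on_sub m n f : lev n m -> word_on m f -> word_on n f.
Proof. by move=> nm h x j hx; apply: h; exact: lev_trans nm. Qed.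

Lemma word_on_shift m n f : word_on (m + n) f -> word_on n (fun x => f (x + m)).
Proof.
move=> h x j hx; rewrite addrAC; apply: h.
by rewrite addrAC [m + n]addrC; apply: lev_add.
Qed.

Lemma words_ext u v : tag u = tag v -> (forall x, lev x (tag u) -> wval u x = wval v x) ->
  u = v.
Proof.
case: u v => m u [n v] /= E; case: n / E v => v /=; rewrite /wval /tagged /= => h.
congr Tagged; apply/val_inj/ffunP => l.
by rewrite -[l]coordsK h //; exact: coords_lev.
Qed.

Lemma is_concatP m n (u : word M m) (v : word M n) (w : word M (m + n)) :
  is_concat u v w <->
  (forall x, lev x m -> wval (mkwords w) x = wval (mkwords u) x) /\
  (forall x, lev x n -> wval (mkwords w) (x + m) = wval (mkwords v) x).
Proof.
split=> [/andP[/eqP/ffunP h /eqP/ffunP k]|[h k]].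
  split=> x hx; rewrite /wval /tagged /=.
    by rewrite -h ffunE in_boxK // addr0.
  by rewrite -k ffunE in_boxK.
apply/andP; split; apply/eqP/ffunP => l; rewrite ffunE.
  by have := h _ (coords_lev l); rewrite /wval /tagged /= coordsK addr0.
by have := k _ (coords_lev l); rewrite /wval /tagged /= coordsK.
Qed.

Variable hM : admissible M.

Lemma concatP u v : trm u = org v ->
  [/\ tag (concat u v) = tag u + tag v,
      forall x, lev x (tag u) -> wval (concat u v) x = wval u x
    & forall x, lev x (tag v) -> wval (concat u v) (x + tag u) = wval v x].
Proof.
case: u v => m u [n v] uv; have [w [wP _]] := adm_H1 hM uv.
rewrite /concat; case: pickP => [w' /is_concatP[]|/(_ w)]; last by rewrite wP.
by split.
Qed.

(** The uniqueness in (H1); it is how all identities between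
    concatenations are proved. *)
Lemma concat_unique u v w : trm u = org v -> tag w = tag u + tag v ->
  (forall x, lev x (tag u) -> wval w x = wval u x) ->
  (forall x, lev x (tag v) -> wval w (x + tag u) = wval v x) -> w = concat u v.
Proof.
case: u v => m u [n v] uv; case: w => mw w /= E.
case: _ / (esym E) w => w h k; have [w0 [_ w0u]] := adm_H1 hM uv.
have [] := concatP uv; case: (concat _ _) => mc c /= E'.
case: _ / (esym E') c => c hc kc.
have hw : is_concat u v w by apply/(is_concatP u v w).
have hc' : is_concat u v c by apply/(is_concatP u v c).
by rewrite -(w0u w hw) -(w0u c hc').
Qed.

End words.
Arguments word_on_wval {r A M} u.

Section word_constructions.
Variables (r : nat) (A : finType) (M : 'I_r -> A -> A -> int) (hM : admissible M).
Implicit Types (m n x y : natvec r) (u v w : words M).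

Lemma trm_concat u v : trm u = org v -> trm (concat u v) = trm v.
Proof.
move=> uv; have [t _ k] := concatP hM uv.
by rewrite !trmE t addrC k.
Qed.

Lemma split_word w m : lev m (tag w) -> exists u v,
  [/\ tag u = m, tag v = subv (tag w) m, trm u = org v & w = concat u v].
Proof.
move=> mw; have [u [tu hu]] := word_of (word_on_sub mw (word_on_wval w)).
have wE : m + subv (tag w) m = tag w by rewrite addrC subvK.
have [|v [tv hv]] := @word_of _ _ M (subv (tag w) m) (fun x => wval w (x + m)).
  by apply: word_on_shift; rewrite wE; exact: word_on_wval.
have uv : trm u = org v by rewrite trmE orgE tu hu // hv // add0r.
exists u, v; split=> //; apply: (concat_unique hM) => //; rewrite tu ?tv ?wE //.
  by move=> x /hu.
by move=> x /hv.
Qed.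

Lemma concat_inj u v u' v' : trm u = org v -> trm u' = org v' -> tag u = tag u' ->
  concat u v = concat u' v' -> u = u' /\ v = v'.
Proof.
move=> uv uv' uu E; have [t h k] := concatP hM uv; have [t' h' k'] := concatP hM uv'.
split; apply: words_ext => //.
- by move=> x hx; rewrite -h // -h' -?uu // E.
- by apply: (addvI (a := tag u)); rewrite -t E t' uu.
- move=> x hx; rewrite -k // -k' -?uu ?E //.
  suff -> : tag v' = tag v by [].
  by apply: (addvI (a := tag u)); rewrite -t E t' uu.
Qed.

(** Both sides are determined by their restrictions; split the left
    one at the end of u and identify the remainder by uniqueness. *)
Lemma concatA u v w : trm u = org v -> trm v = org w ->
  concat (concat u v) w = concat u (concat v w).
Proof.
move=> uv vw; have cw : trm (concat u v) = org w by rewrite trm_concat.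
have uc : trm u = org (concat v w) by rewrite org_concat.
have [t1 h1 k1] := concatP hM uv; have [t2 h2 k2] := concatP hM vw.
have [t3 h3 k3] := concatP hM cw; set z := concat _ w in t3 h3 k3 *.
have uz : lev (tag u) (tag z) by rewrite t3 t1 -addrA.
have [u' [y [tu' ty uy zE]]] := split_word uz.
have [_ h4 k4] := concatP hM uy; rewrite -zE tu' in h4 k4.
have uu : u' = u.
  apply: words_ext => // x; rewrite tu' => hx.
  rewrite -h4 // h3 ?h1 // t1; exact: lev_trans hx _.
have ty2 : tag y = tag v + tag w.
  by rewrite ty t3 t1; apply/ffunP => i; rewrite subvE !addvE -addnA addKn.
rewrite zE uu; congr concat; apply: (concat_unique hM) => // x hx.
- rewrite -k4; last by rewrite ty2; exact: lev_trans hx _.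
  by rewrite h3 ?k1 // t1 addrC; apply: lev_add.
- rewrite -k4; last by rewrite ty2 addrC; apply: lev_add.
  by rewrite -addrA [tag v + _]addrC -t1 k3.
Qed.

Lemma letter_word a : exists u, tag u = 0 /\ trm u = a /\ org u = a.
Proof.
have [|u [tu hu]] := @word_of _ _ M 0 (fun=> a).
  move=> x j /(_ j); rewrite addvE !ffunE eqxx addn1 //.
by exists u; rewrite trmE orgE tu !hu.
Qed.

Lemma edge_word i a b : M i b a = 1 -> exists u, [/\ tag u = unit_vec i, org u = a & trm u = b].
Proof.
move=> h; have [|u [tu hu]] := @word_of _ _ M (unit_vec i) (fun x => if x == 0 then a else b).
  move=> x j xj.
  have ji : j = i.
    by have := xj j; rewrite addvE !ffunE eqxx addn1; case: eqP.
  (* the only edges inside the box of e_i start at the origin *)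
  have -> : x = 0.
    apply/ffunP => k; have := xj k; rewrite ji addvE zerovE -[X in (_ <= X)%N]add0n leq_add2r.
    by rewrite leqn0 => /eqP.
  rewrite add0r eqxx ji; case: eqP => // /ffunP/(_ i).
  by rewrite !ffunE eqxx.
exists u; split=> //; first by rewrite orgE hu // eqxx.
rewrite trmE tu hu //; case: eqP => // /ffunP/(_ i).
by rewrite !ffunE eqxx.
Qed.

Lemma path_word a b : exists u, org u = a /\ trm u = b.
Proof.
have /connectP[p pth ->] := adm_H2 hM a b.
elim: p a pth => [|c p IH] a /=; first by move=> _; have [u [_ [? ?]]] := letter_word a; exists u.
move=> /andP[/existsP[i /eqP h] /IH[v [ov tv]]].
have [u [_ ou tu]] := edge_word h.
by exists (concat u v); rewrite org_concat trm_concat ?ov.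
Qed.

(** By (H0) each M_i has an edge, which (H2) makes reachable from any
    letter; concatenating over all i gives a word that is positive in every
    direction. *)
Lemma long_word a : exists u, org u = a /\ forall i, (0 < tag u i)%N.
Proof.
suff [u [ou hu]] : exists u, org u = a /\ forall i, i \in enum 'I_r -> (0 < tag u i)%N.
  by exists u; split=> // i; apply: hu; rewrite mem_enum.
elim: (enum _) => [|i s [u [ou hu]]]; first by have [u [_ [_ ou]]] := letter_word a; exists u.
have [h01 [b [a' h]]] := adm_H0 hM i.
have {}h : M i b a' = 1 by case: (h01 b a').
have [v [tv ov _]] := edge_word h.
have [q [oq tq]] := path_word (trm u) a'.
have qv : trm q = org v by rewrite tq.
have uq : trm u = org (concat q v) by rewrite org_concat.
exists (concat u (concat q v)); rewrite org_concat; split=> // k.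
have [-> _ _] := concatP hM uq; have [-> _ _] := concatP hM qv.
rewrite !addvE tv ffunE in_cons => /orP[/eqP ->|/hu]; first by rewrite eqxx addn1 addnS.
by move=> ku; rewrite ltn_addr.
Qed.

(** Failure of p-periodicity, with both points as vectors, so that it
    is visibly inherited by longer words. *)
Definition aperiodic (p : intvec r) w : Prop := exists j k : natvec r,
  [/\ lev j (tag w), lev k (tag w), forall i, (k i)%:Z = (j i)%:Z - p i & wval w j <> wval w k].

Lemma aperiodic_catl p u w : trm u = org w -> aperiodic p w -> aperiodic p (concat u w).
Proof.
move=> uw [j [k [jw kw jk h]]]; have [t _ k'] := concatP hM uw.
exists (j + tag u), (k + tag u); split; rewrite ?t ?[tag u + _]addrC ?k' //; try exact: lev_add.
by move=> i; rewrite !addvE !PoszD jk addrAC.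
Qed.

Lemma aperiodic_catr p u w : trm w = org u -> aperiodic p w -> aperiodic p (concat w u).
Proof.
move=> uw [j [k [jw kw jk h]]]; have [t h' _] := concatP hM uw.
exists j, k; split; rewrite ?t ?h' //; exact: lev_trans (lev_addr _ _).
Qed.

(** (H3) gives a word for each p; connect them by paths.  A word
    that contains one without the period p does not have the period p. *)
Lemma aperiodic_word a (ps : seq (intvec r)) : (forall p, p \in ps -> p != 0) ->
  exists w, org w = a /\ forall p, p \in ps -> aperiodic p w.
Proof.
elim: ps => [_|p ps IH hp]; first by have [u [_ [_ ou]]] := letter_word a; exists u.
have [|w [ow hw]] := IH; first by move=> q qs; apply: hp; rewrite in_cons qs orbT.
have [|l [v hv]] := adm_H3 hM (p := p); first by apply: hp; rewrite mem_head.
have {}hv : aperiodic p (mkwords v).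
  apply: contrapT => h; apply: hv => j k jk; apply: contrapT => vjk; apply: h.
  exists (coords j), (coords k); split; rewrite /wval /tagged /= ?coordsK //; try exact: coords_lev.
  by move=> i; rewrite !ffunE.
have [q [oq tq]] := path_word (trm w) (org (mkwords v)).
have wq : trm w = org q by rewrite oq.
exists (concat w (concat q (mkwords v))); split; first by rewrite org_concat.
move=> p'; rewrite in_cons => /orP[/eqP ->|/hw].
  by apply: aperiodic_catl; [rewrite org_concat|apply: aperiodic_catl].
by apply: aperiodic_catr; rewrite org_concat.
Qed.

End word_constructions.

Section wseq.
Variables (r : nat) (A : finType) (M : 'I_r -> A -> A -> int) (hM : admissible M).

(** Words as elements of the sigma type [words M], so that sums over
    words of different shapes can be reindexed by permutation of lists. *)
Definition wseq (n : natvec r) (a : A) : seq (words M) :=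
  [seq mkwords w | w <- enum {: word M n} & worigin w == a].

Lemma mkwords_inj n : injective (@mkwords r A M n).
Proof. by move=> u v /eqP; rewrite /mkwords -tag_eqE /tag_eq /= eqxx tagged_asE => /eqP. Qed.

Lemma mem_wseq n a (u : words M) : u \in wseq n a <-> tag u = n /\ org u = a.
Proof.
split=> [/mapP[w]|[]].
  by rewrite mem_filter => /andP[/eqP <- _] ->.
case: u => m u /= E <-; rewrite -E; apply: map_f.
by rewrite mem_filter eqxx mem_enum.
Qed.

Lemma wseq_uniq n a : uniq (wseq n a).
Proof.
by rewrite map_inj_uniq; [apply/filter_uniq/enum_uniq|exact: mkwords_inj].
Qed.

Lemma big_wseq (V : nmodType) n a (F : words M -> V) :
  \sum_(w : word M n | worigin w == a) F (mkwords w) = \sum_(w <- wseq n a) F w.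
Proof. by rewrite big_map big_filter big_enum_cond. Qed.

(** Unique factorization of words of shape m + n. *)
Lemma big_wseqD (V : nmodType) m n a (F : words M -> V) :
  \sum_(w <- wseq (m + n) a) F w =
  \sum_(w1 <- wseq m a) \sum_(w2 <- wseq n (trm w1)) F (concat w1 w2).
Proof.
(* both sums run over lists without repetition that have the same elements *)
pose L := [seq concat w1 w2 | w1 <- wseq m a, w2 <- wseq n (trm w1)].
have -> : \sum_(w1 <- wseq m a) \sum_(w2 <- wseq n (trm w1)) F (concat w1 w2) =
   \sum_(w <- L) F w.
  by rewrite big_allpairs_dep.
apply/perm_big/uniq_perm; first exact: wseq_uniq.
  apply: allpairs_uniq_dep => [|w1 _|]; try exact: wseq_uniq.
  move=> /= [u v] [u' v'] /allpairsPdep[u1 [v1 [/mem_wseq[tu _] /mem_wseq[tv ov] [-> ->]]]].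
  move=> /allpairsPdep[u2 [v2 [/mem_wseq[tu2 _] /mem_wseq[tv2 ov2] [-> ->]]]] /=.
  by move=> /(concat_inj hM) []; rewrite ?tu ?tu2 // => -> ->.
move=> w; apply/idP/idP.
  move=> /mem_wseq[tw ow]; have [|u [v [tu tv uv wE]]] := split_word hM (w := w) (m := m).
    by rewrite tw.
  apply/allpairsPdep; exists u, v; split=> //; apply/mem_wseq; split=> //.
    by rewrite -ow wE org_concat.
  by rewrite tv tw; apply/ffunP => i; rewrite subvE addvE addKn.
move=> /allpairsPdep[u [v [/mem_wseq[tu ou] /mem_wseq[tv ov] ->]]].
have [t _ _] := concatP hM (esym ov).
by apply/mem_wseq; rewrite org_concat t tu tv.
Qed.

Lemma wseq0 a : exists2 u, wseq 0 a = [:: u] & tag u = 0 /\ org u = a.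
Proof.
have [u [tu [_ ou]]] := letter_word M a; exists u => //.
have h v : v \in wseq 0 a = (v == u).
  apply/idP/eqP => [/mem_wseq[tv ov]|->]; last exact/mem_wseq.
  apply: words_ext; first by rewrite tu.
  move=> x; rewrite tv => hx.
  have -> : x = 0 by apply/ffunP => i; have := hx i; rewrite zerovE leqn0 => /eqP.
  by rewrite -!orgE ou.
apply: perm_small_eq => //.
by apply: uniq_perm; rewrite ?wseq_uniq // => v; rewrite h inE.
Qed.

End wseq.

(** * Decorated words and the defining relations *)

(* classical equality, so that formal sums indexed by decorated words can be sorted and filtered *)
HB.instance Definition _ (r : nat) (A : finType) (M : 'I_r -> A -> A -> int)
  (D : countType) (delta : D -> A) := gen_eqMixin (dword M delta).
HB.instance Definition _ (r : nat) (A : finType) (M : 'I_r -> A -> A -> int)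
  (D : countType) (delta : D -> A) := gen_choiceMixin (dword M delta).

Section dwords.
Variables (r : nat) (A : finType) (M : 'I_r -> A -> A -> int) (hM : admissible M).
Variables (D : countType) (delta : D -> A).
Local Notation dw := (dword M delta).
Implicit Types (u v : dw) (w : words M) (m n x : natvec r).

Definition dval u (x : natvec r) : A := wval (dunder u) x.

Lemma dword_ext0 u v : deco u = deco v -> dunder u = dunder v -> u = v.
Proof.
case: u v => d u hu [e v hv] /= E F; case: e / E hv => hv; case: v / F hv => hv.
by congr DWord; exact: bool_irrelevance.
Qed.

Lemma dword_ext u v : deco u = deco v -> dshape u = dshape v ->
  (forall x, lev x (dshape u) -> dval u x = dval v x) -> u = v.
Proof. by move=> ? ? ?; apply: dword_ext0 => //; exact: words_ext. Qed.

Lemma org_dunder u : org (dunder u) = delta (deco u).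
Proof. by case: u => d u /= /eqP. Qed.

Lemma dconcat_shape u w : dtrm u = org w -> dshape (dconcat u w) = dshape u + tag w.
Proof. by move=> uw; have [] := concatP hM uw. Qed.

Lemma dconcat_trm u w : dtrm u = org w -> dtrm (dconcat u w) = trm w.
Proof. exact: trm_concat. Qed.

Lemma dvalL u w x : dtrm u = org w -> lev x (dshape u) -> dval (dconcat u w) x = dval u x.
Proof. by move=> uw; have [_ h _] := concatP hM uw; exact: h. Qed.

Lemma dvalR u w x : dtrm u = org w -> lev x (tag w) ->
  dval (dconcat u w) (x + dshape u) = wval w x.
Proof. by move=> uw; have [_ _ h] := concatP hM uw; exact: h. Qed.

Lemma dconcatA u w w' : dtrm u = org w -> trm w = org w' ->
  dconcat (dconcat u w) w' = dconcat u (concat w w').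
Proof. by move=> uw ww; apply: dword_ext0 => //=; exact: concatA. Qed.

Lemma dconcat0 u w : tag w = 0 -> dtrm u = org w -> dconcat u w = u.
Proof.
move=> tw uw; apply: dword_ext => //; rewrite dconcat_shape // tw addr0 // => x.
exact: dvalL.
Qed.

Lemma dconcat_inj u w v w' : dtrm u = org w -> dtrm v = org w' -> dshape u = dshape v ->
  dconcat u w = dconcat v w' -> u = v /\ w = w'.
Proof.
move=> uw vw uv E.
have E1 : concat (dunder u) w = concat (dunder v) w' by move: (congr1 (@dunder _ _ _ _ _) E).
have [h ->] := concat_inj hM uw vw uv E1.
by split=> //; apply: dword_ext0 => //; move: (congr1 (@deco _ _ _ _ _) E).
Qed.

Lemma dsplit u m : lev m (dshape u) -> exists v w,
  [/\ dshape v = m, tag w = subv (dshape u) m, dtrm v = org w & u = dconcat v w].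
Proof.
move=> /(split_word hM)[v [w [tv tw vw E]]].
have hv : org v == delta (deco u) by rewrite -org_dunder E org_concat.
by exists (DWord hv), w; split=> //; apply: dword_ext0.
Qed.

Lemma dletter d : exists u, deco u = d /\ dshape u = 0.
Proof.
have [u [tu [_ /eqP hu]]] := letter_word M (delta d).
by exists (DWord hu).
Qed.

Lemma dletter_unique u v : dshape u = 0 -> dshape v = 0 -> deco u = deco v -> u = v.
Proof.
move=> u0 v0 uv; apply: dword_ext => //; rewrite u0 // => x x0.
have -> : x = 0 by apply/ffunP => i; have := x0 i; rewrite zerovE leqn0 => /eqP.
by have := congr1 delta uv; rewrite -!org_dunder.
Qed.

End dwords.

Section relations.
Variables (R : realType) (r : nat) (A : finType) (M : 'I_r -> A -> A -> int).
Variables (hM : admissible M) (D : countType) (delta : D -> A).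
Variables (B : cstarAlgType R) (s : dword M delta -> dword M delta -> B).
Hypothesis hs : AD_relations s.
Local Notation dw := (dword M delta).
Implicit Types (u v x : dw) (w : words M) (m n : natvec r).

Local Notation P u := (s u u).

Lemma projP u : projection (P u).
Proof. by split; rewrite ?(AD_mul hs) ?(AD_star hs). Qed.

(** The sum relation, stated for the shapes e_j, iterates to an
    arbitrary shape. *)
Lemma s_expand n u v : dtrm u = dtrm v ->
  s u v = \sum_(w <- wseq M n (dtrm u)) s (dconcat u w) (dconcat v w).
Proof.
elim/natvec_ind: n u v => [|n j IH] u v uv.
  have [w -> [tw ow]] := wseq0 M (dtrm u).
  by rewrite big_seq1 !dconcat0 // -?uv.
rewrite (big_wseqD hM) (IH u v uv); apply: eq_big_seq => w /mem_wseq[tw ow].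
have uw : dtrm u = org w by [].
have vw : dtrm v = org w by rewrite -uv.
rewrite (AD_sum hs _ j); last by rewrite !dconcat_trm.
rewrite dconcat_trm // (big_wseq _ _ (fun w' => s (dconcat (dconcat u w) w') (dconcat (dconcat v w) w'))).
by apply: eq_big_seq => w' /mem_wseq[tw' ow']; rewrite !dconcatA.
Qed.

Lemma s_mulPl u v : dtrm u = dtrm v -> P u ** s u v = s u v.
Proof. by move=> uv; rewrite (AD_mul hs). Qed.

Lemma s_mulPr u v : dtrm u = dtrm v -> s u v ** P v = s u v.
Proof. by move=> uv; rewrite (AD_mul hs). Qed.

(** The relations only say that the P_{uw}, w of shape e_j, are
    projections with sum P_u.  In a C*-algebra this forces orthogonality. *)
Lemma P_siblings j u w w' : tag w = unit_vec j -> tag w' = unit_vec j ->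
  dtrm u = org w -> dtrm u = org w' -> w <> w' ->
  P (dconcat u w) ** P (dconcat u w') = 0.
Proof.
case: w => m w /= E; case: w' => m' w' /= E'; move: w w'.
rewrite E E' => w w' uw uw' ww'.
have ww : w != w' by apply/eqP => ww; apply: ww'; rewrite ww.
have uw1 : worigin w == dtrm u by rewrite uw.
have uw2 : worigin w' == dtrm u by rewrite uw'.
have pP (i : word M (unit_vec j)) : worigin i == dtrm u -> projection (P (dconcat u (mkwords i))).
  by move=> _; exact: projP.
have sP : projection (\sum_(i : word M (unit_vec j) | worigin i == dtrm u)
    P (dconcat u (mkwords i))).
  by rewrite -(AD_sum hs) //; exact: projP.
exact: (projections_orthogonal pP sP uw1 uw2 ww).
Qed.

Lemma P_prefix1 j u w : tag w = unit_vec j -> dtrm u = org w ->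
  P (dconcat u w) ** P u = P (dconcat u w) /\ P u ** P (dconcat u w) = P (dconcat u w).
Proof.
move=> tw uw; have E : P u = P (dconcat u w) +
    \sum_(w' <- wseq M (unit_vec j) (dtrm u) | w' != w) P (dconcat u w').
  rewrite {1}(@s_expand (unit_vec j) u u) // (bigD1_seq w) ?wseq_uniq //.
  exact/mem_wseq.
have [pp _] := projP (dconcat u w).
split; rewrite {1}E ?cmulDr ?cmulDl pp ?cmul_sumr ?cmul_suml big_seq_cond big1 ?addr0 // => w' /andP[/mem_wseq[tw' ow'] /eqP ww'].
  by apply: P_siblings tw tw' _ _ _ => // /esym.
by apply: P_siblings tw' tw _ _ _.
Qed.

(** By induction on the shape: either the words already differ before
    the last letter, or they are siblings. *)
Lemma P_orth u v : dshape u = dshape v -> u <> v -> P u ** P v = 0.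
Proof.
move: (erefl (dshape u)); move: {2}(dshape u) => m; elim/natvec_ind: m u v => [|m j IH] u v um uv neq.
  by rewrite (AD_orth hs) // -uv.
have mu : lev m (dshape u) by rewrite um.
have mv : lev m (dshape v) by rewrite -uv um.
have tj : subv (m + unit_vec j) m = unit_vec j.
  by apply/ffunP => i; rewrite subvE addvE addKn.
have [u' [w [su tw uw uE]]] := dsplit hM mu.
have [v' [w' [sv tw' vw' vE]]] := dsplit hM mv.
rewrite um tj in tw; rewrite -uv um tj in tw'.
have [h1 h2] := P_prefix1 tw uw; have [h3 h4] := P_prefix1 tw' vw'.
have [uv'|uv'] := eqVneq u' v'.
  rewrite uE vE -uv'; apply: (P_siblings tw tw') => //; first by rewrite uv'.
  by move=> ww; apply: neq; rewrite uE vE uv' ww.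
rewrite uE vE -h1 -h4 cmulA -[P _ ** P u' ** P v']cmulA IH //; last exact/eqP.
  by rewrite cmul0r cmul0l.
by rewrite su.
Qed.

Lemma P_mulE u v : dshape u = dshape v -> P u ** P v = if u == v then P u else 0.
Proof.
move=> uv; case: eqVneq => [->|/eqP]; first by have [] := projP v.
exact: P_orth.
Qed.

(** For a fixed shape the s_{u,v} multiply like matrix units. *)
Lemma s_mulE u v v' x : dtrm u = dtrm v -> dtrm v' = dtrm x -> dshape v = dshape v' ->
  s u v ** s v' x = if v == v' then s u x else 0.
Proof.
move=> uv vx vv; case: eqVneq => [E|/eqP neq].
  by rewrite -E in vx *; rewrite (AD_mul hs).
rewrite -(s_mulPr uv) -(s_mulPl vx) cmulA -[s u v ** _ ** _]cmulA P_orth //.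
by rewrite cmul0r cmul0l.
Qed.

Lemma s_concatR u v w : dtrm u = dtrm v -> dtrm v = org w ->
  s u v ** P (dconcat v w) = s (dconcat u w) (dconcat v w).
Proof.
move=> uv vw; have uw : dtrm u = org w by rewrite uv.
have hw : w \in wseq M (tag w) (dtrm u) by apply/mem_wseq.
rewrite (@s_expand (tag w) u v) // cmul_suml (bigD1_seq w) ?wseq_uniq //=.
rewrite s_mulE ?dconcat_trm // eqxx big_seq_cond big1 ?addr0 // => w' /andP[/mem_wseq[tw' ow'] /eqP ww'].
have vw' : dtrm v = org w' by rewrite -uv.
rewrite s_mulE ?dconcat_shape ?dconcat_trm ?tw' //.
by case: eqP => // /(dconcat_inj hM) []// _ /ww'.
Qed.

Lemma s_concatL u v w : dtrm u = dtrm v -> dtrm v = org w ->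
  P (dconcat u w) ** s u v = s (dconcat u w) (dconcat v w).
Proof.
move=> uv vw; have uw : dtrm u = org w by rewrite uv.
have h := @s_concatR v u w (esym uv) uw.
rewrite -[LHS]cstarK cstarM (projP _).2 (AD_star hs) // h (AD_star hs) //.
by rewrite !dconcat_trm.
Qed.

(** Extend both words to a common shape: the extensions remain
    different, so the previous orthogonality applies termwise. *)
Lemma P_disagree u v : (deco u <> deco v \/ exists x : natvec r,
    [/\ lev x (dshape u), lev x (dshape v) & dval u x <> dval v x]) ->
  P u ** P v = 0.
Proof.
move=> huv; rewrite (@s_expand (subv (dshape v) (dshape u)) u u) //.
rewrite (@s_expand (subv (dshape u) (dshape v)) v v) // cmul_suml.
rewrite big_seq big1 // => w /mem_wseq[tw ow].
rewrite cmul_sumr big_seq big1 // => w' /mem_wseq[tw' ow'].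
apply: P_orth; first by rewrite !dconcat_shape // tw tw' !addvsubv maxvC.
move=> E; case: huv => [h|[x [xu xv h]]]; apply: h.
  exact: (congr1 (fun z : dw => deco z) E).
by rewrite -(dvalL hM (esym ow) xu) -(dvalL hM (esym ow') xv) E.
Qed.

(** P_u in I gives P_v in I for t(v) = t(u), since
    P_v = s_{v,u} P_u s_{u,v}, and P_{uw} in I for every w.  Irreducibility then
    reaches every terminus. *)
Lemma ideal_contains_generators (I : set B) u0 : closed_ideal I -> I (P u0) ->
  forall u v, dtrm u = dtrm v -> I (s u v).
Proof.
move=> [I0 IL Il Ir _] Iu0.
have step u v : I (P u) -> dtrm u = dtrm v -> I (P v).
  move=> Iu uv; rewrite -[P v]((projP v).1) -(@AD_mul _ _ _ _ _ _ _ _ hs v u v) //.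
  by rewrite -(s_mulPl uv) cmulA; apply: Il; exact: Ir.
suff hP v : I (P v).
  by move=> u v uv; rewrite -(s_mulPl uv); exact: Ir.
have [w [ow tw]] := path_word hM (dtrm u0) (dtrm v).
have uw : dtrm u0 = org w by [].
apply: (step (dconcat u0 w)); last by rewrite dconcat_trm.
by rewrite -s_concatR //; exact: Ir.
Qed.

End relations.

(** * Roots of unity and characters *)

Lemma prim_root_exists (C : numClosedFieldType) N : (0 < N)%N ->
  exists z : C, N.-primitive_root z.
Proof.
move=> N0; pose p : {poly C} := 'X^N - 1.
have [rs Dp] := closed_field_poly_normal p.
rewrite (monicP _) ?monicXnsubC // scale1r in Dp.
have rn1 : all N.-unity_root rs by apply/allP => z; rewrite -root_prod_XsubC -Dp.
have srs : size rs = N.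
  by apply/eqP; rewrite -eqSS -(size_prod_XsubC rs id) -Dp size_XnsubC.
have urs : uniq rs.
  by rewrite -separable_prod_XsubC -Dp separable_Xn_sub_1 // pnatr_eq0 -lt0n.
have /hasP[z _ hz] : has N.-primitive_root rs by rewrite (has_prim_root _ rn1) // srs.
by exists z.
Qed.

Definition boxv (r n : nat) (a : {ffun 'I_r -> 'I_n}) : natvec r :=
  [ffun i => nat_of_ord (a i)].

Section characters.
Variables (C : numClosedFieldType) (r N : nat) (N0 : (0 < N)%N).
Variables (q : C) (qP : N.-primitive_root q).

Definition chi (z : {ffun 'I_r -> 'I_N}) (m : natvec r) : C :=
  \prod_i q ^+ (z i * m i).

Lemma chiD z m n : chi z (m + n) = chi z m * chi z n.
Proof.
by rewrite /chi -big_split; apply: eq_bigr => i _; rewrite addvE mulnDr exprD.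
Qed.

Lemma root_conj : q * q^* = 1.
Proof.
rewrite -normCK; apply/eqP; rewrite sqrp_eq1 //.
by rewrite -(@pexpr_eq1 _ _ N) // -normrX prim_expr_order // normr1.
Qed.

Lemma chi_conj z m : chi z m * (chi z m)^* = 1.
Proof.
rewrite /chi rmorph_prod -big_split /= big1 // => i _.
by rewrite rmorphXn -exprMn root_conj expr1n.
Qed.

(** Orthogonality of the characters of (Z/N)^r. *)
Lemma sum_chi (m m' : natvec r) : (forall i, (m i < N)%N) -> (forall i, (m' i < N)%N) ->
  \sum_z chi z m * (chi z m')^* = if m == m' then (N ^ r)%:R else 0.
Proof.
move=> mN mN'.
pose g i := q ^+ m i * q^* ^+ m' i.
have -> : \sum_z chi z m * (chi z m')^* = \prod_(i < r) \sum_(k < N) g i ^+ k.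
  rewrite (bigA_distr_bigA (fun i (k : 'I_N) => g i ^+ k)) /=; apply: eq_bigr => z _.
  rewrite /chi rmorph_prod -big_split /=; apply: eq_bigr => i _.
  by rewrite exprMn -!exprM rmorphXn ![(z i * _)%N]mulnC.
have g1 i : g i = 1 <-> m i = m' i.
  split=> [gi|E]; last by rewrite /g E -exprMn root_conj expr1n.
  have : q ^+ m i = q ^+ m' i.
    by rewrite -[RHS]mul1r -gi /g -mulrA -exprMn mulrC [_^* * _]mulrC root_conj expr1n mul1r.
  by move/eqP; rewrite (eq_prim_root_expr qP) !modn_small // => /eqP.
case: eqP => [E|neq].
  rewrite (eq_bigr (fun=> N%:R)) => [|i _]; last first.
    rewrite (_ : g i = 1); last by apply/g1; rewrite E.
    by under eq_bigr do rewrite expr1n; rewrite sumr_const card_ord.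
  by rewrite prodr_const card_ord natrX.
have /existsP[i mi] : [exists i, m i != m' i].
  apply: contrapT => /negP; rewrite negb_exists => /forallP h; apply: neq.
  by apply/ffunP => i; have := h i; rewrite negbK => /eqP.
rewrite (bigD1 i) //=; suff -> : \sum_(k < N) g i ^+ k = 0 by rewrite mul0r.
apply/(mulfI (x := g i - 1)).
  by rewrite subr_eq0; apply: contra mi => /eqP/g1 ->.
have qN : q ^+ N = 1 by exact: prim_expr_order.
rewrite -subrX1 mulr0 /g exprMn -!exprM ![(_ * N)%N]mulnC !exprM -rmorphXn qN rmorph1.
by rewrite !expr1n mulr1 subrr.
Qed.

End characters.

(** * Homogeneous components and Fejer means *)

Section formal.
Variables (R : realType) (r : nat) (A : finType) (M : 'I_r -> A -> A -> int).
Variables (hM : admissible M) (D : countType) (delta : D -> A).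
Local Notation dw := (dword M delta).
Local Notation term := (R[i] * (dw * dw))%type.
Implicit Types (u v x : dw) (w : words M) (m n : natvec r) (L : seq term).

Definition well_formed L : Prop := forall t, t \in L -> dtrm t.2.1 = dtrm t.2.2.

(** Homogeneous components of an element of the algebra are not known to
    be well defined; they are taken on formal combinations, and [eval] is only
    applied at the end. *)
Definition eval (B : cstarAlgType R) (s : dw -> dw -> B) L : B :=
  \sum_(t <- L) t.1 *: s t.2.1 t.2.2.

(** The degree condition shape(u) - shape(v) = b - a, written without
    subtraction. *)
Definition component (a b : natvec r) L : seq term :=
  [seq t <- L | dshape t.2.1 + a == dshape t.2.2 + b].

Lemma well_formed_component a b L : well_formed L -> well_formed (component a b L).
Proof. by move=> h t; rewrite mem_filter => /andP[_ /h]. Qed.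

Section algebra.
Variables (B : cstarAlgType R) (s : dw -> dw -> B) (hs : AD_relations s).
Local Notation P u := (s u u).

Definition span : set B := [set x | exists2 L, well_formed L & x = eval s L].

Lemma span0 : span 0.
Proof. by exists [::] => //; rewrite /eval big_nil. Qed.

Lemma span_gen u v : dtrm u = dtrm v -> span (s u v).
Proof.
move=> uv; exists [:: (1, (u, v))]; last by rewrite /eval big_seq1 scale1r.
by move=> t; rewrite inE => /eqP ->.
Qed.

Lemma spanD y z : span y -> span z -> span (y + z).
Proof.
move=> [L hL ->] [K hK ->]; exists (L ++ K); last by rewrite /eval big_cat.
by move=> t; rewrite mem_cat => /orP[/hL|/hK].
Qed.

Lemma spanZ (c : R[i]) y : span y -> span (c *: y).
Proof.
move=> [L hL ->]; exists [seq (c * t.1, t.2) | t <- L].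
  by move=> t /mapP[t' /hL h ->].
by rewrite /eval big_map scaler_sumr; apply: eq_bigr => t _; rewrite scalerA.
Qed.

Lemma span_sum (I : eqType) (l : seq I) (F : I -> B) : (forall i, i \in l -> span (F i)) ->
  span (\sum_(i <- l) F i).
Proof.
move=> h; rewrite big_seq; elim/big_ind: _ => //; [exact: span0|exact: spanD].
Qed.

Lemma spanM y z : span y -> span z -> span (y ** z).
Proof.
move=> [L hL ->] [K hK ->]; rewrite /eval cmul_suml; apply: span_sum => t tL.
rewrite cmul_sumr; apply: span_sum => t' tK.
rewrite cmulZl cmulZr; do 2 apply: spanZ.
move: (hL _ tL) (hK _ tK); move: t.2 t'.2 => [u v] [v' x] /= uv vx.
rewrite (s_expand hM hs (subv (dshape v') (dshape v)) uv).
rewrite (s_expand hM hs (subv (dshape v) (dshape v')) vx).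
rewrite cmul_suml; apply: span_sum => w /mem_wseq[tw ow].
rewrite cmul_sumr; apply: span_sum => w' /mem_wseq[tw' ow'].
have vw : dtrm v = org w by rewrite -uv.
have xw : dtrm x = org w' by rewrite -vx.
rewrite (s_mulE hM hs) ?dconcat_trm ?dconcat_shape // ?tw ?tw' ?addvsubv; last exact: maxvC.
case: eqP => [E|_]; last exact: span0; apply: span_gen.
by have := congr1 (@dtrm _ _ _ _ _) E; rewrite !dconcat_trm.
Qed.

Lemma span_star y : span y -> span (cstar y).
Proof.
move=> [L hL ->]; rewrite /eval cstar_sum; apply: span_sum => t /hL h.
by rewrite cstarZ (AD_star hs) //; apply/spanZ/span_gen.
Qed.

Lemma approx_span_subalgebra : cstar_subalgebra (approx span).
Proof.
split.
- exact/approx_sub/span0.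
- move=> c x y /approx_nlim[a ha ax] /approx_nlim[b hb bx].
  by apply: (nlim_approx _ (nlimD (nlimZ c ax) bx)) => n; apply/spanD/hb/spanZ/ha.
- move=> x y /approx_nlim[a ha ax] /approx_nlim[b hb bx].
  by apply: (nlim_approx _ (nlimM ax bx)) => n; exact: spanM.
- move=> x /approx_nlim[a ha ax].
  by apply: (nlim_approx _ (nlim_star ax)) => n; exact: span_star.
- exact: closed_approx.
Qed.

(** By (AD_orth) the projections of distinct decorations are
    orthogonal, and P_u is below the one of its decoration. *)
Lemma local_unit (l : seq dw) : exists2 e, projection e & forall u, u \in l -> e ** P u = P u.
Proof.
have /choice[lf hlf] := dletter M delta.
have lfP d d' : P (lf d) ** P (lf d') = if d == d' then P (lf d) else 0.
  rewrite (P_mulE hM hs); last by rewrite (hlf d).2 (hlf d').2.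
  suff -> : (lf d == lf d') = (d == d') by [].
  apply/eqP/eqP => [E|->//]; by rewrite -(hlf d).1 -(hlf d').1 E.
have lfu d u : P (lf d) ** P u = if d == deco u then P u else 0.
  case: eqP => [E|neq]; last by apply: (P_disagree hM hs); left; rewrite (hlf d).1.
  have [v [w [tv tw vw uE]]] := dsplit hM (@lev0 _ (dshape u)).
  have -> : lf d = v.
    apply: dletter_unique => //; first by case: (hlf d).
    by rewrite (hlf d).1 E uE.
  by rewrite uE (s_concatR hM hs).
pose ds := undup [seq deco u | u <- l].
exists (\sum_(d <- ds) P (lf d)).
  split.
    rewrite cmul_suml; apply: eq_big_seq => d dd; rewrite cmul_sumr.
    rewrite (bigD1_seq d) ?undup_uniq //= lfP eqxx big1 ?addr0 // => d' dd'.
    by rewrite lfP eq_sym (negPf dd').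
  by rewrite cstar_sum; apply: eq_bigr => d _; rewrite (AD_star hs).
move=> u ul; rewrite cmul_suml (bigD1_seq (deco u)) ?undup_uniq //=; last first.
  by rewrite mem_undup; apply: map_f.
rewrite lfu eqxx big1 ?addr0 // => d dd.
by rewrite lfu (negPf dd).
Qed.

Lemma eval_unit L : well_formed L -> exists2 e, projection e & e ** eval s L = eval s L.
Proof.
move=> hL; have [e eP he] := local_unit [seq t.2.1 | t <- L].
exists e => //; rewrite /eval cmul_sumr; apply: eq_big_seq => t tL.
rewrite cmulZr -(s_mulPl hs (hL _ tL)) cmulA he //.
by apply/mapP; exists t.
Qed.

Variables (N : nat) (N0 : (0 < N)%N) (q : R[i]) (qP : N.-primitive_root q).

(** Multiplying s_{u,v} by a character of its degree preserves
    the relations, so universality provides the gauge automorphisms. *)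
Lemma gauge_relations (z : {ffun 'I_r -> 'I_N}) : AD_relations (fun u v =>
  (chi q z (dshape u) * (chi q z (dshape v))^*) *: s u v : B).
Proof.
have c1 m : chi q z m * (chi q z m)^* = 1 by exact: chi_conj.
have c2 m : (chi q z m)^* * chi q z m = 1 by rewrite mulrC.
split.
- move=> u v uv; rewrite cstarZ rmorphM /= conjCK.
  rewrite !(cmulZl, cmulZr) !scalerA (AD_pisom hs) //; congr (_ *: _).
  set a := chi q z _; set b := chi q z _.
  transitivity (a * (b^* * b) * (a^* * a) * b^*); first by ring.
  by rewrite !c2 !mulr1.
- by move=> u v uv; rewrite cstarZ rmorphM /= conjCK (AD_star hs) // mulrC.
- move=> u v w uv vw; rewrite cmulZl cmulZr scalerA (AD_mul hs) //; congr (_ *: _).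
  set a := chi q z _; set b := chi q z _; set c := chi q z _.
  transitivity (a * (b^* * b) * c^*); first by ring.
  by rewrite c2 mulr1.
- move=> u v uv j; rewrite (AD_sum hs uv j) scaler_sumr; apply: eq_bigr => w /eqP ow.
  have uw : dtrm u = org (mkwords w) by [].
  have vw : dtrm v = org (mkwords w) by rewrite -uv.
  rewrite !(dconcat_shape hM) // !chiD rmorphM mulrACA c1 mulr1 //.
- by move=> u v u0 v0 uv; rewrite cmulZl cmulZr (AD_orth hs) // !scaler0.
Qed.

End algebra.
End formal.

Lemma boxv_inj (r n : nat) : injective (@boxv r n).
Proof.
by move=> a b /ffunP h; apply/ffunP => i; apply/val_inj; have := h i; rewrite !ffunE.
Qed.

Lemma bernoulli (R : realType) (x : R) k : 0 <= x <= 1 -> 1 - k%:R * x <= (1 - x) ^+ k.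
Proof.
move=> /andP[x0 x1]; elim: k => [|k IH]; first by rewrite mul0r subr0 expr0.
have h : 0 <= 1 - x by rewrite subr_ge0.
rewrite exprS; apply: le_trans (ler_wpM2l h IH).
rewrite mulrSr; have := mulr_ge0 (mulr_ge0 (ler0n R k) x0) x0; lra.
Qed.

Section fejer.
Variables (R : realType) (r : nat) (A : finType) (M : 'I_r -> A -> A -> int).
Variables (hM : admissible M) (D : countType) (delta : D -> A).
Local Notation dw := (dword M delta).
Local Notation term := (R[i] * (dw * dw))%type.
Implicit Types (u v x : dw) (m n : nat) (L : seq term).

(** The coefficient of degree shape(v) - shape(u) in the Fejer kernel of
    the box [0, n)^r, up to the factor n^r. *)
Definition npairs n u v : nat := #|[pred ab : {ffun 'I_r -> 'I_n} * {ffun 'I_r -> 'I_n} |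
   dshape u + boxv ab.1 == dshape v + boxv ab.2]|.

Lemma npairs_le n u v : (npairs n u v <= n ^ r)%N.
Proof.
have -> : (n ^ r)%N = #|{ffun 'I_r -> 'I_n}| by rewrite card_ffun !card_ord.
rewrite /npairs -(fintype.card_in_image (f := fst)) ?max_card //.
move=> [a b] [a' b']; rewrite !inE /= => /eqP h /eqP h' E; rewrite -E in h' *.
by congr pair; apply/boxv_inj/(addvI (a := dshape v)); rewrite -h -h'.
Qed.

(** The pairs (c + k, c + l) with c in [0, n - B)^r, where k and l are
    the positive and negative parts of shape(v) - shape(u). *)
Lemma npairs_ge n B u v : (forall i, dshape u i <= B)%N -> (forall i, dshape v i <= B)%N ->
  ((n - B) ^ r <= npairs n u v)%N.
Proof.
move=> uB vB; have -> : ((n - B) ^ r)%N = #|{ffun 'I_r -> 'I_(n - B)}|.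
  by rewrite card_ffun !card_ord.
have hk k i (c : {ffun 'I_r -> 'I_(n - B)}) : (k <= B -> k + c i < n)%N.
  by move=> kB; have := ltn_ord (c i); lia.
have hu i : (dshape u i - dshape v i <= B)%N by apply: leq_trans (leq_subr _ _) _.
have hv i : (dshape v i - dshape u i <= B)%N by apply: leq_trans (leq_subr _ _) _.
pose f (c : {ffun 'I_r -> 'I_(n - B)}) :=
  ([ffun i => Ordinal (hk _ i c (hv i))], [ffun i => Ordinal (hk _ i c (hu i))]).
have finj : injective f.
  move=> c c' [/ffunP E _]; apply/ffunP => i; have := E i; rewrite !ffunE => /(congr1 val) /=.
  by move/addnI/val_inj.
rewrite -(fintype.card_image finj).
apply/subset_leq_card/fintype.subsetP => _ /fintype.imageP[c _ ->]; rewrite inE /=.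
by apply/eqP/ffunP => i; rewrite !addvE !ffunE /=; lia.
Qed.

Lemma shape_bound L : exists b, forall t, t \in L -> forall i,
  (dshape t.2.1 i <= b /\ dshape t.2.2 i <= b)%N.
Proof.
exists (\sum_(t <- L) \sum_i (dshape t.2.1 i + dshape t.2.2 i))%N => t tL i.
suff h : (dshape t.2.1 i + dshape t.2.2 i <=
    \sum_(t <- L) \sum_i (dshape t.2.1 i + dshape t.2.2 i))%N.
  by split; apply: leq_trans h; rewrite ?leq_addr ?leq_addl.
apply: (@leq_trans (\sum_i (dshape t.2.1 i + dshape t.2.2 i))%N).
  by rewrite (bigD1 i) //= leq_addr.
by rewrite [leqRHS](big_rem t) //= leq_addr.
Qed.

Section norms.
Variables (B : cstarAlgType R) (s : dw -> dw -> B).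

Definition fejer n L : B := (((n ^ r)%:R : R)^-1)%:C *:
  \sum_(a : {ffun 'I_r -> 'I_n}) \sum_(b : {ffun 'I_r -> 'I_n})
    eval s (component (boxv a) (boxv b) L).

Lemma fejerE n L : fejer n L =
  \sum_(t <- L) ((npairs n t.2.1 t.2.2)%:R / (n ^ r)%:R : R)%:C *: (t.1 *: s t.2.1 t.2.2).
Proof.
rewrite /fejer /eval /component pair_big /=.
under eq_bigr => ab _ do rewrite big_filter big_mkcond /=.
rewrite exchange_big /= scaler_sumr; apply: eq_bigr => t _.
rewrite -big_mkcond /= sumr_const -[_ *: s _ _ *+ _]scaler_nat [LHS]scalerA; congr (_ *: _).
rewrite rmorphM /= [RHS]mulrC rmorph_nat; congr (_ * _).
Qed.

Lemma fejer_cvg L (e : R) : 0 < e -> exists2 n, (0 < n)%N & nrm (fejer n L - eval s L) <= e.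
Proof.
move=> e0; pose K := \sum_(t <- L) nrm (t.1 *: s t.2.1 t.2.2).
have [b hb] := shape_bound L.
have K0 : 0 <= K by apply: sumr_ge0 => t _; exact: nrm_ge0.
have h0 : 0 < e / (K * (r * b)%:R + 1).
  by rewrite divr_gt0 // ltr_wpDl // mulr_ge0.
have [N hN] := small_inv h0.
have h1 : (0 : R) < K * (r * b)%:R + 1 by rewrite ltr_wpDl // mulr_ge0.
(* n > b makes the ratio b / n at most 1, and N makes the error at most e *)
pose n := (N + b).+1; have n0 : (0 : R) < n%:R by rewrite ltr0n.
exists n => //.
rewrite fejerE /eval -sumrB.
apply: le_trans (nrm_sum _ _ _) _.
apply: (@le_trans _ _ (\sum_(t <- L) ((r * b)%:R / n%:R) * nrm (t.1 *: s t.2.1 t.2.2))); last first.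
  rewrite -mulr_sumr -/K; have := hN (N + b)%N (leq_addr _ _); rewrite -/n.
  rewrite ltr_pdivlMr // => h.
  rewrite mulrAC ler_pdivrMr //.
  move: h; rewrite mulrC ltr_pdivrMr // => h; lra.
rewrite big_seq [leRHS]big_seq; apply: ler_sum => t tL.
rewrite -[X in _ - X]scale1r -scalerBl nrmZ ler_wpM2r ?nrm_ge0 //.
rewrite -(rmorph1 (real_complex R)) -rmorphB cabsR.
have nr0 : (0 : R) < (n ^ r)%:R by rewrite ltr0n expn_gt0.
have b1 : (npairs n t.2.1 t.2.2)%:R / (n ^ r)%:R <= (1 : R).
  by rewrite ler_pdivrMr // mul1r ler_nat npairs_le.
have b2 : 1 - (r * b)%:R / n%:R <= (npairs n t.2.1 t.2.2)%:R / (n ^ r)%:R :> R.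
  apply: (@le_trans _ _ ((1 - b%:R / n%:R) ^+ r)).
    rewrite natrM -mulrA; apply: bernoulli.
    by rewrite divr_ge0 //= ler_pdivrMr // mul1r ler_nat /n; lia.
  have bn : (b <= n)%N by rewrite /n; lia.
  rewrite ler_pdivlMr // natrX -exprMn mulrBl mul1r divfK ?gt_eqF // -natrB // -natrX ler_nat.
  by apply: npairs_ge => i; case: (hb t tL i).
rewrite ler_norml; apply/andP; split; lra.
Qed.

End norms.

Section gauge.
Variables (B : cstarAlgType R) (s : dw -> dw -> B) (hAD : is_AD s).

(** The Fejer mean is the average of the images of [eval s L] under the
    gauge automorphisms of the N-th roots of unity, weighted by the squared
    modulus of the sum of characters over the box, divided by n^r.  The weights
    are nonnegative with mean 1, and the automorphisms are contractive. *)
Lemma fejer_le n L : (0 < n)%N -> well_formed L -> nrm (fejer s n L) <= nrm (eval s L).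
Proof.
move=> n0 hL; have hs := AD_rel hAD.
have [b hb] := shape_bound L.
(* N exceeds every exponent below, so congruence modulo N is equality *)
pose N := (n + b)%N; have N0 : (0 < N)%N by rewrite /N; lia.
have [q qP] := prim_root_exists R[i] N0.
pose Z := {ffun 'I_r -> 'I_N}; pose Bx := {ffun 'I_r -> 'I_n}.
have aN (a : Bx) i : (boxv a i < N)%N.
  by rewrite ffunE; have := ltn_ord (a i); rewrite /N; lia.
have [ph hph] : exists ph : Z -> B -> B, forall z, star_hom (ph z) /\
    forall u v, dtrm u = dtrm v -> ph z (s u v) = (chi q z (dshape u) * (chi q z (dshape v))^*) *: s u v.
  have h (z : Z) : exists p : B -> B, star_hom p /\
    forall u v, dtrm u = dtrm v -> p (s u v) = (chi q z (dshape u) * (chi q z (dshape v))^*) *: s u v.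
    have [p h1 h2] := AD_univ hAD (gauge_relations hM hs N0 qP z).
    by exists p.
  by have /choice[p hp] := h; exists p.
pose W (z : Z) := \sum_(a : Bx) chi q z (boxv a).
pose k (z : Z) : R := cabs (W z) ^+ 2.
have kE z : (k z)%:C = \sum_(a : Bx) \sum_(c : Bx) chi q z (boxv a) * (chi q z (boxv c))^*.
  rewrite /k rmorphXn /= -cabsE normCK /W rmorph_sum big_distrl /=.
  by apply: eq_bigr => a _; rewrite big_distrr.
have k0 z : 0 <= k z by exact: sqr_ge0.
have sumk : \sum_z k z = (N ^ r)%:R * (n ^ r)%:R.
  apply: (@complexI R); rewrite rmorph_sum rmorphM /= !rmorph_nat.
  under eq_bigr do rewrite kE.
  rewrite exchange_big /=.
  rewrite (eq_bigr (fun=> (N ^ r)%:R)) => [|a _].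
    by rewrite sumr_const card_ffun !card_ord -[LHS]mulr_natr.
  rewrite exchange_big /= (bigD1 a) //= (sum_chi N0 qP) // eqxx big1 ?addr0 // => c ca.
  rewrite (sum_chi N0 qP) //; case: eqP => // /boxv_inj E; by rewrite E eqxx in ca.
have Nr0 : (0 : R) < (N ^ r)%:R by rewrite ltr0n expn_gt0 N0.
have nr0 : (0 : R) < (n ^ r)%:R by rewrite ltr0n expn_gt0 n0.
have key : (N ^ r)%:R *: (\sum_(a : Bx) \sum_(c : Bx) eval s (component (boxv a) (boxv c) L)) =
    \sum_(z : Z) (k z)%:C *: ph z (eval s L).
  have -> : \sum_(z : Z) (k z)%:C *: ph z (eval s L) = \sum_(z : Z) \sum_(a : Bx) \sum_(c : Bx) \sum_(t <- L)
     (chi q z (dshape t.2.1 + boxv a) * (chi q z (dshape t.2.2 + boxv c))^*) *: (t.1 *: s t.2.1 t.2.2).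
    apply: eq_bigr => z _; rewrite kE scaler_suml; apply: eq_bigr => a _.
    rewrite scaler_suml; apply: eq_bigr => c _.
    rewrite /eval (star_hom_sum (hph z).1) scaler_sumr; apply: eq_big_seq => t /hL tt.
    rewrite (star_homZ (hph z).1) (hph z).2 // !scalerA !chiD rmorphM; congr (_ *: _); ring.
  rewrite [RHS]exchange_big scaler_sumr; apply: eq_bigr => a _.
  rewrite [RHS]exchange_big scaler_sumr; apply: eq_bigr => c _.
  rewrite [RHS]exchange_big /eval /component big_filter big_mkcond scaler_sumr.
  apply: eq_big_seq => t tL; rewrite -scaler_suml (sum_chi N0 qP).
  - by case: ifP => _; rewrite ?scale0r ?scaler0.
  - move=> i; rewrite addvE ffunE; have [h _] := hb t tL i.
    by rewrite addnC -addSn leq_add.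
  - move=> i; rewrite addvE ffunE; have [_ h] := hb t tL i.
    by rewrite addnC -addSn leq_add.
have [e eP he] := eval_unit hM hs hL.
have phn z : nrm (ph z (eval s L)) <= nrm (eval s L).
  exact: (star_hom_contractive (hph z).1 eP he).
rewrite /fejer nrmZ cabsR ger0_norm ?invr_ge0 ?(ltW nr0) // mulrC ler_pdivrMr //.
rewrite -(ler_pM2l Nr0).
set X := \sum_(a : Bx) _; have -> : (N ^ r)%:R * nrm X = nrm ((N ^ r)%:R *: X).
  by rewrite nrmZ -(rmorph_nat (real_complex R)) cabsR ger0_norm // ltW.
rewrite key; have -> : (N ^ r)%:R * (nrm (eval s L) * (n ^ r)%:R) =
    (\sum_z k z) * nrm (eval s L) by rewrite sumk; ring.
rewrite mulr_suml.
apply: le_trans (nrm_sum _ _ _) _; apply: ler_sum => z _.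
by rewrite nrmZ cabsR ger0_norm // ler_wpM2l.
Qed.

(** Fix one approximation L1 of y and n such that the n-th Fejer
    mean of L1 is close to y.  By contractivity the n-th Fejer mean of any other
    good approximation is close to y too.  It is a sum of n^{2r} components
    divided by n^r, so one of them has norm at least a constant that
    depends on y and n only. *)
Lemma large_component (y : B) : y != 0 -> exists c d : R, [/\ 0 < c, 0 < d &
  forall L, well_formed L -> nrm (y - eval s L) < d -> exists a b, c <= nrm (eval s (component a b L))].
Proof.
move=> y0; have hs := AD_rel hAD; rewrite -nrm_gt0 in y0; set e := nrm y in y0.
have dens : approx (span s) y.
  have -> : approx (span s) = [set: B]; last by [].
  apply: (AD_gen hAD) => [|u v uv]; first exact: approx_span_subalgebra.
  exact/approx_sub/span_gen.
have e8 : 0 < e / 8 by rewrite divr_gt0.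
have [_ [L1 hL1 ->] h1] := dens _ e8.
have [n n0 hn] := fejer_cvg s L1 e8.
have nr0 : (0 : R) < (n ^ r)%:R by rewrite ltr0n expn_gt0 n0.
exists (e / 8 / (n ^ r)%:R), (e / 8); split=> //; first by rewrite divr_gt0.
move=> L hL hd.
(* formal difference of L and L1 *)
pose K := L ++ [seq ((-1) * t.1, t.2) | t <- L1].
have hK : well_formed K.
  by move=> t; rewrite mem_cat => /orP[/hL|/mapP[t' /hL1 h ->]].
have evK : eval s K = eval s L - eval s L1.
  rewrite /K /eval big_cat; congr (_ + _).
  by rewrite big_map -sumrN; apply: eq_bigr => t _; rewrite mulN1r scaleNr.
have fK : fejer s n K = fejer s n L - fejer s n L1.
  rewrite !fejerE /K big_cat; congr (_ + _).
  by rewrite big_map -sumrN; apply: eq_bigr => t _; rewrite mulN1r scaleNr scalerN.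
have f1 : nrm (fejer s n L - fejer s n L1) <= e / 4.
  rewrite -fK; apply: le_trans (fejer_le n0 hK) _; rewrite evK.
  have := nrm_dist_tri y (eval s L) (eval s L1); rewrite (nrm_distC _ y); lra.
have f2 : e / 2 <= nrm (fejer s n L).
  have a1 := nrm_dist_tri (eval s L1) y 0; rewrite !subr0 in a1.
  have a2 := nrm_dist_tri (fejer s n L1) (eval s L1) 0; rewrite !subr0 (nrm_distC (eval s L1)) in a2.
  have a3 := nrm_dist_tri (fejer s n L) (fejer s n L1) 0.
  rewrite !subr0 (nrm_distC (fejer s n L1)) in a3; rewrite /e in h1 hn hd f1 *; lra.
apply: contrapT => hc.
have hc' a b : nrm (eval s (component a b L)) <= e / 8 / (n ^ r)%:R.
  by rewrite leNgt; apply/negP => h; apply: hc; exists a, b; exact: ltW.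
suff : nrm (fejer s n L) <= e / 8 by lra.
rewrite /fejer nrmZ cabsR ger0_norm ?invr_ge0 ?(ltW nr0) // mulrC ler_pdivrMr //.
apply: le_trans (nrm_sum _ _ _) _.
apply: (@le_trans _ _ (\sum_(a : {ffun 'I_r -> 'I_n}) (e / 8))).
  apply: ler_sum => a _; apply: le_trans (nrm_sum _ _ _) _.
  apply: (@le_trans _ _ (\sum_(b : {ffun 'I_r -> 'I_n}) (e / 8 / (n ^ r)%:R))).
    by apply: ler_sum => b _; exact: hc'.
  by rewrite sumr_const card_ffun !card_ord -[leLHS]mulr_natr divfK // gt_eqF.
by rewrite sumr_const card_ffun !card_ord -[leLHS]mulr_natr.
Qed.

End gauge.
End fejer.

(** * Closed ideals *)

(** The powers of p - y are congruent to p modulo I and tend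
    to zero. *)
Lemma idempotent_in_ideal (R : realType) (B : cstarAlgType R) (I : set B) (p y : B) :
  closed_ideal I -> p ** p = p -> I y -> nrm (p - y) < 1 -> I p.
Proof.
move=> [I0 IL Il Ir cI] pp Iy h1; apply: closed_approxE cI _ => e e0.
have q0 := nrm_ge0 (p - y).
have [N hN] := expr_small q0 h1 e0.
have hp n : exists2 x, I x & nrm (p - x) <= nrm (p - y) ^+ n.+1.
  elim: n => [|n [x Ix hx]]; first by exists y.
  exists (p ** y + x ** (p - y)).
    have -> : p ** y + x ** (p - y) = 1 *: (p ** y) + x ** (p - y) by rewrite scale1r.
    by apply: IL; [exact: Il|exact: Ir].
  have -> : p - (p ** y + x ** (p - y)) = (p - x) ** (p - y).
    by rewrite cmulBl [p ** (p - y)]cmulBr pp opprD addrA.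
  by apply: le_trans (nrmM _ _) _; rewrite [leRHS]exprSr ler_wpM2r.
have [x Ix hx] := hp N; exists x => //; apply: le_lt_trans hx _.
by apply: hN.
Qed.

Section simplicity.
Variables (R : realType) (r : nat) (A : finType) (M : 'I_r -> A -> A -> int).
Variables (hM : admissible M) (D : countType) (delta : D -> A).
Local Notation dw := (dword M delta).
Local Notation term := (R[i] * (dw * dw))%type.
Implicit Types (u v : dw) (w : words M) (m : natvec r) (L : seq term).
Variables (B : cstarAlgType R) (s : dw -> dw -> B) (hAD : is_AD s).
Let hs := AD_rel hAD.
Local Notation P u := (s u u).

Definition span_between (U V : dw -> Prop) : set B := [set x | exists L,
  [/\ well_formed L, forall t, t \in L -> U t.2.1 /\ V t.2.2 & x = eval s L]].

Lemma span_between_gen (U V : dw -> Prop) u v : U u -> V v -> dtrm u = dtrm v -> span_between U V (s u v).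
Proof.
move=> Uu Vv uv; exists [:: (1, (u, v))]; split; last by rewrite /eval big_seq1 scale1r.
  by move=> t; rewrite inE => /eqP ->.
by move=> t; rewrite inE => /eqP ->.
Qed.

Lemma span_between0 U V : span_between U V 0.
Proof. by exists [::]; split=> //; rewrite /eval big_nil. Qed.

Lemma span_betweenD U V x y : span_between U V x -> span_between U V y -> span_between U V (x + y).
Proof.
move=> [L [h1 h2 ->]] [K [k1 k2 ->]]; exists (L ++ K); split; last by rewrite /eval big_cat.
  by move=> t; rewrite mem_cat => /orP[/h1|/k1].
by move=> t; rewrite mem_cat => /orP[/h2|/k2].
Qed.

Lemma span_betweenZ U V (c : R[i]) x : span_between U V x -> span_between U V (c *: x).
Proof.
move=> [L [h1 h2 ->]]; exists [seq (c * t.1, t.2) | t <- L]; split.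
- by move=> t /mapP[t' /h1 h ->].
- by move=> t /mapP[t' /h2 h ->].
- by rewrite /eval big_map scaler_sumr; apply: eq_bigr => t _; rewrite scalerA.
Qed.

Lemma span_between_sum U V (I : eqType) (l : seq I) (F : I -> B) :
  (forall i, i \in l -> span_between U V (F i)) -> span_between U V (\sum_(i <- l) F i).
Proof.
move=> h; rewrite big_seq; elim/big_ind: _ => //; [exact: span_between0|exact: span_betweenD].
Qed.

Lemma span_between_star U V x : span_between U V x -> span_between V U (cstar x).
Proof.
move=> [L [h1 h2 ->]]; rewrite /eval cstar_sum; apply: span_between_sum => t tL.
have [Ut Vt] := h2 _ tL; have tt := h1 _ tL.
by rewrite cstarZ (AD_star hs) //; apply/span_betweenZ/span_between_gen.
Qed.

Lemma span_betweenM (U V V' W : dw -> Prop) x y :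
  (forall v v', V v -> V' v' -> dshape v = dshape v') ->
  span_between U V x -> span_between V' W y -> span_between U W (x ** y).
Proof.
move=> hV [L [h1 h2 ->]] [K [k1 k2 ->]]; rewrite /eval cmul_suml.
apply: span_between_sum => t tL; rewrite cmul_sumr; apply: span_between_sum => t' tK.
have [Ut Vt] := h2 _ tL; have [Vt' Wt'] := k2 _ tK.
rewrite cmulZl cmulZr; do 2 apply: span_betweenZ.
rewrite (s_mulE hM hs) ?(h1 _ tL) ?(k1 _ tK) //; last exact: hV.
case: eqP => [E|_]; last exact: span_between0.
by apply: span_between_gen => //; rewrite (h1 _ tL) E (k1 _ tK).
Qed.

(** The corner P_v A P_v meets the matrix units in
    multiples of P_v. *)
Lemma span_between_scalar v x : span_between (eq v) (eq v) x -> exists c : R[i], x = c *: P v.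
Proof.
move=> [L [_ h ->]]; exists (\sum_(t <- L) t.1).
rewrite scaler_suml; apply: eq_big_seq => t /h[<- <-] //.
Qed.

Section corner_vectors.
Variables (F : seq dw) (k0 : natvec r) (hF : forall v, v \in F -> dshape v = k0).
Variables (H : B) (Hs : cstar H = H) (HF : span_between (fun v => v \in F) (fun v => v \in F) H).

(** H^k P_v, the k-th power of H applied to a basis vector of the
    finite dimensional algebra. *)
Definition power_vec k v : B := iter k (cmul H) (P v).

Lemma power_vec_span k v : v \in F -> span_between (fun v => v \in F) (eq v) (power_vec k v).
Proof.
move=> vF; elim: k => [|k IH] /=; first by apply: span_between_gen.
by apply: span_betweenM HF IH => u u' uF u'F; rewrite !hF.
Qed.

Lemma sum_power_vec x : span_between (fun v => v \in F) (fun v => v \in F) x ->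
  x = \sum_(v <- undup F) x ** P v.
Proof.
move=> [L [h1 h2 ->]]; rewrite /eval.
rewrite [RHS](eq_bigr (fun v => \sum_(t <- L) (t.1 *: s t.2.1 t.2.2) ** P v)); last first.
  by move=> v _; rewrite cmul_suml.
rewrite [RHS]exchange_big /=; apply: eq_big_seq => t tL.
have [_ tF] := h2 _ tL; have tt := h1 _ tL.
rewrite (bigD1_seq t.2.2) ?mem_undup ?undup_uniq //= cmulZl (s_mulPr hs tt) big_seq_cond big1 ?addr0 //.
move=> v /andP[vF vt]; rewrite mem_undup in vF.
rewrite cmulZl (s_mulE hM hs) // ?hF //.
by rewrite eq_sym (negPf vt) scaler0.
Qed.

(** H^(2^j): for a self-adjoint H the C*-identity gives
    |H^n| = |H|^n at once for n a power of 2. *)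
Fixpoint dyadic_power j : B := if j is j'.+1 then dyadic_power j' ** dyadic_power j' else H.

Lemma dyadic_power_star j : cstar (dyadic_power j) = dyadic_power j.
Proof. by elim: j => [|j IH] //=; rewrite cstarM IH. Qed.

Lemma nrm_dyadic_power j : nrm (dyadic_power j) = nrm H ^+ (2 ^ j).
Proof.
elim: j => [|j IH]; first by rewrite expr1.
by rewrite /= nrm_sq ?dyadic_power_star // IH -exprM expnSr.
Qed.

Lemma dyadic_power_span j : span_between (fun v => v \in F) (fun v => v \in F) (dyadic_power j).
Proof.
elim: j => [|j IH] //=; apply: (span_betweenM _ IH IH) => v v' vF v'F; by rewrite !hF.
Qed.

Lemma dyadic_power_iter j x : dyadic_power j ** x = iter (2 ^ j) (cmul H) x.
Proof.
elim: j x => [|j IH] x //=.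
by rewrite -cmulA !IH -iterD expnS mul2n addnn.
Qed.

(** Otherwise |H^k P_v| <= (|H| / 2)^k for all v and k, and
    |H|^n = |H^n| <= (size F) (|H| / 2)^n for n a large power of 2.  This
    replaces the eigenvector of a norming eigenvalue. *)
Lemma growing_power_vec : 0 < nrm H -> exists v k,
  v \in F /\ nrm H / 2 * nrm (power_vec k v) < nrm (power_vec k.+1 v).
Proof.
move=> H0; apply: contrapT => hc.
have hv v k : v \in F -> nrm (power_vec k.+1 v) <= nrm H / 2 * nrm (power_vec k v).
  by move=> vF; rewrite leNgt; apply/negP => h; apply: hc; exists v, k.
have hv' v k : v \in F -> nrm (power_vec k v) <= (nrm H / 2) ^+ k.
  move=> vF; elim: k => [|k IH]; first exact/nrm_projection/(projP hs).
  by apply: le_trans (hv _ _ vF) _; rewrite exprS ler_wpM2l // divr_ge0 // ltW.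
(* 2 ^ (2 ^ j) > j already contradicts the estimate *)
pose j := size (undup F); pose n := (2 ^ j)%N.
have : nrm (dyadic_power j) <= \sum_(v <- undup F) (nrm H / 2) ^+ n.
  rewrite {1}(sum_power_vec (dyadic_power_span j)); apply: le_trans (nrm_sum _ _ _) _.
  rewrite big_seq [leRHS]big_seq; apply: ler_sum => v; rewrite mem_undup => vF.
  by rewrite dyadic_power_iter; exact: hv'.
rewrite nrm_dyadic_power big_const_seq count_predT iter_addr_0 -/n -/j -[leRHS]mulr_natr expr_div_n.
have Hn : 0 < nrm H ^+ n by exact: exprn_gt0.
have t0 : (0 : R) < 2 ^+ n by exact: exprn_gt0.
rewrite -mulrA -[leLHS]mulr1 ler_pM2l // mulrC ler_pdivlMr // mul1r -natrX ler_nat.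
by rewrite leqNgt => /negP; apply; apply: (ltn_trans (ltn_expl j (ltnSn 1))); apply: ltn_expl.
Qed.

End corner_vectors.

(** Rewrites a formal combination so that all first indices that are
    below m get the shape m. *)
Definition expand (m : natvec r) L : seq term := flatten
  [seq [seq (t.1, (dconcat t.2.1 w, dconcat t.2.2 w)) |
    w <- wseq M (subv m (dshape t.2.1)) (dtrm t.2.1)] | t <- L].

Lemma mem_expand m L t : well_formed L -> t \in expand m L -> exists2 t', t' \in L &
  exists w, [/\ tag w = subv m (dshape t'.2.1), dtrm t'.2.1 = org w, dtrm t'.2.2 = org w &
    t = (t'.1, (dconcat t'.2.1 w, dconcat t'.2.2 w))].
Proof.
move=> hL /flatten_mapP[t' t'L /mapP[w /mem_wseq[tw ow] ->]].
by exists t' => //; exists w; rewrite -hL.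
Qed.

Lemma well_formed_expand m L : well_formed L -> well_formed (expand m L).
Proof.
move=> hL t /mem_expand[]// t' _ [w [_ h1 h2 ->]] /=.
by rewrite !dconcat_trm.
Qed.

Lemma expand_shape m L t : well_formed L -> (forall t, t \in L -> lev (dshape t.2.1) m) ->
  t \in expand m L -> dshape t.2.1 = m.
Proof.
move=> hL hm /mem_expand[]// t' t'L [w [tw h1 h2 ->]] /=.
by rewrite dconcat_shape // tw addrC subvK //; exact: hm.
Qed.

Lemma eval_expand m L : well_formed L -> eval s (expand m L) = eval s L.
Proof.
move=> hL; rewrite /eval big_flatten big_map; apply: eq_big_seq => t /hL tt.
by rewrite big_map /= -scaler_sumr -(s_expand hM hs).
Qed.

Lemma component_expand m a b L : well_formed L -> component a b (expand m L) = expand m (component a b L).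
Proof.
elim: L => [|t L IH] // hL.
have {}IH : component a b (expand m L) = expand m (component a b L).
  by apply: IH => t' t'L; apply: hL; rewrite in_cons t'L orbT.
have tt := hL t (mem_head _ _).
pose l : seq term := [seq (t.1, (dconcat t.2.1 w, dconcat t.2.2 w)) |
  w <- wseq M (subv m (dshape t.2.1)) (dtrm t.2.1)].
have hl : {in l, forall t', (dshape t'.2.1 + a == dshape t'.2.2 + b) =
    (dshape t.2.1 + a == dshape t.2.2 + b)}.
  move=> t' /mapP[w /mem_wseq[tw ow] ->] /=.
  rewrite !dconcat_shape -?tt // ![_ + tag w + _]addrAC ![_ + tag w]addrC.
  by apply/eqP/eqP => [/addvI//|->].
transitivity (component a b l ++ component a b (expand m L)); first exact: filter_cat.
rewrite IH [X in X ++ _](eq_in_filter hl) [in RHS]/component /= -/(component a b L).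
by case: ifP => _; rewrite ?filter_predT ?filter_pred0.
Qed.

(** The product is s_{vw,v2 w} s_{v1 w,vw}.  At a point j,
    k = j - p of failure of periodicity, v1 w and v2 w take the values w(j) and
    w(k) at the same place j + shape(v1) = k + shape(v2), so their projections
    are orthogonal. *)
Lemma aperiodic_compression v v1 v2 w : dtrm v = org w -> dtrm v1 = dtrm v -> dtrm v2 = dtrm v ->
  aperiodic [ffun i => (dshape v2 i)%:Z - (dshape v1 i)%:Z] w ->
  P (dconcat v w) ** (s v v2 ** s v1 v) ** P (dconcat v w) = 0.
Proof.
move=> vw v1v v2v [j [k [jw kw jk h]]].
have v1w : dtrm v1 = org w by rewrite v1v.
have v2w : dtrm v2 = org w by rewrite v2v.
rewrite cmulA -cmulA (s_concatL hM hs) // (s_concatR hM hs) //.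
rewrite -[s _ (dconcat v2 w)](s_mulPr hs); last by rewrite !dconcat_trm.
rewrite -[s (dconcat v1 w) _](s_mulPl hs); last by rewrite !dconcat_trm.
rewrite -cmulA [s (dconcat v2 w) _ ** _]cmulA (P_disagree hM hs) ?cmul0l ?cmul0r //; right.
have E : j + dshape v1 = k + dshape v2.
  by apply/ffunP => i; rewrite !addvE; have := jk i; rewrite ffunE; lia.
exists (j + dshape v1); split.
- by rewrite E dconcat_shape // addrC; apply: lev_add.
- by rewrite dconcat_shape // addrC; apply: lev_add.
- by rewrite {1}E !dvalR // => /esym.
Qed.

(** With T the large component, x = H^k P_v and
    x' = H x for H = star(T) T, the compression z -> star(x') star(T) z x maps T
    to star(x') x' = l P_v with |l| >= |x'|^2, while its norm is at most
    |x'| |T| |x| and |x'| > |T|^2 |x| / 2.  So an error of norm at most |T| / 8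
    in z is less than |l| after compression. *)
Lemma ideal_contains_projection (I : set B) y : closed_ideal I -> I y -> y != 0 ->
  exists u, I (P u).
Proof.
move=> hI Iy y0; have [c [d [c0 d0 hcd]]] := large_component hM hAD y0.
(* closer than d for the large component, and than c / 8 for the final estimate *)
pose e := Num.min d (c / 8).
have e0 : 0 < e by rewrite lt_min d0 divr_gt0.
have ed : e <= d by rewrite ge_min lexx.
have ec : e <= c / 8 by rewrite ge_min lexx orbT.
have dens : approx (span s) y.
  have -> : approx (span s) = [set: B]; last by [].
  apply: (AD_gen hAD) => [|u v uv]; first exact: approx_span_subalgebra.
  exact/approx_sub/span_gen.
have [_ [L0 hL0 ->] hy0] := dens _ e0.
have [a [b hab]] := hcd L0 hL0 (lt_le_trans hy0 ed).
have [bd hbd] := shape_bound L0.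
pose m : natvec r := [ffun=> bd].
pose L := expand m L0.
have hL : well_formed L by exact: well_formed_expand.
have Lm t : t \in L -> dshape t.2.1 = m.
  by apply: expand_shape => // t' /hbd h i; rewrite ffunE; case: (h i).
rewrite -(eval_expand m hL0) -/L in hy0.
rewrite -(eval_expand m (well_formed_component hL0)) -component_expand // -/L in hab.
set T := eval s (component a b L) in hab.
pose L' := [seq t <- L | ~~ (dshape t.2.1 + a == dshape t.2.2 + b)].
have hL' : well_formed L' by move=> t; rewrite mem_filter => /andP[_ /hL].
have yE : eval s L = T + eval s L'.
  by rewrite /T /eval /component !big_filter (bigID (fun t : term => dshape t.2.1 + a == dshape t.2.2 + b)).
pose F := [seq t.2.2 | t <- component a b L].
(* the common shape of the second indices of the component *)
pose k0 := subv (m + a) b.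
have hF v : v \in F -> dshape v + b = m + a.
  by move=> /mapP[t]; rewrite mem_filter => /andP[/eqP h /Lm tm] ->; rewrite -h tm.
have hFk v : v \in F -> dshape v = k0.
  by move=> /hF h; apply/ffunP => i; rewrite subvE -h addvE addnK.
pose V v := v \in [seq t.2.2 | t <- L'].
have hV v : V v -> dshape v + b <> m + a.
  by move=> /mapP[t]; rewrite mem_filter => /andP[/eqP h /Lm tm] -> h'; apply: h; rewrite h' tm.
have Tsp : span_between (fun u => dshape u = m) (fun v => v \in F) T.
  exists (component a b L); split=> //; first exact: well_formed_component.
  by move=> t tL; split; [move: tL; rewrite mem_filter => /andP[_ /Lm]|exact: map_f].
have Ysp : span_between (fun u => dshape u = m) V (eval s L').
  exists L'; split=> // t tL; split; last exact: map_f.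
  by move: tL; rewrite mem_filter => /andP[_ /Lm].
pose H := cstar T ** T.
have Hs : cstar H = H by rewrite cstarM cstarK.
have same u u' : dshape u = m -> dshape u' = m -> dshape u = dshape u' by move=> -> ->.
have Hsp : span_between (fun v => v \in F) (fun v => v \in F) H by apply: span_betweenM same (span_between_star Tsp) Tsp.
have Zsp : span_between (fun v => v \in F) V (cstar T ** eval s L') by apply: span_betweenM same (span_between_star Tsp) Ysp.
have T0 : 0 < nrm T by apply: lt_le_trans hab.
have HT : nrm H = nrm T ^+ 2 by exact: nrm_starM.
have H0 : 0 < nrm H by rewrite HT exprn_gt0.
have [v [k [vF grow]]] := growing_power_vec hFk Hs Hsp H0.
set x' := power_vec H k.+1 v in grow; set x := power_vec H k v in grow.
have x'E : x' = H ** x by [].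
have xsp : span_between (fun v => v \in F) (eq v) x by by apply: (power_vec_span hFk Hsp).
have x'sp : span_between (fun v => v \in F) (eq v) x' by by apply: (power_vec_span hFk Hsp).
have sameF u u' : u \in F -> u' \in F -> dshape u = dshape u' by move=> /hFk -> /hFk ->.
have [l lE] := span_between_scalar (span_betweenM sameF (span_between_star x'sp) x'sp).
have x0 := nrm_ge0 x.
have x'0 : 0 < nrm x'.
  by apply: le_lt_trans grow; rewrite mulr_ge0 // divr_ge0 // ltW.
have l1 : nrm x' ^+ 2 <= cabs l.
  rewrite -nrm_starM lE nrmZ -[leRHS]mulr1 ler_wpM2l ?cabs_ge0 //.
  exact/nrm_projection/(projP hs).
have l0 : 0 < cabs l by apply: lt_le_trans l1; rewrite exprn_gt0.
(* the degrees of the off-diagonal terms that remain after compression by P_v *)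
pose ps := [seq ([ffun i => (dshape v2 i)%:Z - (dshape v i)%:Z] : intvec r) | v2 <- [seq t.2.2 | t <- L']].
have [|w [ow hw]] := @aperiodic_word _ _ _ hM (dtrm v) ps.
  move=> p /mapP[v2 /hV v2V ->]; apply/eqP => /ffunP h; apply: v2V.
  rewrite -(hF _ vF); congr (_ + _); apply/ffunP => i.
  by have := h i; rewrite !ffunE => /subr0_eq[].
have vw : dtrm v = org w by [].
exists (dconcat v w); set Q := P (dconcat v w).
have QP : projection Q by exact: projP.
have Q1 := nrm_projection QP.
pose U := cstar x' ** (cstar T ** eval s L').
have Usp : span_between (eq v) V U by apply: span_betweenM sameF (span_between_star x'sp) Zsp.
(* terms outside the component die by aperiodicity *)
have off : Q ** (U ** x) ** Q = 0.
  have [LU [wU hU ->]] := Usp; have [LX [wX hX ->]] := xsp.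
  rewrite /eval !(cmul_suml, cmul_sumr) big_seq big1 // => t tU.
  rewrite !(cmul_suml, cmul_sumr) big_seq big1 // => t' tX.
  rewrite !(cmulZl, cmulZr); have [vt Vt] := hU _ tU; have [Ft' vt'] := hX _ tX.
  rewrite -vt -vt' aperiodic_compression ?scaler0 //.
  - by rewrite wX // vt'.
  - by rewrite -wU // vt.
  - by rewrite (hFk _ Ft') -(hFk _ vF); apply: hw; apply/mapP; exists t.2.2.
pose Z z := Q ** (cstar x' ** cstar T ** z ** x) ** Q.
have ZB z z' : Z (z - z') = Z z - Z z'.
  by rewrite /Z !(cmulBl, cmulBr).
have Zy0 : Z (eval s L) = l *: Q.
  rewrite /Z yE cmulDr cmulDl cmulDr cmulDl.
  have -> : cstar x' ** cstar T ** eval s L' = U by rewrite /U cmulA.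
  rewrite off addr0 -[cstar x' ** cstar T ** T]cmulA -/H -[cstar x' ** H ** x]cmulA -x'E.
  rewrite lE cmulZr cmulZl.
  by congr (_ *: _); rewrite /Q (s_concatL hM hs) // (QP.1).
have Zn z : nrm (Z z) <= nrm x' * nrm T * nrm z * nrm x.
  have n0 (q : B) := nrm_ge0 q.
  rewrite /Z; apply: le_trans (nrmM _ _) _; rewrite -[leRHS]mulr1; apply: ler_pM => //.
  apply: le_trans (nrmM _ _) _; rewrite -[leRHS]mul1r; apply: ler_pM => //.
  apply: le_trans (nrmM _ _) _; apply: ler_pM => //.
  apply: le_trans (nrmM _ _) _; apply: ler_pM => //.
  by apply: le_trans (nrmM _ _) _; rewrite !nrm_star.
apply: (@idempotent_in_ideal _ _ _ Q (l^-1 *: Z y)) => //; first exact: QP.1.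
  have [J0 IL Il Ir _] := hI.
  by rewrite -[_ *: _]addr0; apply: IL => //; apply/Ir/Il/Ir/Il.
have lN0 : l != 0 by apply: contraTneq l0 => ->; rewrite /cabs normr0 ltxx.
have -> : Q - l^-1 *: Z y = l^-1 *: Z (eval s L - y).
  by rewrite ZB scalerBr Zy0 scalerA mulVf // scale1r.
have lV : cabs l^-1 = (cabs l)^-1.
  apply: (mulfI (lt0r_neq0 l0)); rewrite -cabsM !divff //; last exact: lt0r_neq0.
  by rewrite /cabs normr1.
rewrite nrmZ lV mulrC ltr_pdivrMr // mul1r.
apply: le_lt_trans (Zn _) _; apply: lt_le_trans l1.
rewrite nrm_distC expr2 -!mulrA ltr_pM2l //.
set en := nrm (y - _) in hy0 *.
have en0 : 0 <= en by exact: nrm_ge0.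
have g2 : nrm T * (nrm T * nrm x) < 2 * nrm x' by move: grow; rewrite HT expr2; lra.
have e8 : en * 8 <= nrm T by lra.
have : en * 8 * (nrm T * nrm x) <= nrm T * (nrm T * nrm x).
  by rewrite ler_wpM2r // mulr_ge0 // ltW.
lra.
Qed.

(** A closed ideal is not assumed self-adjoint, so generation
    is applied to the elements that lie in I together with their adjoint. *)
Theorem closed_ideal_trivial (I : set B) : closed_ideal I -> I = [set 0] \/ I = [set: B].
Proof.
move=> hI; have [h|h] := pselect (exists2 y, I y & y != 0); last first.
  left; apply/seteqP; split=> [y Iy|_ ->]; last by case: hI.
  by apply: contrapT => /eqP y0; apply: h; exists y.
have [y Iy y0] := h; have [u Iu] := ideal_contains_projection hI Iy y0.
have Is := ideal_contains_generators hM hs hI Iu.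
right; apply/seteqP; split=> // z _.
have : [set x | I x /\ I (cstar x)] = [set: B]; last by move=> /seteqP[_ /(_ z Logic.I)[]].
have [I0 IL Il Ir cI] := hI.
apply: (AD_gen hAD) => [|u' v uv]; last by split; rewrite ?(AD_star hs) //; apply: Is.
split.
- by rewrite /= cstar0.
- move=> c x1 x2 [h1 h2] [h3 h4]; split; first exact: IL.
  by rewrite cstarD cstarZ; exact: IL.
- move=> x1 x2 [h1 h2] [h3 h4]; split; first exact: Ir.
  by rewrite cstarM; exact: Ir.
- by move=> x1 [h1 h2]; split=> //; rewrite cstarK.
have -> : [set x | I x /\ I (cstar x)] = approx [set x | I x /\ I (cstar x)].
  apply/seteqP; split=> [x hx|x /approx_nlim[f hf fx]]; first exact: approx_sub.
  split; apply: closed_approxE cI _.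
    by apply: (nlim_approx _ fx) => n; case: (hf n).
  by apply: (nlim_approx _ (nlim_star fx)) => n; case: (hf n).
exact: closed_approx.
Qed.

End simplicity.

(** * The C*-algebra of adjointable operators on a pre-Hilbert space *)

(** The inner product is positive semi-definite: only the forms
    <T x, y> of operators are used, and these do not see null vectors. *)
Record preHilbert (R : realType) := PreHilbert {
  ph_space :> lmodType R[i];
  ip : ph_space -> ph_space -> R[i];
  ipDl : forall x y z, ip (x + y) z = ip x z + ip y z;
  ipZl : forall c x z, ip (c *: x) z = c * ip x z;
  ip_conj : forall x y, ip y x = (ip x y)^*;
  ip_ge0 : forall x, 0 <= ip x x }.

Section forms.
Variables (R : realType) (H : preHilbert R).
Implicit Types (x y z : H) (c : R[i]) (K L : R).

Definition hn x : R := Num.sqrt (complex.Re (ip x x)).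

Lemma hn_ge0 x : 0 <= hn x. Proof. exact: sqrtr_ge0. Qed.

Lemma ipxx x : ip x x = (hn x ^+ 2)%:C.
Proof.
rewrite /hn sqr_sqrtr; first exact/ge0_complexE/ip_ge0.
by have := ip_ge0 x; rewrite lecE => /andP[].
Qed.

Lemma ipDr x y z : ip z (x + y) = ip z x + ip z y.
Proof. by rewrite ip_conj ipDl rmorphD /= -!ip_conj. Qed.
Lemma ipZr c x z : ip z (c *: x) = c^* * ip z x.
Proof. by rewrite ip_conj ipZl rmorphM /= -ip_conj. Qed.
Lemma ipNl x z : ip (- x) z = - ip x z.
Proof. by rewrite -scaleN1r ipZl mulN1r. Qed.
Lemma ipNr x z : ip z (- x) = - ip z x.
Proof. by rewrite ip_conj ipNl rmorphN /= -ip_conj. Qed.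

(** Minimise |x - t <x, y> y|^2 over real t; for hn y = 0 the
    quadratic is affine in t and must be constant. *)
Lemma cauchy_schwarz x y : cabs (ip x y) <= hn x * hn y.
Proof.
set a := cabs _; have a0 : 0 <= a by exact: cabs_ge0.
have key (t : R) : 0 <= hn x ^+ 2 - 2 * t * a ^+ 2 + t ^+ 2 * a ^+ 2 * hn y ^+ 2.
  have := ip_ge0 (x - (t%:C * ip x y) *: y).
  rewrite ipDl !ipDr !ipNl !ipNr !ipZl !ipZr !ipxx (ip_conj x y).
  have tt : (t%:C * ip x y)^* = t%:C * (ip x y)^*.
    by rewrite rmorphM; congr (_ * _); exact: conjc_real.
  have aE : ip x y * (ip x y)^* = (a ^+ 2)%:C by rewrite -normCK cabsE rmorphXn.
  rewrite tt.
  have -> : (hn x ^+ 2)%:C + - (t%:C * (ip x y)^* * ip x y) +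
    (- (t%:C * ip x y * (ip x y)^*) -
     - (t%:C * ip x y * (t%:C * (ip x y)^* * (hn y ^+ 2)%:C))) =
    (hn x ^+ 2 - 2 * t * a ^+ 2 + t ^+ 2 * a ^+ 2 * hn y ^+ 2)%:C.
    transitivity ((hn x ^+ 2)%:C - 2 * t%:C * (ip x y * (ip x y)^*) +
      t%:C ^+ 2 * (ip x y * (ip x y)^*) * (hn y ^+ 2)%:C); first by ring.
    by rewrite aE; ring.
  by rewrite lecR.
have x0 := hn_ge0 x; have y0 := hn_ge0 y.
have [yE|yN] := eqVneq (hn y) 0.
  have [-> |aN] := eqVneq a 0; first by rewrite mulr_ge0.
  have a2 : 0 < a ^+ 2 by rewrite exprn_gt0 // lt_neqAle eq_sym aN.
  have := key ((hn x ^+ 2 + 1) / a ^+ 2).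
  rewrite yE expr0n mulr0 addr0 -mulrA divfK ?gt_eqF //.
  have := sqr_ge0 (hn x); lra.
have y2 : 0 < hn y ^+ 2 by rewrite exprn_gt0 // lt_neqAle eq_sym yN.
have := key (hn y ^+ 2)^-1.
have -> : (hn y ^+ 2)^-1 ^+ 2 * a ^+ 2 * hn y ^+ 2 = (hn y ^+ 2)^-1 * a ^+ 2.
  by field.
move=> h; have {}h : a ^+ 2 / hn y ^+ 2 <= hn x ^+ 2 by rewrite mulrC; lra.
rewrite ler_pdivrMr // -exprMn in h.
by rewrite -(@ler_pXn2r _ 2) // ?nnegrE // mulr_ge0.
Qed.

Lemma hn_sq_le x K : 0 <= K -> cabs (ip x x) <= K * hn x -> hn x <= K.
Proof.
move=> K0; rewrite ipxx cabsR ger0_norm ?sqr_ge0 // expr2.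
have [->|x0] := eqVneq (hn x) 0; first by [].
by rewrite ler_pM2r // lt_neqAle eq_sym x0 hn_ge0.
Qed.

Definition form := H -> H -> R[i]^o.

Definition bdd K (F : form) : Prop := forall x y, cabs (F x y) <= K * (hn x * hn y).

(** Bounded operators with an adjoint.  Linearity is a consequence of the
    adjoint, as far as the associated form is concerned. *)
Record bop := Bop {
  opf : H -> H;
  opa : H -> H;
  op_adj : forall x y, ip (opf x) y = ip x (opa y);
  op_bdd : exists2 K, 0 <= K & bdd K (fun x y => ip (opf x) y) }.

Definition form_of (T : bop) : form := fun x y => ip (opf T x) y.

Lemma cabsD (a b : R[i]) : cabs (a + b) <= cabs a + cabs b.
Proof. by rewrite -lecR rmorphD /= -!cabsE ler_normD. Qed.

Lemma cabsN (a : R[i]) : cabs (- a) = cabs a.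
Proof. by rewrite /cabs normrN. Qed.

Lemma bddD K L F G : bdd K F -> bdd L G -> bdd (K + L) (F + G).
Proof.
move=> h k x y; apply: le_trans (cabsD _ _) _.
by rewrite mulrDl; apply: lerD; [exact: h|exact: k].
Qed.

Lemma bddZ K F c : bdd K F -> bdd (cabs c * K) (c *: F).
Proof. by move=> h x y; rewrite [cabs _]cabsM -mulrA ler_wpM2l ?cabs_ge0. Qed.

Lemma bdd_le K L F : K <= L -> bdd K F -> bdd L F.
Proof.
move=> KL h x y; apply: le_trans (h x y) _.
by rewrite ler_wpM2r // mulr_ge0 // hn_ge0.
Qed.

Definition fstar (F : form) : form := fun x y => (F y x)^*.

Lemma bdd_fstar K F : bdd K F -> bdd K (fstar F).
Proof. by move=> h x y; rewrite cabs_conj [hn x * _]mulrC. Qed.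

Lemma bop0_adj x y : ip (0 : H) y = ip x (0 : H).
Proof. by rewrite -(scale0r x) ipZl mul0r ipZr rmorph0 mul0r. Qed.

Lemma bop0_bdd : exists2 K, 0 <= K & bdd K (fun x y => ip (0 : H) y).
Proof.
exists 0 => // x y; have -> : ip (0 : H) y = 0 by rewrite -(scale0r x) ipZl mul0r.
by rewrite mul0r /cabs normr0.
Qed.
Definition bop0 := Bop bop0_adj bop0_bdd.

Lemma bopD_adj T S x y : ip (opf T x + opf S x) y = ip x (opa T y + opa S y).
Proof. by rewrite ipDl ipDr !op_adj. Qed.
Lemma bopD_bdd T S : exists2 K, 0 <= K & bdd K (fun x y => ip (opf T x + opf S x) y).
Proof.
have [K K0 hK] := op_bdd T; have [L L0 hL] := op_bdd S.
exists (K + L); first exact: addr_ge0.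
by move=> x y; rewrite ipDl; exact: (bddD hK hL).
Qed.
Definition bopD T S := Bop (bopD_adj T S) (bopD_bdd T S).

Lemma bopZ_adj c T x y : ip (c *: opf T x) y = ip x (c^* *: opa T y).
Proof. by rewrite ipZl ipZr conjCK op_adj. Qed.
Lemma bopZ_bdd c T : exists2 K, 0 <= K & bdd K (fun x y => ip (c *: opf T x) y).
Proof.
have [K K0 hK] := op_bdd T; exists (cabs c * K); first by rewrite mulr_ge0 ?cabs_ge0.
by move=> x y; rewrite ipZl; exact: (bddZ c hK).
Qed.
Definition bopZ c T := Bop (bopZ_adj c T) (bopZ_bdd c T).

Lemma bopS_adj T x y : ip (opa T x) y = ip x (opf T y).
Proof. by rewrite ip_conj -op_adj -ip_conj. Qed.
Lemma bopS_bdd T : exists2 K, 0 <= K & bdd K (fun x y => ip (opa T x) y).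
Proof.
have [K K0 hK] := op_bdd T; exists K => // x y.
by rewrite bopS_adj ip_conj cabs_conj [hn x * _]mulrC; exact: hK.
Qed.
Definition bopS T := Bop (bopS_adj T) (bopS_bdd T).

Lemma opf_bdd K T x : 0 <= K -> bdd K (form_of T) -> hn (opf T x) <= K * hn x.
Proof.
move=> K0 h; apply: hn_sq_le; first by rewrite mulr_ge0 ?hn_ge0.
by rewrite -mulrA; exact: h.
Qed.

Lemma bopM_adj T S x y : ip (opf T (opf S x)) y = ip x (opa S (opa T y)).
Proof. by rewrite !op_adj. Qed.
Lemma bddM K L T S : 0 <= K -> 0 <= L -> bdd K (form_of T) -> bdd L (form_of S) ->
  bdd (K * L) (fun x y => ip (opf T (opf S x)) y).
Proof.
move=> K0 L0 h k x y; apply: le_trans (h _ _) _; rewrite -mulrA ler_wpM2l //.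
by rewrite mulrA ler_wpM2r ?hn_ge0 //; exact: opf_bdd.
Qed.
Lemma bopM_bdd T S : exists2 K, 0 <= K & bdd K (fun x y => ip (opf T (opf S x)) y).
Proof.
have [K K0 hK] := op_bdd T; have [L L0 hL] := op_bdd S.
by exists (K * L); [exact: mulr_ge0|exact: bddM].
Qed.
Definition bopM T S := Bop (bopM_adj T S) (bopM_bdd T S).

(** |T x|^2 = <star(T) T x, x>. *)
Lemma bdd_cstar K T : 0 <= K -> bdd (K ^+ 2) (form_of (bopM (bopS T) T)) -> bdd K (form_of T).
Proof.
move=> K0 h x y; apply: le_trans (cauchy_schwarz _ _) _.
rewrite mulrA ler_wpM2r ?hn_ge0 //.
rewrite -(@ler_pXn2r _ 2) // ?nnegrE ?mulr_ge0 ?hn_ge0 //.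
have := h x x; rewrite /form_of /= bopS_adj ipxx cabsR ger0_norm ?sqr_ge0 //.
by rewrite exprMn -expr2.
Qed.

Lemma form_ofD T S : form_of (bopD T S) = form_of T + form_of S.
Proof. by apply/funext => x; apply/funext => y; rewrite /form_of /= ipDl. Qed.
Lemma form_ofZ c T : form_of (bopZ c T) = c *: form_of T.
Proof. by apply/funext => x; apply/funext => y; rewrite /form_of /= ipZl. Qed.
Lemma form_ofS T : form_of (bopS T) = fstar (form_of T).
Proof. by apply/funext => x; apply/funext => y; rewrite /form_of /fstar /= bopS_adj ip_conj. Qed.
Lemma form_of0 : form_of bop0 = 0.
Proof.
apply/funext => x; apply/funext => y.
by rewrite /form_of /= -(scale0r x) ipZl mul0r.
Qed.

(** The completion of the operators is realised as a set of sesquilinear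
    forms: the norm closure of the forms <T x, y> among bounded forms.  This
    makes the vector space and the completeness immediate, and leaves only the
    product to be extended by continuity. *)
Definition oplim : {pred form} := fun F =>
  `[< forall e, 0 < e -> exists T, bdd e (F - form_of T) >].

Lemma oplimP F : reflect (forall e, 0 < e -> exists T, bdd e (F - form_of T)) (F \in oplim).
Proof. exact: asboolP. Qed.

Lemma bdd0 K : 0 <= K -> bdd K 0.
Proof. by move=> K0 x y; rewrite /cabs normr0 !mulr_ge0 ?hn_ge0. Qed.

Lemma oplim_form_of T : form_of T \in oplim.
Proof. by apply/oplimP => e e0; exists T; rewrite subrr; apply/bdd0/ltW. Qed.

Lemma oplim_submod_closed : submod_closed oplim.
Proof.
split; first by rewrite -form_of0 oplim_form_of.
move=> c F G /oplimP hF /oplimP hG; apply/oplimP => e e0.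
have c0 : 0 < cabs c + 1 by rewrite ltr_wpDl ?cabs_ge0.
have [|T hT] := hF (e / 2 / (cabs c + 1)); first by rewrite !divr_gt0.
have [|S hS] := hG (e / 2); first by rewrite divr_gt0.
exists (bopD (bopZ c T) S); rewrite form_ofD form_ofZ.
have -> : c *: F + G - (c *: form_of T + form_of S) = c *: (F - form_of T) + (G - form_of S).
  by rewrite scalerBr opprD addrACA.
apply: bdd_le (bddD (bddZ c hT) hS).
suff : cabs c * (e / 2 / (cabs c + 1)) <= e / 2 by lra.
by rewrite mulrCA ler_piMr ?divr_ge0 ?(ltW e0) // ler_pdivrMr // mul1r lerDl.
Qed.

HB.instance Definition _ := GRing.isSubmodClosed.Build R[i] form oplim oplim_submod_closed.

Lemma oplim_fstar F : F \in oplim -> fstar F \in oplim.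
Proof.
move=> /oplimP hF; apply/oplimP => e /hF[T hT]; exists (bopS T).
rewrite form_ofS; have -> : fstar F - fstar (form_of T) = fstar (F - form_of T).
  by apply/funext => x; apply/funext => y; apply/esym; exact: rmorphB.
exact: bdd_fstar.
Qed.

End forms.

(** Sequences suffice, because a Cauchy filter has
    elements inside balls of radius 1/(n+1). *)
Lemma complete_of_cauchy_seq (R : realType) (V : normedModType R[i]) :
  (forall u : nat -> V, (forall e : R, 0 < e -> exists N, forall n m, (N <= n)%N -> (N <= m)%N ->
     nrm (u n - u m) < e) -> exists l, nlim u l) ->
  forall Fi : set_system V, ProperFilter Fi -> cauchy Fi -> cvg Fi.
Proof.
move=> hV Fi PF /cauchyP cF.
have /choice[u hu] : forall n : nat, exists G, Fi (ball G (n.+1%:R^-1 : R)%:C).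
  by move=> n; apply: cF; rewrite ltcR invr_gt0.
have close n m : nrm (u n - u m) <= n.+1%:R^-1 + m.+1%:R^-1.
  have [G [xn xm]] := @filter_ex _ Fi PF _ (filterI (hu n) (hu m)).
  move: xn xm; rewrite -!ball_normE /= !normE !ltcR => xn xm.
  have := nrm_dist_tri G (u n) (u m); rewrite (nrm_distC G) => h.
  by apply: le_trans h _; apply: lerD; exact: ltW.
have [l ul] : exists l, nlim u l.
  apply: hV => e e0; have e2 : 0 < e / 2 by rewrite divr_gt0.
  have [N hN] := small_inv e2; exists N => n m /hN h1 /hN h2.
  by apply: le_lt_trans (close n m) _; rewrite [ltRHS]splitr; exact: ltrD.
apply/cvg_ex; exists l; apply/fcvg_ballP => c /gt0_complexE[e e0 ->].
have e2 : 0 < e / 2 by rewrite divr_gt0.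
have [N hN] := small_inv e2; have [N' hN'] := ul _ e2.
pose n := maxn N N'.
apply: filterS (hu n) => G; rewrite -!ball_normE /= !normE !ltcR => h.
have := hN _ (leq_maxl N N'); have := hN' _ (leq_maxr N N'); rewrite -/n => a1 a2.
have {}h := lt_trans h a2.
have := nrm_dist_tri (u n) l G; rewrite (nrm_distC l (u n)); lra.
Qed.

Record opalg (R : realType) (H : preHilbert R) := OpAlg {
  opform :> form H; opformP : opform \in @oplim R H }.

HB.instance Definition _ (R : realType) (H : preHilbert R) := [isSub for @opform R H].
HB.instance Definition _ (R : realType) (H : preHilbert R) := [Choice of opalg H by <:].
HB.instance Definition _ (R : realType) (H : preHilbert R) :=
  [SubChoice_isSubLmodule of opalg H by <:].

Section opalg_norm.
Variables (R : realType) (H : preHilbert R).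
Implicit Types (F G : opalg H) (K : R) (x y : H).

Definition emb (T : bop H) : opalg H := OpAlg (oplim_form_of T).

Lemma opalg_ext F G : opform F = opform G -> F = G.
Proof. exact: val_inj. Qed.

Lemma opformD F G : opform (F + G) = opform F + opform G. Proof. by []. Qed.
Lemma opformZ (c : R[i]) F : opform (c *: F) = c *: opform F. Proof. by []. Qed.

Lemma embD T S : emb (bopD T S) = emb T + emb S.
Proof. by apply: opalg_ext; rewrite opformD /= form_ofD. Qed.
Lemma embZ c T : emb (bopZ c T) = c *: emb T.
Proof. by apply: opalg_ext; rewrite opformZ /= form_ofZ. Qed.

Definition bounds F : set R := [set K | 0 <= K /\ bdd K F].
Definition opnorm F : R := inf (bounds F).

Lemma bounds_neq0 F : bounds F !=set0.
Proof.
have /oplimP/(_ 1 ltr01)[T hT] := opformP F; have [K K0 hK] := op_bdd T.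
exists (1 + K); split; first by rewrite addr_ge0.
by rewrite -[opform F](subrK (form_of T)); exact: bddD.
Qed.

Lemma opnorm_ge0 F : 0 <= opnorm F.
Proof. by apply: lb_le_inf; [exact: bounds_neq0|move=> K []]. Qed.

Lemma opnorm_le F K : 0 <= K -> bdd K F -> opnorm F <= K.
Proof. by move=> K0 h; apply: ge_inf; [exists 0 => ? []|split]. Qed.

Lemma bdd_opnorm F : bdd (opnorm F) F.
Proof.
move=> x y; have [p0|p0] := eqVneq (hn x * hn y) 0.
  by have [K [_ /(_ x y)]] := bounds_neq0 F; rewrite p0 !mulr0.
have {}p0 : 0 < hn x * hn y by rewrite lt_neqAle eq_sym p0 mulr_ge0 ?hn_ge0.
rewrite -ler_pdivrMr //; apply: lb_le_inf; first exact: bounds_neq0.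
by move=> K [_ hK]; rewrite ler_pdivrMr //; exact: hK.
Qed.

Lemma opnormD F G : opnorm (F + G) <= opnorm F + opnorm G.
Proof.
apply: opnorm_le; first by rewrite addr_ge0 ?opnorm_ge0.
by rewrite opformD; apply: bddD; exact: bdd_opnorm.
Qed.

Lemma opnorm_eq0 F : opnorm F = 0 -> F = 0.
Proof.
move=> h; apply: opalg_ext; apply/funext => x; apply/funext => y.
have := bdd_opnorm F x y; rewrite h mul0r => h'.
have /eqP : cabs (opform F x y) = 0 by apply/le_anti; rewrite h' cabs_ge0.
move=> /eqP c0; apply/eqP; rewrite -normr_eq0 cabsE c0 //.
Qed.

Lemma opnormZ (c : R[i]) F : opnorm (c *: F) = cabs c * opnorm F.
Proof.
have le (d : R[i]) G : opnorm (d *: G) <= cabs d * opnorm G.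
  apply: opnorm_le; first by rewrite mulr_ge0 ?cabs_ge0 ?opnorm_ge0.
  by rewrite opformZ; apply: bddZ; exact: bdd_opnorm.
apply/le_anti; rewrite le /=.
have [->|c0] := eqVneq c 0; first by rewrite /cabs normr0 mul0r opnorm_ge0.
have cp : 0 < cabs c by rewrite -ltcR -cabsE normr_gt0.
have := le c^-1 (c *: F); rewrite scalerA mulVf // scale1r => h.
have cV : cabs c * cabs c^-1 = 1 by rewrite -cabsM divff // /cabs normr1.
by have := ler_wpM2l (ltW cp) h; rewrite mulrA cV mul1r.
Qed.

Definition opnormC F : R[i] := (opnorm F)%:C.

Lemma opnormC_D F G : opnormC (F + G) <= opnormC F + opnormC G.
Proof. by rewrite -rmorphD lecR opnormD. Qed.
Lemma opnormC_Z (c : R[i]) F : opnormC (c *: F) = `|c| * opnormC F.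
Proof. by rewrite /opnormC opnormZ rmorphM cabsE. Qed.
Lemma opnormC_eq0 F : opnormC F = 0 -> F = 0.
Proof. by move=> /complexI; exact: opnorm_eq0. Qed.

End opalg_norm.

HB.instance Definition _ (R : realType) (H : preHilbert R) :=
  Lmodule_isNormed.Build R[i] (opalg H) (@opnormC_D R H) (@opnormC_Z R H) (@opnormC_eq0 R H).

Section opalg_complete.
Variables (R : realType) (H : preHilbert R).
Implicit Types (F G : opalg H) (K : R) (x y : H).

Lemma nrm_opnorm F : nrm F = opnorm F. Proof. by []. Qed.

Lemma complex_cauchy (c : nat -> R[i]) :
  (forall e : R, 0 < e -> exists N, forall n m, (N <= n)%N -> (N <= m)%N -> cabs (c n - c m) < e) ->
  exists l : R[i], forall e : R, 0 < e -> exists N, forall n, (N <= n)%N -> cabs (c n - l) < e.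
Proof.
move=> hc.
have ReIm_le (z : R[i]) : `|complex.Re z| <= cabs z /\ `|complex.Im z| <= cabs z.
  case: z => a b; rewrite /cabs normc_def /=.
  by split; rewrite -sqrtr_sqr ler_wsqrtr // ?lerDl ?lerDr sqr_ge0.
have rc (u : nat -> R) : (forall e : R, 0 < e -> exists N, forall n m, (N <= n)%N -> (N <= m)%N -> `|u n - u m| < e) ->
  exists l : R, forall e : R, 0 < e -> exists N, forall n, (N <= n)%N -> `|u n - l| < e.
  move=> hu; have : cauchy (u @ \oo).
    apply/cauchyP => e /hu[N hN]; exists (u N); exists N => // n /= Nn.
    by rewrite -ball_normE /=; exact: hN.
  move=> /R_complete /cvg_ex[l /cvgrPdist_lt ul]; exists l => e e0.
  by have [N _ hN] := ul e e0; exists N => n /hN; rewrite distrC.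
have [a ha] : exists l : R, forall e : R, 0 < e -> exists N, forall n, (N <= n)%N -> `|complex.Re (c n) - l| < e.
  apply: rc => e /hc[N hN]; exists N => n m Nn Nm; apply: le_lt_trans (hN _ _ Nn Nm).
  by have [h _] := ReIm_le (c n - c m); move: h; rewrite raddfB.
have [b hb] : exists l : R, forall e : R, 0 < e -> exists N, forall n, (N <= n)%N -> `|complex.Im (c n) - l| < e.
  apply: rc => e /hc[N hN]; exists N => n m Nn Nm; apply: le_lt_trans (hN _ _ Nn Nm).
  by have [_ h] := ReIm_le (c n - c m); move: h; rewrite raddfB.
exists (a +i* b) => e e0; have e2 : 0 < e / 2 by rewrite divr_gt0.
have [N hN] := ha _ e2; have [N' hN'] := hb _ e2.
exists (maxn N N') => n; rewrite geq_max => /andP[/hN h1 /hN' h2].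
have -> : c n - (a +i* b) = (complex.Re (c n) - a)%:C + 'i * (complex.Im (c n) - b)%:C.
  by case: (c n) => p q; apply/eqP; rewrite eq_complex /= !(mul0r, mulr0, mul1r, subr0, add0r, addr0) !eqxx.
apply: le_lt_trans (cabsD _ _) _; rewrite cabsM !cabsR.
have -> : cabs ('i : R[i]) = 1 by rewrite /cabs normCi.
lra.
Qed.

(** Values of the forms converge pointwise, and the bound passes
    to the limit. *)
Lemma opalg_cauchy_seq (u : nat -> opalg H) :
  (forall e : R, 0 < e -> exists N, forall n m, (N <= n)%N -> (N <= m)%N -> nrm (u n - u m) < e) ->
  exists l, nlim u l.
Proof.
move=> hu.
have /choice[f hf] : forall xy : H * H, exists l : R[i], forall e : R, 0 < e ->
    exists N, forall n, (N <= n)%N -> cabs (opform (u n) xy.1 xy.2 - l) < e.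
  move=> [x y]; apply: complex_cauchy => e e0 /=.
  have p1 : 0 < hn x * hn y + 1 by rewrite ltr_wpDl // mulr_ge0 ?hn_ge0.
  have [|N hN] := hu (e / (hn x * hn y + 1)); first by rewrite divr_gt0.
  exists N => n m Nn Nm; have /ltW h := hN _ _ Nn Nm.
  apply: le_lt_trans (bdd_opnorm (u n - u m) x y) _; rewrite -nrm_opnorm.
  have hp : 0 <= hn x * hn y by rewrite mulr_ge0 ?hn_ge0.
  apply: le_lt_trans (ler_wpM2r hp h) _.
  by rewrite mulrAC ltr_pdivrMr // ltr_pM2l // ltrDl.
pose F : form H := fun x y => f (x, y).
have near e : 0 < e -> exists N, forall n, (N <= n)%N -> bdd e (opform (u n) - F).
  move=> e0; have [|N hN] := hu e; first by [].
  exists N => n Nn x y; apply/ler_addgt0Pr => d d0.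
  have [N' hN'] := hf (x, y) _ d0; pose m := maxn N N'.
  have h1 := hN' m (leq_maxr _ _); rewrite /= in h1.
  have h2 : cabs (opform (u n) x y - opform (u m) x y) <= e * (hn x * hn y).
    apply: le_trans (bdd_opnorm (u n - u m) x y) _.
    by rewrite ler_wpM2r ?mulr_ge0 ?hn_ge0 // ltW // hN // leq_maxl.
  have -> : (opform (u n) - F) x y = (opform (u n) x y - opform (u m) x y) + (opform (u m) x y - f (x, y)).
    by rewrite addrA subrK.
  by apply: le_trans (cabsD _ _) _; apply: lerD => //; exact: ltW.
have FP : F \in @oplim R H.
  apply/oplimP => e e0; have e2 : 0 < e / 2 by rewrite divr_gt0.
  have [N /(_ N (leqnn _)) hN] := near _ e2.
  have /oplimP/(_ _ e2)[T hT] := opformP (u N); exists T.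
  have -> : F - form_of T = (-1) *: (opform (u N) - F) + (opform (u N) - form_of T).
    by rewrite scaleN1r opprB addrA subrK.
  apply: bdd_le (bddD (bddZ (-1) hN) hT).
  rewrite cabsN /cabs normr1 /=; lra.
exists (OpAlg FP) => e e0; have e2 : 0 < e / 2 by rewrite divr_gt0.
have [N hN] := near _ e2; exists N => n /hN h.
rewrite nrm_opnorm; apply: (@le_lt_trans _ _ (e / 2)); last by lra.
by apply: opnorm_le => //; exact: ltW.
Qed.

Lemma opalg_complete (Fi : set_system (opalg H)) : ProperFilter Fi -> cauchy Fi -> cvg Fi.
Proof. exact: (complete_of_cauchy_seq opalg_cauchy_seq). Qed.

End opalg_complete.

HB.instance Definition _ (R : realType) (H : preHilbert R) :=
  Uniform_isComplete.Build (opalg H) (@opalg_complete R H).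

Lemma nlim_nrm (R : realType) (V : normedModType R[i]) (u : nat -> V) l :
  nlim u l -> (fun n => nrm (u n)) @ \oo --> nrm l.
Proof.
move=> ul; apply/cvgrPdist_lt => e /ul[N hN]; exists N => // n /= /hN h.
apply: le_lt_trans h; rewrite ler_norml.
have := nrm_dist_tri l (u n) 0; have := nrm_dist_tri (u n) l 0.
rewrite !subr0 (nrm_distC l) => h1 h2; apply/andP; split; lra.
Qed.

Section product.
Variables (R : realType) (H : preHilbert R).
Implicit Types (F G : opalg H) (T S : bop H) (t s : nat -> bop H).

Local Notation E t := (fun n : nat => emb (t n)).

Lemma emb_dense F : exists t, nlim (E t) F.
Proof.
have /choice[t ht] : forall n : nat, exists T, nrm (emb T - F) <= n.+1%:R^-1.
  move=> n; have n0 : 0 < (n.+1%:R : R)^-1 by rewrite invr_gt0.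
  have /oplimP/(_ _ n0)[T hT] := opformP F; exists T; rewrite nrm_distC.
  by apply: opnorm_le => //; exact: ltW.
exists t => e /small_inv[N hN]; exists N => n /hN; exact: le_lt_trans.
Qed.

Lemma emb_eq T S : (forall x y, ip (opf T x) y = ip (opf S x) y) -> emb T = emb S.
Proof. by move=> h; apply: opalg_ext; apply/funext => x; apply/funext => y; exact: h. Qed.

Lemma emb_bdd T : bdd (nrm (emb T)) (form_of T).
Proof. exact: bdd_opnorm. Qed.

Lemma nrm_embM T S : nrm (emb (bopM T S)) <= nrm (emb T) * nrm (emb S).
Proof.
apply: opnorm_le; first by rewrite mulr_ge0 ?nrm_ge0.
by apply: bddM; rewrite ?nrm_ge0 //; exact: emb_bdd.
Qed.

Lemma embMDl T T' S : emb (bopM (bopD T T') S) = emb (bopM T S) + emb (bopM T' S).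
Proof. by rewrite -embD; apply: emb_eq. Qed.

Lemma embMDr T S S' : emb (bopM T (bopD S S')) = emb (bopM T S) + emb (bopM T S').
Proof. by rewrite -embD; apply: emb_eq => x y /=; rewrite op_adj !ipDl -!op_adj. Qed.

Lemma embMZl c T S : emb (bopM (bopZ c T) S) = c *: emb (bopM T S).
Proof. by rewrite -embZ; apply: emb_eq. Qed.

Lemma embMZr c T S : emb (bopM T (bopZ c S)) = c *: emb (bopM T S).
Proof. by rewrite -embZ; apply: emb_eq => x y /=; rewrite op_adj !ipZl -!op_adj. Qed.

Lemma embM_dist T T' S S' : nrm (emb (bopM T S) - emb (bopM T' S')) <=
  nrm (emb T - emb T') * nrm (emb S) + nrm (emb T') * nrm (emb S - emb S').
Proof.
have -> : emb T - emb T' = emb (bopD T (bopZ (-1) T')) by rewrite embD embZ scaleN1r.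
have -> : emb S - emb S' = emb (bopD S (bopZ (-1) S')) by rewrite embD embZ scaleN1r.
apply: le_trans (lerD (nrm_embM _ _) (nrm_embM _ _)).
apply: le_trans (nrmD _ _); rewrite embMDl embMDr embMZl embMZr !scaleN1r.
by rewrite addrA subrK.
Qed.

Lemma embM_close F G t t' s s' : nlim (E t) F -> nlim (E t') F -> nlim (E s) G -> nlim (E s') G ->
  forall e : R, 0 < e -> exists N, forall n m, (N <= n)%N -> (N <= m)%N ->
    nrm (emb (bopM (t n) (s n)) - emb (bopM (t' m) (s' m))) < e.
Proof.
move=> tF tF' sG sG' e e0.
have [K K0 hK] := nlim_bounded sG; have [L L0 hL] := nlim_bounded tF'.
have ek : 0 < e / 4 / K by rewrite !divr_gt0.
have el : 0 < e / 4 / L by rewrite !divr_gt0.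
have [N1 h1] := tF _ ek; have [N2 h2] := tF' _ ek.
have [N3 h3] := sG _ el; have [N4 h4] := sG' _ el.
exists (maxn (maxn N1 N2) (maxn N3 N4)) => n m.
rewrite !geq_max => /andP[/andP[/h1 a1 _] /andP[/h3 a3 _]].
move=> /andP[/andP[_ /h2 a2] /andP[_ /h4 a4]].
apply: le_lt_trans (embM_dist _ _ _ _) _.
have d1 := nrm_dist_tri F (emb (t n)) (emb (t' m)); rewrite (nrm_distC F) in d1.
have d2 := nrm_dist_tri G (emb (s n)) (emb (s' m)); rewrite (nrm_distC G) in d2.
rewrite ltr_pdivlMr // in a1; rewrite ltr_pdivlMr // in a2.
rewrite ltr_pdivlMr // mulrC in a3; rewrite ltr_pdivlMr // mulrC in a4.
have b1 : nrm (emb (t n) - emb (t' m)) * nrm (emb (s n)) <=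
    (nrm (emb (t n) - F) + nrm (emb (t' m) - F)) * K.
  by apply: ler_pM; rewrite ?nrm_ge0 //; exact: hK.
have b2 : nrm (emb (t' m)) * nrm (emb (s n) - emb (s' m)) <=
    L * (nrm (emb (s n) - G) + nrm (emb (s' m) - G)).
  by apply: ler_pM; rewrite ?nrm_ge0 //; exact: hL.
apply: le_lt_trans (lerD b1 b2) _; rewrite mulrDl mulrDr.
have -> : e = e / 4 + e / 4 + (e / 4 + e / 4) by field.
exact: (ltrD (ltrD a1 a2) (ltrD a3 a4)).
Qed.

(** The product of operators is uniformly continuous on bounded
    sets, so products of approximations converge, to a limit that does not
    depend on the approximations. *)
Lemma opmul_exists F G : exists P, forall t s, nlim (E t) F -> nlim (E s) G ->
  nlim (fun n => emb (bopM (t n) (s n))) P.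
Proof.
have [t0 t0F] := emb_dense F; have [s0 s0G] := emb_dense G.
have [P hP] := opalg_cauchy_seq (embM_close t0F t0F s0G s0G).
exists P => t s tF sG e e0; have e2 : 0 < e / 2 by rewrite divr_gt0.
have [N hN] := embM_close tF t0F sG s0G e2; have [N' hN'] := hP _ e2.
exists (maxn N N') => n; rewrite geq_max => /andP[Nn /hN' a1].
have a2 := hN _ _ Nn Nn.
apply: le_lt_trans (nrm_dist_tri (emb (bopM (t0 n) (s0 n))) _ _) _.
by rewrite [ltRHS]splitr; exact: (ltrD a2 a1).
Qed.

Definition opmul F G : opalg H := sval (cid (opmul_exists F G)).

Lemma opmulP F G t s : nlim (E t) F -> nlim (E s) G ->
  nlim (fun n => emb (bopM (t n) (s n))) (opmul F G).
Proof. by move=> tF sG; apply: (svalP (cid (opmul_exists F G))). Qed.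

Definition opstar F : opalg H := OpAlg (oplim_fstar (opformP F)).

Lemma opstar_emb T : opstar (emb T) = emb (bopS T).
Proof. by apply: opalg_ext; rewrite /= form_ofS. Qed.

Lemma opstarK F : opstar (opstar F) = F.
Proof. by apply: opalg_ext; apply/funext => x; apply/funext => y; rewrite /= /fstar conjCK. Qed.

Lemma opstarD F G : opstar (F + G) = opstar F + opstar G.
Proof. by apply: opalg_ext; apply/funext => x; apply/funext => y; exact: rmorphD. Qed.

Lemma opstarZ (c : R[i]) F : opstar (c *: F) = c^* *: opstar F.
Proof.
apply: opalg_ext; rewrite opformZ; apply/funext => x; apply/funext => y.
change ((c * opform F y x)^* = c^* * (opform F y x)^*).
exact: rmorphM.
Qed.

Lemma nrm_opstar_le F : nrm (opstar F) <= nrm F.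
Proof. by apply: opnorm_le; [exact: opnorm_ge0|apply: bdd_fstar; exact: bdd_opnorm]. Qed.

Lemma nlim_opstar (t : nat -> opalg H) F : nlim t F -> nlim (fun n => opstar (t n)) (opstar F).
Proof.
move=> tF e /tF[N hN]; exists N => n /hN; apply: le_lt_trans.
have -> : opstar (t n) - opstar F = opstar (t n - F).
  by rewrite -[- F in RHS]scaleN1r opstarD opstarZ rmorphN rmorph1 scaleN1r.
exact: nrm_opstar_le.
Qed.

Lemma nlim_bopS t F : nlim (E t) F -> nlim (E (fun n => bopS (t n))) (opstar F).
Proof.
move=> /nlim_opstar; have -> // : (fun n => opstar (emb (t n))) = E (fun n => bopS (t n)).
by apply/funext => n; exact: opstar_emb.
Qed.

Lemma nlim_bopM t s F G : nlim (E t) F -> nlim (E s) G ->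
  nlim (E (fun n => bopM (t n) (s n))) (opmul F G).
Proof. exact: opmulP. Qed.

Lemma nlim_bopD t s F G : nlim (E t) F -> nlim (E s) G ->
  nlim (E (fun n => bopD (t n) (s n))) (F + G).
Proof.
move=> tF sG; have -> : E (fun n => bopD (t n) (s n)) = fun n => emb (t n) + emb (s n).
  by apply/funext => n; exact: embD.
exact: nlimD.
Qed.

Lemma nlim_bopZ (c : R[i]) t F : nlim (E t) F -> nlim (E (fun n => bopZ c (t n))) (c *: F).
Proof.
move=> tF; have -> : E (fun n => bopZ c (t n)) = fun n => c *: emb (t n).
  by apply/funext => n; exact: embZ.
exact: nlimZ.
Qed.

(** Every identity of the C*-algebra is checked on operators and
    passes to limits by density. *)
Lemma nlim_emb_eq t s F G : (forall n, emb (t n) = emb (s n)) -> nlim (E t) F -> nlim (E s) G -> F = G.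
Proof.
move=> ts tF sG; apply: nlim_unique tF _.
by have -> : E t = E s by apply/funext.
Qed.

Lemma opmulA F G K : opmul F (opmul G K) = opmul (opmul F G) K.
Proof.
have [f hf] := emb_dense F; have [g hg] := emb_dense G; have [k hk] := emb_dense K.
apply: nlim_emb_eq (nlim_bopM hf (nlim_bopM hg hk)) (nlim_bopM (nlim_bopM hf hg) hk) => n.
exact: emb_eq.
Qed.

Lemma opmulDl F G K : opmul (F + G) K = opmul F K + opmul G K.
Proof.
have [f hf] := emb_dense F; have [g hg] := emb_dense G; have [k hk] := emb_dense K.
apply: nlim_emb_eq (nlim_bopM (nlim_bopD hf hg) hk) (nlim_bopD (nlim_bopM hf hk) (nlim_bopM hg hk)) => n.
by rewrite embMDl embD.
Qed.

Lemma opmulDr K F G : opmul K (F + G) = opmul K F + opmul K G.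
Proof.
have [f hf] := emb_dense F; have [g hg] := emb_dense G; have [k hk] := emb_dense K.
apply: nlim_emb_eq (nlim_bopM hk (nlim_bopD hf hg)) (nlim_bopD (nlim_bopM hk hf) (nlim_bopM hk hg)) => n.
by rewrite embMDr embD.
Qed.

Lemma opmulZl (c : R[i]) F G : opmul (c *: F) G = c *: opmul F G.
Proof.
have [f hf] := emb_dense F; have [g hg] := emb_dense G.
apply: nlim_emb_eq (nlim_bopM (nlim_bopZ c hf) hg) (nlim_bopZ c (nlim_bopM hf hg)) => n.
by rewrite embMZl embZ.
Qed.

Lemma opmulZr (c : R[i]) F G : opmul F (c *: G) = c *: opmul F G.
Proof.
have [f hf] := emb_dense F; have [g hg] := emb_dense G.
apply: nlim_emb_eq (nlim_bopM hf (nlim_bopZ c hg)) (nlim_bopZ c (nlim_bopM hf hg)) => n.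
by rewrite embMZr embZ.
Qed.

Lemma opstarM F G : opstar (opmul F G) = opmul (opstar G) (opstar F).
Proof.
have [f hf] := emb_dense F; have [g hg] := emb_dense G.
apply: nlim_emb_eq (nlim_bopS (nlim_bopM hf hg)) (nlim_bopM (nlim_bopS hg) (nlim_bopS hf)) => n.
exact: emb_eq.
Qed.

Lemma opnormM F G : `|opmul F G| <= `|F| * `|G|.
Proof.
have [f hf] := emb_dense F; have [g hg] := emb_dense G.
rewrite !normE -rmorphM lecR.
apply: (ler_cvg_to (nlim_nrm (nlim_bopM hf hg)) (cvgM (nlim_nrm hf) (nlim_nrm hg))).
by apply: nearW => n; exact: nrm_embM.
Qed.

Lemma nrm_emb_star T : nrm (emb (bopM (bopS T) T)) = nrm (emb T) ^+ 2.
Proof.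
have n0 := nrm_ge0 (emb T); have m0 := nrm_ge0 (emb (bopM (bopS T) T)).
apply/le_anti/andP; split.
  apply: le_trans (nrm_embM _ _) _; rewrite expr2 ler_wpM2r //.
  by rewrite -opstar_emb nrm_opstar_le.
rewrite -[leRHS]sqr_sqrtr // ler_sqr ?nnegrE ?sqrtr_ge0 //.
apply: opnorm_le; first exact: sqrtr_ge0.
apply: bdd_cstar; first exact: sqrtr_ge0.
by rewrite sqr_sqrtr //; exact: emb_bdd.
Qed.

Lemma opnorm_star F : `|opmul (opstar F) F| = `|F| ^+ 2.
Proof.
have [f hf] := emb_dense F.
rewrite !normE -rmorphXn; congr _%:C.
have h1 := nlim_nrm (nlim_bopM (nlim_bopS hf) hf).
have E2 : (fun n => nrm (emb (bopM (bopS (f n)) (f n)))) = fun n => nrm (emb (f n)) * nrm (emb (f n)).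
  by apply/funext => n; rewrite nrm_emb_star expr2.
rewrite E2 in h1.
have h2 : (fun n => nrm (emb (f n)) * nrm (emb (f n))) @ \oo --> nrm F * nrm F.
  exact: cvgM (nlim_nrm hf) (nlim_nrm hf).
by rewrite expr2 -(cvg_lim (@Rhausdorff R) h1) (cvg_lim (@Rhausdorff R) h2).
Qed.

End product.

HB.instance Definition _ (R : realType) (H : preHilbert R) :=
  CompleteNormedModule_isCStarAlgebra.Build R (opalg H) (@opmulA R H) (@opmulDl R H)
    (@opmulDr R H) (@opmulZl R H) (@opmulZr R H) (@opstarK R H) (@opstarD R H)
    (@opstarZ R H) (@opstarM R H) (@opnormM R H) (@opnorm_star R H).

Lemma emb_mul (R : realType) (H : preHilbert R) (T S : bop H) :
  cmul (emb T) (emb S) = emb (bopM T S).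
Proof.
have h : nlim (fun n : nat => emb (bopM T S)) (cmul (emb T) (emb S)).
  by apply: (opmulP (t := fun=> T) (s := fun=> S)); exact: nlim_cst.
exact: nlim_unique h (nlim_cst _).
Qed.

Lemma emb_star (R : realType) (H : preHilbert R) (T : bop H) :
  cstar (emb T) = emb (bopS T).
Proof. exact: opstar_emb. Qed.

(** * Partial bijections acting on finitely supported functions *)

Section finitely_supported.
Variables (R : realType) (X : choiceType).

Definition fsupp : {pred X -> R[i]^o} := fun f => `[< finite_set [set x | f x != 0] >].

Lemma fsuppP (f : X -> R[i]^o) : reflect (finite_set [set x | f x != 0]) (f \in fsupp).
Proof. exact: asboolP. Qed.

Lemma fsupp_submod_closed : submod_closed fsupp.
Proof.
split; first by apply/fsuppP; apply: sub_finite_set (@finite_set0 X) => x /=; rewrite eqxx.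
move=> c f g /fsuppP hf /fsuppP hg; apply/fsuppP.
have : finite_set ([set x | f x != 0] `|` [set x | g x != 0]) by rewrite finite_setU.
apply: sub_finite_set => x /=; apply: contra_neqP => /not_orP[].
move=> /negP/negPn/eqP fx /negP/negPn/eqP gx.
by rewrite -[LHS]/(c * f x + g x) fx gx mulr0 addr0.
Qed.

HB.instance Definition _ := GRing.isSubmodClosed.Build R[i] (X -> R[i]^o) fsupp
  fsupp_submod_closed.

End finitely_supported.

Record finfct (R : realType) (X : choiceType) := FinFct {
  finfct_fun :> X -> R[i]^o; finfctP : finfct_fun \in @fsupp R X }.

HB.instance Definition _ (R : realType) (X : choiceType) := [isSub for @finfct_fun R X].
HB.instance Definition _ (R : realType) (X : choiceType) := [Choice of finfct R X by <:].
HB.instance Definition _ (R : realType) (X : choiceType) :=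
  [SubChoice_isSubLmodule of finfct R X by <:].

Section ell2.
Variables (R : realType) (X : choiceType).
Implicit Types (f g h : finfct R X) (x y z : X).

Definition finfct_ip f g : R[i] := \sum_(x \in [set: X]) finfct_fun f x * (finfct_fun g x)^*.

Lemma finfct_ext f g : (forall x, finfct_fun f x = finfct_fun g x) -> f = g.
Proof. by move=> h; apply/val_inj/funext. Qed.

Lemma finfct_ipE f g (A : set X) : [set x | finfct_fun f x != 0] `<=` A ->
  finfct_ip f g = \sum_(x \in A) finfct_fun f x * (finfct_fun g x)^*.
Proof.
move=> fA; apply/esym/fsbig_widen => // x [_ /= Ax].
suff -> : finfct_fun f x = 0 by rewrite mul0r.
by apply/eqP/negPn/negP => /fA.
Qed.

Lemma finfct_ipDl f g h : finfct_ip (f + g) h = finfct_ip f h + finfct_ip g h.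
Proof.
pose A := [set x | finfct_fun f x != 0] `|` [set x | finfct_fun g x != 0].
have fA : finite_set A by rewrite finite_setU; split; apply/fsuppP/finfctP.
rewrite (@finfct_ipE f h A); last by move=> x; left.
rewrite (@finfct_ipE g h A); last by move=> x; right.
rewrite (@finfct_ipE (f + g) h A); last first.
  move=> x /=; apply: contra_neqP => /not_orP[].
  move=> /negP/negPn/eqP fx /negP/negPn/eqP gx.
  by rewrite -[LHS]/(finfct_fun f x + finfct_fun g x) fx gx addr0.
rewrite -fsbig_split //; apply: eq_fsbigr => x _.
exact: (mulrDl (finfct_fun f x) (finfct_fun g x)).
Qed.

Lemma finfct_ipZl (c : R[i]) f h : finfct_ip (c *: f) h = c * finfct_ip f h.
Proof.
by rewrite /finfct_ip mulr_fsumr; apply: eq_fsbigr => x _; exact/esym/mulrA.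
Qed.

Lemma finfct_ip_conj f g : finfct_ip g f = (finfct_ip f g)^*.
Proof.
pose A := [set x | finfct_fun f x != 0] `|` [set x | finfct_fun g x != 0].
have fA : finite_set A by rewrite finite_setU; split; apply/fsuppP/finfctP.
rewrite (@finfct_ipE f g A); last by move=> x; left.
rewrite (@finfct_ipE g f A); last by move=> x; right.
rewrite !fsbig_finite // rmorph_sum; apply: eq_bigr => x _.
by rewrite rmorphM /= conjCK mulrC.
Qed.

Lemma finfct_ip_ge0 f : 0 <= finfct_ip f f.
Proof. by apply: fsumr_ge0 => x _; exact: mul_conjC_ge0. Qed.

Definition ell2 : preHilbert R := PreHilbert finfct_ipDl finfct_ipZl finfct_ip_conj finfct_ip_ge0.

Lemma delta_fsupp x : (fun y => (y == x)%:R : R[i]^o) \in @fsupp R X.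
Proof.
apply/fsuppP; apply: sub_finite_set (finite_set1 x) => y /=.
by case: (y =P x) => // _; rewrite mulr0n eqxx.
Qed.
Definition pmass x : finfct R X := FinFct (delta_fsupp x).

Lemma pmass_ip x : finfct_ip (pmass x) (pmass x) = 1.
Proof.
rewrite (@finfct_ipE _ _ [set x]); last first.
  by move=> y /=; case: (y =P x) => // _; rewrite mulr0n eqxx.
by rewrite fsbig_set1 /= eqxx mulr1n mul1r conjC1.
Qed.

Section partial_bijection.
Variables (Q : X -> X -> Prop).
Hypothesis Qr : forall x y y', Q x y -> Q x y' -> y = y'.
Hypothesis Ql : forall x x' y, Q x y -> Q x' y -> x = x'.

(** f composed with the partial map P, extended by zero. *)
Definition pullback (P : X -> X -> Prop) (f : X -> R[i]^o) x : R[i]^o :=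
  if pselect (exists y, P x y) is left h then f (sval (cid h)) else 0.

Lemma pullbackE (P : X -> X -> Prop) (f : X -> R[i]^o) x y :
  (forall x y y', P x y -> P x y' -> y = y') -> P x y -> pullback P f x = f y.
Proof.
move=> Pr Pxy; rewrite /pullback; case: pselect => [h|[]]; last by exists y.
by congr f; apply: (Pr x) => //; exact: svalP (cid h).
Qed.

Lemma pullback0 (P : X -> X -> Prop) (f : X -> R[i]^o) x : ~ (exists y, P x y) -> pullback P f x = 0.
Proof. by rewrite /pullback; case: pselect. Qed.

Lemma pullback_fsupp (P : X -> X -> Prop) f :
  (forall x y y', P x y -> P x y' -> y = y') -> (forall x x' y, P x y -> P x' y -> x = x') ->
  pullback P f \in @fsupp R X.
Proof.
move=> Pr Pl; apply/fsuppP.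
have ff : finite_set [set x | finfct_fun f x != 0] by apply/fsuppP/finfctP.
have [inv hinv] : exists inv : X -> X, forall x y, P x y -> inv y = x.
  have /choice[inv hinv] : forall y, exists x, forall x', P x' y -> x = x'.
    move=> y; have [[x Pxy]|h] := pselect (exists x, P x y).
      by exists x => x'; exact: Pl.
    by exists y => x' Px'; case: h; exists x'.
  by exists inv => x y Pxy; exact: hinv.
apply: sub_finite_set (finite_image inv ff) => x /=.
have [[y Pxy]|h] := pselect (exists y, P x y).
  by rewrite (pullbackE _ Pr Pxy) => fy; exists y => //; exact: hinv.
by rewrite pullback0 // eqxx.
Qed.

Definition pbijf f : ell2 := FinFct (pullback_fsupp f Qr Ql).
Definition pbija f : ell2 := FinFct (@pullback_fsupp (fun x y => Q y x) f (fun x y y' => @Ql y y' x)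
  (fun x x' y => @Qr y x x')).

(** The adjoint is the pullback by the inverse: reindex the sum over
    the domain of Q as a sum over its range. *)
Lemma pbij_adj f g : ip (pbijf f) g = ip (f : ell2) (pbija g).
Proof.
rewrite /ip /= /finfct_ip.
pose dom := [set x | exists y, Q x y]; pose cod := [set y | exists x, Q x y].
have [inv hinv] : exists inv : X -> X, forall y, cod y -> Q (inv y) y.
  have /choice[inv hinv] : forall y, exists x, cod y -> Q x y.
    move=> y; have [[x Qxy]|h] := pselect (cod y); first by exists x.
    by exists y.
  by exists inv.
have Qa x y y' : (fun x y => Q y x) x y -> (fun x y => Q y x) x y' -> y = y' by exact: Ql.
rewrite -[LHS](@fsbig_widen _ _ _ _ dom) //; last first.
  by move=> x [_ /= h]; rewrite pullback0 // mul0r.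
rewrite -[RHS](@fsbig_widen _ _ _ _ cod) //; last first.
  by move=> x [_ /= h]; rewrite pullback0 // conjC0 mulr0.
rewrite (@reindex_fsbig _ _ _ _ _ inv cod dom); last first.
  split.
  - by move=> y /hinv h; exists y.
  - move=> y y'; rewrite !inE => /hinv h /hinv h' E.
    by apply: Qr h _; rewrite E.
  - by move=> x [y Qxy]; exists y; [exists x|apply: Ql (Qxy); apply: hinv; exists x].
apply: eq_fsbigr => y; rewrite inE => /hinv Qy.
by rewrite /= (pullbackE _ Qr Qy) (pullbackE _ Qa Qy).
Qed.

Lemma pbij_bdd : exists2 K : R, 0 <= K & bdd K (fun f g : ell2 => ip (pbijf f) g).
Proof.
exists 1 => // f g; rewrite mul1r; apply: le_trans (cauchy_schwarz _ _) _.
apply: ler_wpM2r; first exact: hn_ge0.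
rewrite /hn ler_wsqrtr //.
suff : ip (pbijf f) (pbijf f) <= ip (f : ell2) f by rewrite lecE => /andP[].
rewrite pbij_adj -subr_ge0 -ipNr -ipDr.
apply: fsumr_ge0 => x _; set u := pbija _.
rewrite -[finfct_fun (_ - _) x]/(finfct_fun f x - finfct_fun u x).
have Qa x0 y y' : (fun x y => Q y x) x0 y -> (fun x y => Q y x) x0 y' -> y = y' by exact: Ql.
have [[y Qyx]|h] := pselect (exists y, Q y x).
  have -> : finfct_fun u x = finfct_fun f x.
    by rewrite /u /= (pullbackE _ Qa Qyx) /= (pullbackE _ Qr Qyx).
  by rewrite subrr conjC0 mulr0.
have -> : finfct_fun u x = 0 by rewrite /u /= pullback0.
by rewrite subr0; exact: mul_conjC_ge0.
Qed.

Definition pbij : bop ell2 := @Bop R ell2 pbijf pbija pbij_adj pbij_bdd.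

End partial_bijection.

End ell2.

(** * The representation on infinite words *)

Section infinite_words.
Variables (r : nat) (A : finType) (M : 'I_r -> A -> A -> int) (hM : admissible M).
Implicit Types (m n x y z : natvec r) (u v w : words M) (f g : natvec r -> A).

Definition infinite_word f : Prop := forall x j, M j (f (x + unit_vec j)) (f x) = 1.

Lemma infinite_word_on m f : infinite_word f -> word_on M m f.
Proof. by move=> h x j _. Qed.
Arguments infinite_word_on m {f}.

Lemma infinite_word_shift m f : infinite_word f -> infinite_word (fun x => f (x + m)).
Proof. by move=> h x j; rewrite addrAC. Qed.
Arguments infinite_word_shift m {f}.

Lemma infinite_word_concat m n f u v w : infinite_word f ->
  tag u = m -> (forall x, lev x m -> wval u x = f x) ->
  tag v = n -> (forall x, lev x n -> wval v x = f (x + m)) ->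
  tag w = m + n -> (forall x, lev x (m + n) -> wval w x = f x) -> w = concat u v.
Proof.
move=> hf tu hu tv hv tw hw; apply: (concat_unique hM).
- by rewrite trmE orgE tu hu // hv // add0r.
- by rewrite tu tv.
- by rewrite tu => x hx; rewrite hu // hw //; exact: lev_trans hx _.
- by rewrite tu tv => x hx; rewrite hv // hw // addrC; apply: lev_add.
Qed.

(** Every finite restriction is determined by (H1). *)
Lemma infinite_word_unique m f g : infinite_word f -> infinite_word g -> (forall x, lev x m -> f x = g x) ->
  (forall x, f (x + m) = g (x + m)) -> f =1 g.
Proof.
move=> hf hg fg fgm n.
have [u [tu hu]] := word_of (infinite_word_on m hf).
have [v [tv hv]] := word_of (infinite_word_on n (infinite_word_shift m hf)).
have [w [tw hw]] := word_of (infinite_word_on (m + n) hf).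
have [w' [tw' hw']] := word_of (infinite_word_on (m + n) hg).
have E := infinite_word_concat hf tu hu tv hv tw hw.
have E' : w' = concat u v.
  apply: (infinite_word_concat hg tu _ tv _ tw' hw') => x hx.
    by rewrite hu // fg.
  by rewrite hv // fgm.
by rewrite -hw // -hw' // E E'.
Qed.

(** Concatenate v with the restrictions of f to growing boxes;
    uniqueness in (H1) makes the results compatible, and the value at z is read
    off the concatenation with the restriction to [0, z]. *)
Lemma infinite_word_cat v f : infinite_word f -> trm v = f 0 -> exists g, [/\ infinite_word g,
  forall x, lev x (tag v) -> g x = wval v x & forall x, g (x + tag v) = f x].
Proof.
move=> hf vf.
have /choice[t ht] : forall z, exists w, tag w = z /\ forall x, lev x z -> wval w x = f x.
  by move=> z; apply: word_of; exact: infinite_word_on.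
have vt z : trm v = org (t z) by have [tz hz] := ht z; rewrite orgE hz.
pose c z := concat v (t z).
have cP z : [/\ tag (c z) = tag v + z, forall x, lev x (tag v) -> wval (c z) x = wval v x
    & forall x, lev x z -> wval (c z) (x + tag v) = f x].
  have [h1 h2 h3] := concatP hM (vt z); have [tz hz] := ht z; split=> //.
    by rewrite h1 tz.
  by move=> x hx; rewrite h3 ?hz ?tz.
have cons z z' x : lev z z' -> lev x (tag v + z) -> wval (c z') x = wval (c z) x.
  move=> zz hx; have [h1 h2 h3] := cP z; have [h1' h2' h3'] := cP z'.
  have vz : lev (tag v + z) (tag (c z')) by rewrite h1'; apply: lev_add.
  have [d [td hd]] := word_of (word_on_sub vz (word_on_wval (c z'))).
  have [tz hz] := ht z.
  suff <- : d = c z by rewrite hd.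
  apply: (concat_unique hM) => // [|y hy|y]; first by rewrite td tz.
    by rewrite hd ?h2' //; exact: lev_trans hy _.
  rewrite tz => hy; rewrite hd; last by rewrite addrC; apply: lev_add.
  by rewrite h3' ?hz //; exact: lev_trans hy zz.
exists (fun z => wval (c z) z); split.
- move=> x j; have -> : wval (c x) x = wval (c (x + unit_vec j)) x by rewrite (cons x).
  have [tc _ _] := cP (x + unit_vec j).
  by apply: word_on_wval; rewrite tc; exact: lev_addl.
- by move=> x hx; have [_ h _] := cP x; exact: h.
- by move=> x; have [_ _ h] := cP (x + tag v); apply: h.
Qed.

(** Iterate concatenation with words that are positive in
    every direction. *)
Lemma infinite_word_exists a : exists2 f, infinite_word f & f 0 = a.
Proof.
have /choice[e he] : forall b, exists w, org w = b /\ forall i, (0 < tag w i)%N.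
  by move=> b; exact: long_word.
have [w0 [_ [_ ow0]]] := letter_word M a.
pose c k := iter k (fun w => concat w (e (trm w))) w0.
have ce k : trm (c k) = org (e (trm (c k))) by rewrite (he _).1.
have cS k : [/\ tag (c k.+1) = tag (c k) + tag (e (trm (c k))) &
    forall x, lev x (tag (c k)) -> wval (c k.+1) x = wval (c k) x].
  by have [h1 h2 _] := concatP hM (ce k).
have clev k l : (k <= l)%N -> lev (tag (c k)) (tag (c l)).
  move=> kl; rewrite -(subnKC kl); elim: (l - k)%N => [|d IH]; first by rewrite addn0.
  by rewrite addnS; have [-> _] := cS (k + d)%N; exact: lev_trans IH _.
have cval k l x : (k <= l)%N -> lev x (tag (c k)) -> wval (c l) x = wval (c k) x.
  move=> kl hx; rewrite -(subnKC kl); elim: (l - k)%N => [|d IH]; first by rewrite addn0.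
  rewrite addnS; have [_ h] := cS (k + d)%N; rewrite h //.
  exact: lev_trans hx (clev _ _ (leq_addr _ _)).
have ck k i : (k <= tag (c k) i)%N.
  elim: k => // k IH; have [-> _] := cS k; rewrite addvE.
  by have := (he (trm (c k))).2 i; lia.
(* the N x-th stage of the iteration contains x in its box *)
pose N x := \sum_i x i.
have cN x : lev x (tag (c (N x))).
  move=> i; apply: leq_trans (ck _ _).
  by rewrite /N (bigD1 i) //= leq_addr.
have NS x j : (N x <= N (x + unit_vec j)%R)%N.
  by apply: leq_sum => i _; rewrite addvE leq_addr.
exists (fun x => wval (c (N x)) x).
  move=> x j; rewrite -(cval _ _ x (NS x j)) //.
  by apply: word_on_wval; exact: cN.
have -> : N 0 = 0%N by rewrite /N big1 // => i _; rewrite zerovE.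
by rewrite /c /= -orgE.
Qed.

End infinite_words.
Arguments infinite_word_on {r A M} m {f}.
Arguments infinite_word_shift {r A M} m {f}.

Section decorated_infinite_words.
Variables (r : nat) (A : finType) (M : 'I_r -> A -> A -> int) (hM : admissible M).
Variables (D : countType) (delta : D -> A).
Local Notation dw := (dword M delta).

Record dinf := DInf { xd : D; xw : natvec r -> A; xwP : infinite_word M xw; xoP : xw 0 = delta xd }.

HB.instance Definition _ := gen_eqMixin dinf.
HB.instance Definition _ := gen_choiceMixin dinf.

Implicit Types (u v : dw) (w : words M) (p q : dinf) (x : natvec r).

Lemma dinf_ext (p q : dinf) : xd p = xd q -> xw p =1 xw q -> p = q.
Proof.
case: p q => [d f hf of1] [d' f' hf' of2] /= E /funext E'.
by case: _ / E of2 => of2; case: _ / E' hf' of2 => hf' of2; congr DInf; exact: Prop_irrelevance.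
Qed.

Definition cyl (u : dw) (p : dinf) : Prop :=
  deco u = xd p /\ forall x, lev x (dshape u) -> xw p x = dval u x.

(** The partial bijection u x -> v x of infinite words, as a relation; the
    inverse and the composition are then immediate. *)
Definition swap (u v : dw) (p q : dinf) : Prop :=
  [/\ cyl u p, cyl v q & forall x, xw p (x + dshape u) = xw q (x + dshape v)].

Lemma swap_sym u v p q : swap u v p q -> swap v u q p.
Proof. by move=> [h1 h2 h3]; split. Qed.

Lemma swap_r u v p q q' : swap u v p q -> swap u v p q' -> q = q'.
Proof.
move=> [_ [d1 h1] t1] [_ [d2 h2] t2]; apply: dinf_ext; first by rewrite -d1.
apply: (@infinite_word_unique _ _ _ hM (dshape v)); try exact: xwP.
  by move=> x hx; rewrite h1 // h2.
by move=> x; rewrite -t1.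
Qed.

Lemma swap_l u v p p' q : swap u v p q -> swap u v p' q -> p = p'.
Proof. by move=> /swap_sym h /swap_sym; exact: swap_r. Qed.

(** The only place where t(u) = t(v) matters: the tail of p after u
    can be attached to v. *)
Lemma swap_exists (u v : dw) p : dtrm u = dtrm v -> cyl u p -> exists q, swap u v p q.
Proof.
move=> uv hp; have [d h] := hp.
have hv : trm (dunder v) = (fun x => xw p (x + dshape u)) 0.
  by rewrite -[LHS]uv add0r h.
have [g [gi g1 g2]] := infinite_word_cat hM (infinite_word_shift (dshape u) (xwP p)) hv.
have go : g 0 = delta (deco v) by rewrite g1 // -orgE org_dunder.
by exists (DInf gi go); split.
Qed.

Lemma swap_comp u v (w : dw) p q z : swap u v p q -> swap v w q z -> swap u w p z.
Proof. by move=> [h1 h2 h3] [k1 k2 k3]; split=> // x; rewrite h3. Qed.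

Lemma cyl_split j u p : cyl u p -> exists w, [/\ tag w = unit_vec j, dtrm u = org w &
  cyl (dconcat u w) p].
Proof.
move=> [d h].
have [w [tw hw]] := word_of (infinite_word_on (unit_vec j) (infinite_word_shift (dshape u) (xwP p))).
have uw : dtrm u = org w by rewrite orgE hw // add0r h.
exists w; split=> //; split=> // x.
have [c [tc hc]] := word_of (infinite_word_on (dshape u + unit_vec j) (xwP p)).
rewrite dconcat_shape // tw => hx; rewrite -hc // /dval /=; congr wval.
by apply: (infinite_word_concat hM (xwP p) (erefl (dshape u)) _ tw hw tc hc) => y /h.
Qed.

Lemma cyl_concat u w p : dtrm u = org w -> cyl (dconcat u w) p -> cyl u p.
Proof.
move=> uw [d h]; split=> // x hx; rewrite h ?(dvalL hM uw) //.
by rewrite dconcat_shape //; exact: lev_trans hx _.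
Qed.

Lemma cyl_unique u v p : dshape u = dshape v -> cyl u p -> cyl v p -> u = v.
Proof.
move=> uv [d h] [d' h']; apply: dword_ext => //; first by rewrite d.
by move=> x hx; rewrite -h // -h' // -uv.
Qed.

Lemma cyl_tail u w p x : dtrm u = org w -> cyl (dconcat u w) p -> lev x (tag w) ->
  xw p (x + dshape u) = wval w x.
Proof.
move=> uw [_ h] hx; rewrite h; first by rewrite (dvalR hM).
by rewrite dconcat_shape // addrC; apply: lev_add.
Qed.

Lemma swap_concat u v w p q : dtrm u = org w -> dtrm v = org w ->
  swap (dconcat u w) (dconcat v w) p q -> swap u v p q.
Proof.
move=> uw vw [h1 h2 h3]; split; [exact: cyl_concat h1|exact: cyl_concat h2|].
apply: (@infinite_word_unique _ _ _ hM (tag w)); [exact/infinite_word_shift/xwP|exact/infinite_word_shift/xwP| |].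
  by move=> x hx; rewrite (cyl_tail uw h1) // (cyl_tail vw h2).
move=> x; have := h3 x; rewrite !dconcat_shape //.
by rewrite -!addrA ![tag w + _]addrC.
Qed.

(** A point of the cylinder of u lies in the cylinder of exactly one
    extension of u by a word of shape e_j. *)
Lemma swap_expand j u v p q : dtrm u = dtrm v -> swap u v p q -> exists w,
  [/\ tag w = unit_vec j, dtrm u = org w & swap (dconcat u w) (dconcat v w) p q].
Proof.
move=> uv h; have [h1 h2 h3] := h; have [w [tw uw hw]] := cyl_split j h1.
have vw : dtrm v = org w by rewrite -uv.
have ew : dtrm (dconcat u w) = dtrm (dconcat v w) by rewrite !dconcat_trm.
exists w; split=> //; have [q' hq'] := swap_exists ew hw.
by rewrite (swap_r h (swap_concat uw vw hq')).
Qed.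

Section representation.
Variable (R : realType).
Local Notation HS := (ell2 R dinf).

Definition word_rep_op (u v : dw) : bop HS := pbij R (@swap_r u v) (@swap_l u v).
Definition word_rep (u v : dw) : opalg HS := emb (word_rep_op u v).

Lemma word_rep_opE u v (f : HS) p q : swap u v p q -> finfct_fun (opf (word_rep_op u v) f) p = finfct_fun f q.
Proof. by move=> h; rewrite /= (pullbackE _ (@swap_r u v) h). Qed.

Lemma word_rep_op0 u v (f : HS) p : ~ (exists q, swap u v p q) -> finfct_fun (opf (word_rep_op u v) f) p = 0.
Proof. exact: pullback0. Qed.

Lemma word_rep_mul u v (w : dw) : dtrm u = dtrm v -> dtrm v = dtrm w -> cmul (word_rep u v) (word_rep v w) = word_rep u w.
Proof.
move=> uv vw; rewrite emb_mul; apply: emb_eq => f g; congr (ip _ g).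
apply: finfct_ext => p.
have [[z pz]|h] := pselect (exists z, swap u w p z).
  rewrite (word_rep_opE _ pz); have [pu _ _] := pz.
  have [q pq] := swap_exists uv pu.
  rewrite [LHS](word_rep_opE (opf (word_rep_op v w) f) pq).
  by apply: word_rep_opE; apply: swap_comp (swap_sym pq) pz.
rewrite (word_rep_op0 f h).
have [[q pq]|h'] := pselect (exists q, swap u v p q); last exact: word_rep_op0.
rewrite [LHS](word_rep_opE (opf (word_rep_op v w) f) pq) word_rep_op0 // => -[z qz].
by apply: h; exists z; exact: swap_comp pq qz.
Qed.

Lemma word_rep_star u v : cstar (word_rep u v) = word_rep v u.
Proof.
rewrite emb_star; apply: emb_eq => f g; congr (ip _ g); apply: finfct_ext => p.
have [[q pq]|h] := pselect (exists q, swap v u p q).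
  have Pr a b b' : (fun p q => swap u v q p) a b -> (fun p q => swap u v q p) a b' -> b = b'.
    exact: swap_l.
  by rewrite (word_rep_opE _ pq); exact: (pullbackE _ Pr (swap_sym pq)).
rewrite (word_rep_op0 f h) /=; apply: (pullback0 (P := fun p q => swap u v q p)).
by move=> [q qp]; apply: h; exists q; exact: swap_sym.
Qed.

Lemma emb_sum (I : Type) (s : seq I) (T : I -> bop HS) (S : bop HS) :
  (forall f p, finfct_fun (opf S f) p = \sum_(i <- s) finfct_fun (opf (T i) f) p) ->
  emb S = \sum_(i <- s) emb (T i).
Proof.
move=> h; apply: opalg_ext; apply/funext => f; apply/funext => g.
have -> : opform (\sum_(i <- s) emb (T i)) f g = \sum_(i <- s) ip (opf (T i) f) g.
  by elim/big_rec2: _ => // i y x _ <-.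
have -> : \sum_(i <- s) ip (opf (T i) f) g = ip (\sum_(i <- s) opf (T i) f) g.
  elim/big_rec2: _ => [|i y x _ ->]; last by rewrite ipDl.
  by rewrite -(scale0r (0 : HS)) ipZl mul0r.
congr (ip _ g); apply: finfct_ext => p; rewrite h.
elim/big_rec2: _ => // i y x _ -> //.
Qed.

Lemma word_rep_relations : AD_relations word_rep.
Proof.
split.
- by move=> u v uv; rewrite word_rep_star !word_rep_mul.
- by move=> u v _; exact: word_rep_star.
- exact: word_rep_mul.
- move=> u v uv j.
  rewrite (big_wseq _ _ (fun w => word_rep (dconcat u w) (dconcat v w))).
  apply: emb_sum => f p.
  have hw w : w \in wseq M (unit_vec j) (dtrm u) -> [/\ tag w = unit_vec j, dtrm u = org w & dtrm v = org w].
    by move=> /mem_wseq[tw ow]; split=> //; rewrite -uv.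
  have [[q pq]|h] := pselect (exists q, swap u v p q).
    have [w [tw uw pw]] := swap_expand j uv pq.
    rewrite (word_rep_opE _ pq) (bigD1_seq w) ?wseq_uniq //; last exact/mem_wseq.
    rewrite (word_rep_opE f pw) big_seq_cond big1 => [|w' /andP[/hw[tw' uw' vw'] ww']].
      exact/esym/addr0.
    apply: word_rep_op0 => -[q' [h1 _ _]]; have [h2 _ _] := pw.
    have sh : dshape (dconcat u w') = dshape (dconcat u w) by rewrite !dconcat_shape // tw tw'.
    have [_ E] := dconcat_inj hM uw' uw (erefl _) (cyl_unique sh h1 h2).
    by rewrite E eqxx in ww'.
  rewrite (word_rep_op0 f h) big_seq big1 // => w /hw[tw uw vw].
  by apply: word_rep_op0 => -[q pq]; apply: h; exists q; exact: swap_concat uw vw pq.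
- move=> u v u0 v0 uv; rewrite emb_mul -(scale0r (emb (word_rep_op u v))) -embZ.
  apply: emb_eq => f g; congr (ip _ g); apply: finfct_ext => p.
  have -> : finfct_fun (opf (bopZ 0 (word_rep_op u v)) f) p = 0 by exact: mul0r.
  have [[q pq]|h] := pselect (exists q, swap u u p q); last exact: word_rep_op0.
  rewrite [LHS](word_rep_opE (opf (word_rep_op v v) f) pq); apply: word_rep_op0 => -[z [h1 _ _]].
  have [_ h2 _] := pq; apply: uv; apply: (@cyl_unique _ _ q) => //.
  by rewrite u0 v0.
Qed.

(** The projection of a decoration fixes the point mass at any
    infinite word with that decoration. *)
Lemma word_rep_neq0 (d : D) : exists u : dw, word_rep u u != 0.
Proof.
have [f fi f0] := infinite_word_exists hM (delta d); pose p := DInf fi f0.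
have [u [ud u0]] := dletter M delta d.
have up : cyl u p.
  split=> //; rewrite u0 => x hx.
  have -> : x = 0 by apply/ffunP => i; have := hx i; rewrite zerovE leqn0 => /eqP.
  by rewrite /= f0 -ud -org_dunder.
have pp : swap u u p p by split.
exists u; apply/eqP => /(congr1 (fun F : opalg HS => opform F (pmass R p) (pmass R p))).
have -> : opform (0 : opalg HS) (pmass R p) (pmass R p) = 0 by [].
move=> /eqP; rewrite -[X in X == _]/(finfct_ip (opf (word_rep_op u u) (pmass R p)) (pmass R p)).
have -> : opf (word_rep_op u u) (pmass R p) = pmass R p.
  apply: finfct_ext => q; have [[q' qq]|h] := pselect (exists q', swap u u q q').
    rewrite (word_rep_opE _ qq); suff -> : q' = q by [].
    have [h1 _ _] := qq; apply: (swap_r qq); split=> //.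
  rewrite (word_rep_op0 _ h) /=; case: eqP => // qp; case: h; exists p; by rewrite qp.
by rewrite pmass_ip oner_eq0.
Qed.

End representation.

End decorated_infinite_words.

(** * Simplicity *)

Theorem theorem5p9 (R : realType) (r : nat) (A : finType)
  (M : 'I_r -> A -> A -> int) (D : countType) (delta : D -> A)
  (hr : (1 <= r)%N) (hA : (0 < #|A|)%N) (hM : admissible M) (hD : inhabited D)
  (AD : cstarAlgType R) (s : dword M delta -> dword M delta -> AD)
  (hAD : is_AD s) :
  cstar_simple AD.
Proof.
split; last by move=> I hI; exact: (closed_ideal_trivial hM hAD hI).
case: hD => d; have [u u0] := word_rep_neq0 hM delta R d.
have [phi phiP phiE] := AD_univ hAD (word_rep_relations hM delta R).
exists (s u u); apply: contra_neq u0 => su.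
by rewrite -phiE // su -(scale0r (0 : AD)) (star_homZ phiP) scale0r.
Qed.
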